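(* For every real number $\mathrm{We}\ge10$ there exists a non-circular Crowdy--Wegmann bubble of area $\pi$ which solves the free boundary problem with Weber number $\mathrm{We}$. That is, there exist an integer $m\ge2$, an admissible parameter $b>0$ and $\lambda\in\mathbb{R}$ such that the Jordan curve $\mathcal{S}=\mathcal{S}_{m,b}$ is not a circle, its interior domain $\mathcal{B}^{\mathrm{in}}$ has area $\pi$, and, with $\mathcal{B}^{\mathrm{out}}$ the exterior domain of $\mathcal{S}$, the function $\psi=\psi_{m,b}\colon\mathcal{B}^{\mathrm{out}}\to\mathbb{R}$ satisfies $$-\Delta\psi=0 \text{ in } \mathcal{B}^{\mathrm{out}},\qquad \psi=0 \text{ on } \mathcal{S},\qquad \psi(x)=\log|x|+O(1)\text{ as }|x|\to\infty,$$ $$-\tfrac12\,\mathrm{We}\,(\partial_n\psi)^2+\kappa=\lambda\quad\text{on }\mathcal{S}.$$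
   Context: Identify $\mathbb{R}^2$ with $\mathbb{C}$ and let $\mathbb{D}$ be the open unit disc. For an integer $m\ge2$ and $b\ge0$ define $$\Phi_{m,b}(\zeta)=\zeta+\frac{4mb\,\zeta}{(m-1)(\zeta^m+(m-1)b)},\qquad\text{so that}\qquad \Phi_{m,b}'(\zeta)=\left(\frac{\zeta^m-(m+1)b}{\zeta^m+(m-1)b}\right)^2.$$ The parameter $b$ is called admissible (for $m$) if $\Phi_{m,b}$ is univalent (holomorphic and injective) in $\mathbb{C}\setminus\overline{\mathbb{D}}$ and its boundary trace on $\partial\mathbb{D}$ is injective. For admissible $b$, $\Phi_{m,b}(\partial\mathbb{D})$ is a Jordan curve enclosing area $\pi\mathfrak{a}_m(b)>0$, where $$\mathfrak{a}_m(b)=1-\frac{16m^2b^2}{m-1}\,\frac{1+(m-1)b^2}{(1-(m-1)^2b^2)^2}.$$ Set $\widehat\Phi_{m,b}=\mathfrak{a}_m(b)^{-1/2}\Phi_{m,b}$ and $\mathcal{S}_{m,b}=\widehat\Phi_{m,b}(\partial\mathbb{D})$ (a Jordan curve enclosing area $\pi$), and define $\psi_{m,b}$ on the exterior of $\mathcal{S}_{m,b}$ by $\psi_{m,b}(\widehat\Phi_{m,b}(\zeta))=\log|\zeta|$ for $|\zeta|>1$. The Crowdy--Wegmann bubbles are these pairs $(\mathcal{S}_{m,b},\psi_{m,b})$. $n$ is the unit normal on $\mathcal{S}$ pointing from $\mathcal{B}^{\mathrm{in}}$ into $\mathcal{B}^{\mathrm{out}}$, $\partial_n\psi$ is the normal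 derivative taken from $\mathcal{B}^{\mathrm{out}}$, and $\kappa$ is the signed curvature of $\mathcal{S}$, positive when $\mathcal{B}^{\mathrm{in}}$ is convex and equal to $1$ for the unit circle. *)

(* Defs.v *)
From HB Require Import structures.
From mathcomp Require Import all_boot all_order all_algebra.
From mathcomp Require Import complex.
From mathcomp Require Import all_classical all_reals all_analysis.

Set Implicit Arguments.
Unset Strict Implicit.
Unset Printing Implicit Defensive.

Import Order.TTheory GRing.Theory Num.Theory.
Import numFieldNormedType.Exports.
Import ComplexField.Normc.

Local Open Scope classical_set_scope.
Local Open Scope ring_scope.
Local Open Scope complex_scope.

(* The plane R^2 = C.  The regular module [R[i]^o] carries the topology and
   the R[i]-normed structure of R[i], so [derivable f z 1] is complex
   differentiability; [normc z : R] is the modulus. *)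
Notation plane R := (R[i]^o).

Section Plane.
Variable R : realType.
Local Notation C := (plane R).
Implicit Types (A U S : set C) (z w p n v : C).

(* Euclidean scalar product. *)
Definition dot z w : R := complex.Re z * complex.Re w + complex.Im z * complex.Im w.

Definition unit_circle : set C := [set z | normc z = 1].

Definition unit_disc_ext : set C := [set z | 1 < normc z].

Definition is_circle S : Prop :=
  exists (c : C) (r : R), 0 < r /\ S = [set z | normc (z - c) = r].

Definition area A : \bar R :=
  ((@lebesgue_measure R) \x (@lebesgue_measure R))%E
    [set xy : R * R | A (xy.1 +i* xy.2)].

(* For a Jordan curve S these are the bounded and the unbounded component of
   the complement of S. *)
Definition inner_domain S : set C :=
  [set z | ~ S z /\ bounded_set (connected_component (~` S) z)].

Definition outer_domain S : set C :=
  [set z | ~ S z /\ ~ bounded_set (connected_component (~` S) z)].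

Definition on_line (f : C -> R) z v (t : R) : R := f (z + t%:C * v).

(* Real directional derivative; v = 1 and v = i give the two partials. *)
Definition ddir v (f : C -> R) z : R := derive1 (on_line f z v) 0.

Definition C1_on U (f : C -> R) : Prop :=
  forall v, v = 1 \/ v = 'i -> forall z, U z ->
    derivable (on_line f z v) 0 1 /\ {for z, continuous (ddir v f)}.

Definition C2_on U (f : C -> R) : Prop :=
  C1_on U f /\ forall v, v = 1 \/ v = 'i -> C1_on U (ddir v f).

Definition laplacian (f : C -> R) z : R :=
  ddir 1 (ddir 1 f) z + ddir 'i (ddir 'i f) z.

Definition velocity (g : R -> C) (t : R) : C :=
  derive1 (fun s => complex.Re (g s)) t +i* derive1 (fun s => complex.Im (g s)) t.

Definition C1_curve (g : R -> C) : Prop :=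
  [/\ forall t, derivable (fun s => complex.Re (g s) : R) t 1,
      forall t, derivable (fun s => complex.Im (g s) : R) t 1
    & continuous (velocity g)].

(* g is a regular C^2 parametrization of the Jordan curve S. *)
Definition jordan_param S (g : R -> C) : Prop :=
  [/\ C1_curve g /\ C1_curve (velocity g),
      forall t, velocity g t != 0,
      forall t, g (t + 2 * pi) = g t,
      set_inj `[0, 2 * pi[ g
    & range g = S].

(* The unit normal to S at g t pointing from the inner domain into the outer
   domain. *)
Definition outer_unit_normal S (g : R -> C) (t : R) n : Prop :=
  [/\ normc n = 1,
      dot n (velocity g t) = 0
    & \forall h \near 0^'+, outer_domain S (g t + h%:C * n) /\
                            inner_domain S (g t - h%:C * n)].

(* Signed curvature relative to the outer unit normal n: it does not depend on
   the orientation of g, and equals 1 for the unit circle, where n = g and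
   g'' = - g for the arc length parametrization. *)
Definition curvature (g : R -> C) n (t : R) : R :=
  - dot (velocity (velocity g) t) n / normc (velocity g t) ^+ 2.

(* Derivative of f at p in direction n, from the side into which n points. *)
Definition has_normal_derivative (f : C -> R) p n (d : R) : Prop :=
  (f (p + h%:C * n) - f p) / h @[h --> 0^'+] --> d.

(* psi is defined on the outer domain and extended to S by its boundary values;
   its values in the inner domain are irrelevant. *)
Definition solves_free_boundary_problem (We lambda : R) S (psi : C -> R) : Prop :=
  [/\ C2_on (outer_domain S) psi /\
        (forall z, outer_domain S z -> - laplacian psi z = 0),
      {within S `|` outer_domain S, continuous psi} /\
        (forall z, S z -> psi z = 0),
      exists M r : R, forall z, outer_domain S z -> r < normc z ->
        `|psi z - ln (normc z)| <= M
    & exists2 g : R -> C, jordan_param S g &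
        forall t, exists n (d : R),
          [/\ outer_unit_normal S g t n,
              has_normal_derivative psi (g t) n d
            & - (2^-1 * We * d ^+ 2) + curvature g n t = lambda]].

Section CrowdyWegmann.
Variables (m : nat) (b : R).

Definition Phi (z : C) : C :=
  z + (4 * m%:R * b)%:C * z / ((m%:R - 1)%:C * (z ^+ m + ((m%:R - 1) * b)%:C)).

(* A pole of Phi, where [/] returns a junk value, is excluded from the exterior
   of the disc by differentiability. *)
Definition admissible : Prop :=
  [/\ forall z, unit_disc_ext z -> derivable Phi z 1,
      set_inj unit_disc_ext Phi
    & set_inj unit_circle Phi].

Definition area_factor : R :=
  1 - 16 * m%:R ^+ 2 * b ^+ 2 / (m%:R - 1) *
      ((1 + (m%:R - 1) * b ^+ 2) / (1 - (m%:R - 1) ^+ 2 * b ^+ 2) ^+ 2).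

Definition Phi_hat (z : C) : C := ((Num.sqrt area_factor)^-1)%:C * Phi z.

Definition CW_curve : set C := Phi_hat @` unit_circle.

Definition CW_potential (psi : C -> R) : Prop :=
  forall z, unit_disc_ext z -> psi (Phi_hat z) = ln (normc z).

End CrowdyWegmann.
End Plane.

(* Main.v *)
(* Write w = z ^ m, x = (m + 1) b and y = (m + 1)^2 b / (m - 1). Only m >= 10 and 0 < x <= 1/3 are
   used. For them h(u) = 1 / Phi(1/u) has derivative ((1 - x v) / (1 + y v)) ^ 2 with
   v = u ^ m, whose real part is bounded below on a convex neighbourhood of the closed
   disc; so h, and hence Phi on a neighbourhood of the closed exterior, is expansive
   (Noshiro-Warschawski), which gives univalence, openness, and a holomorphic inverse G.
   Then psi = log |G|, and the normal derivative of psi on the curve is 1 / |F'| for the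
   scaled map F. As Phi' is the square of a Moebius function of w, the curvature is
   explicit and curvature - We/2 * (d_n psi)^2 is constant on the unit circle exactly for
   We = a^(-1/2) (m + 1) (1 - x^2) / (1 + (m - 1) b x), where a is the area factor.
   Given We >= 10 take m to be its integer part: the right-hand side is m + 1 > We at
   b = 0 and at most m <= We at x = 1/3, so the intermediate value theorem yields b.
   The area is computed in polar coordinates: the polar angle of F(e^(it)) increases
   with t, the interior is starlike, and by slicing along lines through 0 its area is
   the integral of half the squared radius, which has an elementary primitive. *)

Require Import Defs.
From mathcomp Require Import all_boot all_order all_algebra.
From mathcomp Require Import complex.
From mathcomp Require Import all_classical all_reals all_analysis.
From mathcomp Require Import measurable_realfun ring lra.
Import Order.TTheory GRing.Theory Num.Theory.
Import numFieldNormedType.Exports.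
Import ComplexField.Normc.
Set Implicit Arguments.
Unset Strict Implicit.
Unset Printing Implicit Defensive.
Local Open Scope classical_set_scope.
Local Open Scope ring_scope.
Local Open Scope complex_scope.

(** The bound 10 comes from the intermediate value argument: at x = 1/3 the right-hand side is at
    most m for m = 10, but exceeds m for m = 9. In return, m >= 10 and x <= 1/3 force y <= 11/27,
    small enough for crude estimates. The delicate point is regularity up to the curve. All bounds
    are proved on [Omega], slightly larger than the closed exterior, so that F, its inverse and psi
    exist on both sides of the curve; boundary continuity, the one-sided normal derivative and the
    direction of the normal then follow from ordinary two-sided derivatives. Holomorphy is used only
    as complex differentiability with explicit rational derivatives: expansiveness yields openness
    and a differentiable inverse by elementary means, and C^2 regularity is read off from closed
    formulas. The two domains of the curve are found by following connected sets that avoid it,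
    without the Jordan curve theorem. Since Phi has poles in the disc, the area is not an integral
    of |F'|^2 over the disc; this is why the boundary is described in polar coordinates. *)

Local Notation normc z := (ComplexField.Normc.normc (z : plane _)).

(** * Complex derivatives *)

Section ComplexDerivative.
Variable R : realType.
Local Notation C := (plane R).
Implicit Types (z w d : C) (f g : C -> C).

Lemma normcE z : `|z| = (normc z)%:C.
Proof. by []. Qed.

Lemma normc_ge0 z : 0 <= normc z.
Proof. by case: z => a b /=; rewrite sqrtr_ge0. Qed.

Lemma normc_sqr z : normc z ^+ 2 = complex.Re z ^+ 2 + complex.Im z ^+ 2.
Proof. by case: z => a b /=; rewrite sqr_sqrtr ?addr_ge0 ?sqr_ge0. Qed.

Lemma normc_eq0 z : (normc z == 0) = (z == 0).
Proof. by apply/eqP/eqP => [/eq0_normc//|->]; exact: normc0. Qed.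

Lemma normc_gt0 z : (0 < normc z) = (z != 0).
Proof. by rewrite lt_def normc_ge0 andbT normc_eq0. Qed.

Lemma normc_real (x : R) : normc (x%:C : C) = `|x|.
Proof. by rewrite /= expr0n addr0 sqrtr_sqr. Qed.

Lemma normcB z w : normc (z - w) = normc (w - z).
Proof. by rewrite -normcN opprB. Qed.

Lemma normcX z n : normc (z ^+ n) = normc z ^+ n.
Proof. by elim: n => [|n IH]; rewrite ?expr0 ?normc1// !exprS normcM IH. Qed.

Lemma le_normcB z w : normc (z - w) <= normc z + normc w.
Proof. by rewrite -[in leRHS](normcN w) le_normcD. Qed.

Lemma le_normc_dist z w : `|normc z - normc w| <= normc (z - w).
Proof.
rewrite ler_norml; apply/andP; split.
  rewrite lerNl opprB lerBlDr normcB.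
  by rewrite (le_trans _ (le_normcD _ _))// subrK.
by rewrite lerBlDr (le_trans _ (le_normcD _ _))// subrK.
Qed.

Lemma norm_Re_le z : `|complex.Re z| <= normc z.
Proof.
by rewrite -(ler_pXn2r (n:=2)) ?nnegrE ?normc_ge0// normc_sqr real_normK ?num_real// lerDl sqr_ge0.
Qed.

Lemma norm_Im_le z : `|complex.Im z| <= normc z.
Proof.
by rewrite -(ler_pXn2r (n:=2)) ?nnegrE ?normc_ge0// normc_sqr real_normK ?num_real// lerDr sqr_ge0.
Qed.

Lemma normc_le_ReIm z : normc z <= `|complex.Re z| + `|complex.Im z|.
Proof.
rewrite -(ler_pXn2r (n:=2)) ?nnegrE ?normc_ge0 ?addr_ge0//.
rewrite normc_sqr sqrrD !real_normK ?num_real// lerD2r lerDl.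
by rewrite mulrn_wge0 ?mulr_ge0.
Qed.

(** Balls of the plane have radii in [R[i]]; positivity there forces a zero imaginary part, so real
    radii describe the same neighbourhoods. *)
Lemma nbhs_normcP z (P : set C) :
  nbhs z P <-> exists2 e : R, 0 < e & forall w, normc (w - z) < e -> P w.
Proof.
split.
  move=> /nbhs_ballP[e /= e0 eP]; case: e e0 eP => a b.
  rewrite ltcE /= => /andP[/eqP-> a0] eP; exists a => // w wz.
  by apply: eP; rewrite -ball_normE /= normcE ltcE/= eqxx normcB.
move=> [e e0 eP]; apply/nbhs_ballP; exists e%:C => /=; first by rewrite ltcR.
move=> w; rewrite -ball_normE /= normcE ltcR normcB; exact: eP.
Qed.

(** First-order remainder form: the increment 0 is allowed, so the chain rule and the derivative of
    an inverse need no division by an increment that may vanish. *)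
Definition cderiv f z d := forall e : R, 0 < e -> exists2 del : R, 0 < del &
  forall w, normc w < del -> normc (f (z + w) - f z - d * w) <= e * normc w.

Lemma cderivP f z d : cderiv f z d <-> is_derive z (1 : C) f d.
Proof.
split.
  move=> h.
  have fd : (fun k : C => k^-1 *: (f (k *: (1:C) + z) - f z)) @ 0^' --> (d : C).
    apply/cvgrPdist_lt => /= e; case: e => a b.
    rewrite ltcE /= => /andP[/eqP-> a0].
    have [del del0 hd] := h (a / 2) (divr_gt0 a0 (ltr0Sn _ _)).
    apply/nbhs_normcP; exists del => // w; rewrite subr0 => wd w0.
    rewrite normcE ltcR -normcN.
    have -> : - (d - w^-1 *: (f (w *: (1:C) + z) - f z)) =
       w^-1 * (f (z + w) - f z - d * w).
      rewrite /GRing.scale /= mulr1 (addrC w z).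
      by rewrite [RHS]mulrBr mulrCA mulVf// mulr1 opprB.
    rewrite normcM normcV mulrC ltr_pdivrMr ?normc_gt0//.
    rewrite (le_lt_trans (hd _ wd))// ltr_pM2r ?normc_gt0// ltr_pdivrMr//.
    by rewrite ltr_pMr// ltr1n.
  split; last exact/cvg_lim.
  by apply/cvg_ex; exists d.
move=> [fd dE] e e0.
have : (fun k : C => k^-1 *: (f (k *: (1:C) + z) - f z)) @ 0^' --> (d : C).
  by rewrite -dE; exact: fd.
move/cvgrPdist_lt => /(_ e%:C); rewrite ltcR => /(_ e0) /nbhs_normcP[del del0 hd].
exists del => // w wd.
have [->|w0] := eqVneq w 0; first by rewrite addr0 mulr0 !subrr normc0 mulr0.
have := hd w; rewrite subr0 => /(_ wd w0).
rewrite normcE ltcR -normcN.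
have -> : - (d - w^-1 *: (f (w *: (1:C) + z) - f z)) =
       w^-1 * (f (z + w) - f z - d * w).
  rewrite /GRing.scale /= mulr1 (addrC w z).
  by rewrite [RHS]mulrBr mulrCA mulVf// mulr1 opprB.
by rewrite normcM normcV mulrC ltr_pdivrMr ?normc_gt0// => /ltW.
Qed.

Lemma cderiv_cst (c : C) z : cderiv (fun=> c) z 0.
Proof. by apply/cderivP. Qed.

Lemma cderiv_id z : cderiv id z 1.
Proof. by apply/cderivP. Qed.

Lemma cderivD f g z df dg : cderiv f z df -> cderiv g z dg ->
  cderiv (fun w => f w + g w) z (df + dg).
Proof. by move=> /cderivP ? /cderivP ?; apply/cderivP; exact: (is_deriveD (f:=f)). Qed.

Lemma cderivN f z df : cderiv f z df -> cderiv (fun w => - f w) z (- df).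
Proof. by move=> /cderivP ?; apply/cderivP; exact: (is_deriveN (f:=f)). Qed.

Lemma cderivB f g z df dg : cderiv f z df -> cderiv g z dg ->
  cderiv (fun w => f w - g w) z (df - dg).
Proof. by move=> hf hg; apply: cderivD => //; exact: cderivN. Qed.

Lemma cderivM f g z df dg : cderiv f z df -> cderiv g z dg ->
  cderiv (fun w => f w * g w) z (f z * dg + g z * df).
Proof. by move=> /cderivP ? /cderivP ?; apply/cderivP; exact: (is_deriveM (f:=f)). Qed.

Lemma cderivV f z df : f z != 0 -> cderiv f z df ->
  cderiv (fun w => (f w)^-1) z (- df / f z ^+ 2).
Proof.
move=> f0 /cderivP[df1 df2]; apply/cderivP; split; first exact: derivableV.
by rewrite deriveV// df2 /GRing.scale /= mulNr mulNr mulrC.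
Qed.

Lemma cderivX f z df n : cderiv f z df ->
  cderiv (fun w => f w ^+ n) z (n%:R * f z ^+ n.-1 * df).
Proof.
move=> /cderivP hf; apply/cderivP.
have -> : (fun w => f w ^+ n) = f ^+ n by apply/funext => w; rewrite exprfctE.
exact: is_deriveX.
Qed.

Lemma cderiv_eq f z d d' : cderiv f z d -> d = d' -> cderiv f z d'.
Proof. by move=> ? <-. Qed.

Lemma cderiv_near_eq f g z d : (\forall w \near z, f w = g w) ->
  cderiv f z d -> cderiv g z d.
Proof.
move=> fg /cderivP h; apply/cderivP; exact: near_eq_is_derive fg h.
Qed.

Lemma cderiv_bound f z d : cderiv f z d ->
  exists2 del : R, 0 < del & forall w, normc w < del ->
    normc (f (z + w) - f z) <= (normc d + 1) * normc w.
Proof.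
move=> /(_ 1 ltr01)[del del0 h]; exists del => // w /h {}h.
have -> : f (z + w) - f z = (f (z + w) - f z - d * w) + d * w by rewrite subrK.
by rewrite (le_trans (le_normcD _ _))// mulrDl addrC normcM lerD2l.
Qed.

Lemma continuous_normcP (T : topologicalType) (f : T -> C) (x : T) :
  {for x, continuous f} <->
  forall e : R, 0 < e -> \forall y \near x, normc (f y - f x) < e.
Proof.
split => [cf e e0|h].
  apply: (cf [set w | normc (w - f x) < e]).
  by apply/nbhs_normcP; exists e.
move=> P /nbhs_normcP[e e0 eP]; rewrite nbhs_simpl /=.
by apply: filterS (h e e0) => y; exact: eP.
Qed.

Lemma cderiv_continuous f z d : cderiv f z d -> {for z, continuous f}.
Proof.
move=> /cderiv_bound[del del0 h]; apply/continuous_normcP => e e0.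
apply/nbhs_normcP; exists (Num.min del (e / (normc d + 1))).
  by rewrite lt_min del0 divr_gt0// ltr_pwDr ?normc_ge0.
move=> w; rewrite lt_min => /andP[wd we].
have := h (w - z) wd; rewrite [z + _]addrC subrK => /le_lt_trans; apply.
by rewrite mulrC -ltr_pdivlMr// ltr_pwDr ?normc_ge0.
Qed.

Lemma continuous_neq0_near f z : {for z, continuous f} -> f z != 0 ->
  \forall w \near z, f w != 0.
Proof.
move=> /continuous_normcP cf fz; have fz0 : 0 < normc (f z) by rewrite normc_gt0.
apply: filterS (cf _ fz0) => w; apply: contraTneq => ->.
by rewrite sub0r normcN ltxx.
Qed.

(** Componentwise, to match [velocity]: the parameter is real while the scalars of the plane are
    complex. [pderivP] recasts it as a single estimate on the modulus. *)
Definition pderiv (g : R -> C) t (v : C) :=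
  is_derive t (1 : R) (fun s => complex.Re (g s)) (complex.Re v) /\
  is_derive t (1 : R) (fun s => complex.Im (g s)) (complex.Im v).

Lemma is_derive_dP (f : R -> R) (t d : R) : is_derive t (1 : R) f d <->
  forall e : R, 0 < e -> exists2 del : R, 0 < del &
    forall h, `|h| < del -> `|f (t + h) - f t - d * h| <= e * `|h|.
Proof.
have E (h : R) : h != 0 -> `|d - h^-1 *: (f (h *: (1:R) + t) - f t)| =
    `|f (t + h) - f t - d * h| / `|h|.
  move=> h0; rewrite -normrV ?unitfE// -normrM distrC; congr (`| _ |).
  rewrite /GRing.scale /= mulr1 (addrC h t).
  by rewrite [RHS]mulrBl mulfK// mulrC.
split.
  move=> [fd dE] e e0.
  have : (fun k : R => k^-1 *: (f (k *: (1:R) + t) - f t)) @ 0^' --> (d : R).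
    by rewrite -dE; exact: fd.
  move/cvgrPdist_le => /(_ _ e0) /nbhs_ballP[del /= del0 hd].
  exists del => // h hdel.
  have [->|h0] := eqVneq h 0; first by rewrite addr0 mulr0 !subrr normr0 mulr0.
  have := hd h; rewrite /ball /= sub0r normrN => /(_ hdel h0).
  by rewrite E// ler_pdivrMr// normr_gt0.
move=> H.
have fd : (fun k : R => k^-1 *: (f (k *: (1:R) + t) - f t)) @ 0^' --> (d : R).
  apply/cvgrPdist_le => /= e e0; have [del del0 hd] := H e e0.
  apply/nbhs_ballP; exists del => //= h; rewrite /ball /= sub0r normrN => hdel h0.
  by rewrite E// ler_pdivrMr ?normr_gt0// hd.
split; last exact/cvg_lim.
by apply/cvg_ex; exists d.
Qed.

Lemma ReM (a : R) z : complex.Re (a%:C * z) = a * complex.Re z.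
Proof. by case: z => x y /=; rewrite mul0r subr0. Qed.

Lemma ImM (a : R) z : complex.Im (a%:C * z) = a * complex.Im z.
Proof. by case: z => x y /=; rewrite mul0r addr0. Qed.

Lemma ReD z w : complex.Re (z + w) = complex.Re z + complex.Re w.
Proof. by case: z; case: w. Qed.

Lemma ImD z w : complex.Im (z + w) = complex.Im z + complex.Im w.
Proof. by case: z; case: w. Qed.

Lemma ReN z : complex.Re (- z) = - complex.Re z.
Proof. by case: z. Qed.

Lemma ImN z : complex.Im (- z) = - complex.Im z.
Proof. by case: z. Qed.

Lemma pderivP (g : R -> C) t v : pderiv g t v <->
  forall e : R, 0 < e -> exists2 del : R, 0 < del &
    forall h, `|h| < del -> normc (g (t + h) - g t - h%:C * v) <= e * `|h|.
Proof.
split.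
  move=> [/is_derive_dP hR /is_derive_dP hI] e e0.
  have e20 : 0 < e / 2 by rewrite divr_gt0.
  have [d1 d10 h1] := hR _ e20; have [d2 d20 h2] := hI _ e20.
  exists (Num.min d1 d2); first by rewrite lt_min d10.
  move=> h; rewrite lt_min => /andP[hd1 hd2].
  rewrite (le_trans (normc_le_ReIm _))// !ReD !ImD !ReN !ImN ReM ImM.
  have := lerD (h1 _ hd1) (h2 _ hd2).
  by rewrite -mulrDl -splitr ![_ * h]mulrC.
move=> H; split; apply/is_derive_dP => e /H[del del0 hd]; exists del => // h /hd;
    apply: le_trans.
  apply: le_trans (norm_Re_le _); rewrite !ReD !ReN ReM (mulrC h)//.
by apply: le_trans (norm_Im_le _); rewrite !ImD !ImN ImM (mulrC h).
Qed.

Lemma pderiv_comp f (g : R -> C) t v d : cderiv f (g t) d -> pderiv g t v ->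
  pderiv (fun s => f (g s)) t (d * v).
Proof.
move=> fd /pderivP gd; apply/pderivP => e e0.
pose M := normc v + 1; have M0 : 0 < M by rewrite ltr_pwDr ?normc_ge0.
have N0 : 0 < normc d + 1 by rewrite ltr_pwDr ?normc_ge0.
have [d1 d10 h1] := fd (e / 2 / M) (divr_gt0 (divr_gt0 e0 (ltr0Sn _ _)) M0).
have [d2 d20 h2] := gd (e / 2 / (normc d + 1)) (divr_gt0 (divr_gt0 e0 (ltr0Sn _ _)) N0).
have [d3 d30 h3] := gd 1 ltr01.
exists (Num.min d2 (Num.min d3 (d1 / M))).
  by rewrite !lt_min d20 d30 divr_gt0.
move=> h; rewrite !lt_min => /and3P[hd2 hd3 hd1].
pose k := g (t + h) - g t.
have kle : normc k <= M * `|h|.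
  have -> : k = (k - h%:C * v) + h%:C * v by rewrite subrK.
  rewrite (le_trans (le_normcD _ _))// mulrDl addrC normcM normc_real (mulrC (normc v)).
  by rewrite lerD2l h3.
have kd1 : normc k < d1.
  by rewrite (le_lt_trans kle)// mulrC -ltr_pdivlMr.
have -> : f (g (t + h)) - f (g t) - h%:C * (d * v) =
   (f (g t + k) - f (g t) - d * k) + d * (k - h%:C * v).
  by rewrite [g t + k]addrC subrK [d * (k - _)]mulrBr (mulrCA d) addrA subrK.
rewrite (le_trans (le_normcD _ _))// (splitr (e * `|h|)) lerD//.
  rewrite (le_trans (h1 _ kd1))// (le_trans (ler_wpM2l _ kle))//.
    by rewrite !divr_ge0 ?(ltW e0)// ltW.
  have -> : e / 2 / M * (M * `|h|) = e * `|h| / 2 * (M / M) by ring.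
  by rewrite divff ?mulr1// gt_eqF.
rewrite normcM (le_trans (ler_wpM2l (normc_ge0 _) (h2 _ hd2)))//.
have -> : normc d * (e / 2 / (normc d + 1) * `|h|) =
  (e * `|h| / 2) * (normc d / (normc d + 1)) by ring.
rewrite ler_piMr//; first by rewrite divr_ge0// mulr_ge0// ltW.
by rewrite ler_pdivrMr// mul1r lerDl.
Qed.
End ComplexDerivative.

Lemma connected_sub_open (T : topologicalType) (A U V : set T) :
  connected A -> open U -> open V -> A `<=` U `|` V -> U `&` V `<=` set0 ->
  A `&` U !=set0 -> A `<=` U.
Proof.
move=> cA oU oV AUV UV0 AU z Az.
suff E : A `&` U = A by have [] : (A `&` U) z by rewrite E.
apply: cA => //; first by exists U.
exists (~` V); first exact: open_closedC.
apply/seteqP; split => x [Ax Ux]; split => //.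
  by move=> Vx; exact: (UV0 x).
by have [|/Ux] := AUV _ Ax.
Qed.

(** * Differentiable inverses, open mapping and polar form *)

Section OpenMapping.
Variable R : realType.
Local Notation C := (plane R).
Implicit Types (z w d p q : C) (f g : C -> C).

Lemma bounded_setP (A : set C) :
  bounded_set A <-> exists M : R, forall z, A z -> normc z <= M.
Proof.
split.
  case => M [Mr h].
  have M1 : (M < M + 1)%R by rewrite ltrDl.
  exists (complex.Re (M + 1)) => z Az.
  have := h _ M1 z Az; rewrite /= normcE lecE => /andP[_]; exact.
move=> [M h]; exists M%:C; split; first by apply/complex_realP; exists M.
by move=> N MN z Az /=; rewrite (le_trans _ (ltW MN))// normcE lecR h.
Qed.

(** The Lipschitz bound makes the increment k of [G] of order w, so the remainder of [f] along k is
    o(w), and w = d k + o(w) can be solved for k. *)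
Lemma inverse_cderiv f (G : C -> C) p d (K : R) :
  d != 0 -> cderiv f (G p) d ->
  (\forall q \near p, f (G q) = q) ->
  (\forall q \near p, normc (G q - G p) <= K * normc (q - p)) ->
  cderiv G p d^-1.
Proof.
move=> d0 fd fG GK e e0.
have fGp : f (G p) = p := nbhs_singleton fG.
have [r r0 hr] : exists2 r : R, 0 < r & forall q, normc (q - p) < r ->
    f (G q) = q /\ normc (G q - G p) <= K * normc (q - p).
  by apply/nbhs_normcP; near=> q; split; near: q.
pose K1 := `|K| + 1; have K10 : 0 < K1 by rewrite ltr_pwDr.
have nd0 : 0 < normc d by rewrite normc_gt0.
have [del del0 hd] := fd (e * normc d / K1) (divr_gt0 (mulr_gt0 e0 nd0) K10).
exists (Num.min r (del / K1)); first by rewrite lt_min r0 divr_gt0.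
move=> w; rewrite lt_min => /andP[wr wd].
have pw : p + w - p = w by rewrite (addrC p) addrK.
have [|fw kw] := hr (p + w); first by rewrite pw.
rewrite pw in kw.
set k := G (p + w) - G p.
have kw1 : normc k <= K1 * normc w.
  rewrite (le_trans kw)// ler_wpM2r ?normc_ge0//.
  by rewrite (le_trans (ler_norm _))// lerDl.
have kd : normc k < del by rewrite (le_lt_trans kw1)// mulrC -ltr_pdivlMr.
have := hd k kd; rewrite /k [G p + _]addrC subrK fw fGp pw -/k => h.
have -> : k - d^-1 * w = - (d^-1 * (w - d * k)).
  by rewrite mulrBr mulrA mulVf// mul1r opprB.
rewrite normcN normcM normcV mulrC ler_pdivrMr//.
rewrite (le_trans h)//.
have := ler_wpM2l (ltW (divr_gt0 (mulr_gt0 e0 nd0) K10)) kw1.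
have -> : e * normc d / K1 * (K1 * normc w) = e * normc w * normc d * (K1 / K1) by ring.
by rewrite divff ?gt_eqF// mulr1.
Unshelve. all: by end_near. Qed.

Lemma mk_continuous (xy : R * R) :
  {for xy, continuous (fun xy : R * R => (xy.1 +i* xy.2 : C))}.
Proof.
apply/continuous_normcP => e e0.
have e20 : 0 < e / 2 by rewrite divr_gt0.
case: xy => x y; exists (ball x (e / 2), ball y (e / 2)) => /=.
  by split; exact: nbhsx_ballx.
move=> [u v] [/= xu yv].
suff : normc ((u +i* v : C) - (x +i* y)) < e by [].
rewrite (le_lt_trans (normc_le_ReIm _))// (splitr e) ltrD//=.
  by rewrite distrC.
by rewrite distrC.
Qed.

Lemma normc_continuous z : {for z, continuous (fun w : C => normc w : R)}.
Proof.
move=> P /nbhs_ballP[e /= e0 eP]; rewrite nbhs_simpl.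
apply/nbhs_normcP; exists e => // w wz; apply: eP.
by rewrite /ball /= distrC (le_lt_trans (le_normc_dist _ _)).
Qed.

(* Minimise |f - q| over a small square around z0: the lower Lipschitz bound
   keeps the minimiser off the boundary, and at an interior minimiser with
   f <> q a Newton step would decrease |f - q|. *)
Lemma open_image f z0 (c e : R) : 0 < c -> 0 < e ->
  (forall z, normc (z - z0) < e -> exists2 d, d != 0 & cderiv f z d) ->
  (forall z, normc (z - z0) < e -> c * normc (z - z0) <= normc (f z - f z0)) ->
  exists2 r : R, 0 < r & forall q, normc (q - f z0) < r ->
    exists2 z, normc (z - z0) < e & f z = q.
Proof.
move=> c0 e0 fd fc; case: z0 fd fc => x0 y0 fd fc.
pose a := e / 3; have a0 : 0 < a by rewrite divr_gt0.
pose box := `[x0 - a, x0 + a] `*` `[y0 - a, y0 + a] : set (R * R).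
have inbox xy : box xy -> normc ((xy.1 +i* xy.2 : C) - (x0 +i* y0)) < e.
  case: xy => x y [] /=; rewrite !in_itv/= => hx hy.
  have /le_lt_trans : normc ((x +i* y : C) - (x0 +i* y0)) <= a + a.
    by rewrite (le_trans (normc_le_ReIm _))//= lerD// ler_distl.
  by apply; rewrite /a; lra.
(* At the centre |f - q| is below c a / 3, so the minimiser z has |f z - f z0| < 2 c a / 3, and the
   lower Lipschitz bound puts it at distance less than a from z0, inside the square. *)
exists (c * a / 3); first by rewrite divr_gt0// mulr_gt0.
move=> q qz.
have cF : {within box, continuous (fun xy : R * R => normc (f (xy.1 +i* xy.2) - q))}.
  apply: continuous_in_subspaceT => xy; rewrite inE => /inbox xye.
  have [d d0 fxy] := fd _ xye.
  apply: (@continuous_comp _ _ _ (fun xy : R * R => (f (xy.1 +i* xy.2) - q : C)) (fun w : C => normc w : R)).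
    apply: (@continuous_comp _ _ _ (fun xy : R * R => (xy.1 +i* xy.2 : C)) (fun z => f z - q)).
      exact: mk_continuous.
    exact: (cderiv_continuous (cderivB fxy (cderiv_cst q _))).
  exact: normc_continuous.
have box0 : box (x0, y0).
  by split; rewrite /= in_itv/=; apply/andP; split; lra.
have boxK : compact box by apply: compact_setX; exact: segment_compact.
have [[x y] + xymin] := compact_EVT_min (ex_intro _ _ box0) boxK cF.
rewrite inE => xybox; have xye := inbox _ xybox.
exists (x +i* y) => //; apply/eqP; rewrite -subr_eq0 -normc_eq0; apply/negP => /negP fq0.
have {fq0} fq0 : 0 < normc (f (x +i* y) - q) by rewrite lt_def fq0 normc_ge0.
have xyr : normc (f (x +i* y) - q) <= c * a / 3.
  have := xymin (x0, y0) (mem_set box0) => /le_trans; apply => /=.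
  by rewrite normcB ltW.
have xysmall : normc ((x +i* y : C) - (x0 +i* y0)) < a.
  rewrite -(ltr_pM2l c0) (le_lt_trans (fc _ xye))//.
  have -> : f (x +i* y) - f (x0 +i* y0) = (f (x +i* y) - q) + (q - f (x0 +i* y0)).
    by rewrite addrA subrK.
  rewrite (le_lt_trans (le_normcD _ _))// (le_lt_trans (lerD xyr (ltW qz)))//.
  by have : 0 < c * a by [rewrite mulr_gt0|]; lra.
have [d d0 fxy] := fd _ xye.
set z := (x +i* y : C) in xye fq0 xyr xysmall d0 fxy *.
set D := f z - q in fq0 xyr.
pose v := - D / d.
have v0 : 0 < normc v.
  by rewrite normcM normcN mulr_gt0 ?normc_gt0// ?invr_eq0// -normc_gt0.
(* With this tolerance the Newton step t v leaves a remainder of at most t |D| / 2, so the new value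
   of |f - q| is at most (1 - t) |D| + t |D| / 2 < |D|. *)
pose A := normc D / 2 / normc v.
have A0 : 0 < A by rewrite !divr_gt0.
have [del del0 hd] := fxy A A0.
pose t := Num.min (1 / 2) (Num.min (del / 2 / normc v)
   ((a - normc (z - (x0 +i* y0))) / 2 / normc v)).
have t0 : 0 < t by rewrite !lt_min !divr_gt0// subr_gt0.
have t1 : t <= 1 / 2 by rewrite /t ge_min lexx.
have tv1 : t * normc v < del.
  rewrite -ltr_pdivlMr// (@le_lt_trans _ _ (del / 2 / normc v))//.
    by rewrite /t !ge_min lexx orbT.
  by rewrite ltr_pM2r ?invr_gt0//; lra.
have tv2 : t * normc v < a - normc (z - (x0 +i* y0)).
  rewrite -ltr_pdivlMr// (@le_lt_trans _ _ ((a - normc (z - (x0 +i* y0))) / 2 / normc v))//.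
    by rewrite /t !ge_min lexx !orbT.
  by rewrite ltr_pM2r ?invr_gt0//; lra.
have ntv : normc (t%:C * v) = t * normc v by rewrite normcM normc_real gtr0_norm.
pose z1 := z + t%:C * v.
have z1a : normc (z1 - (x0 +i* y0)) < a.
  rewrite /z1 addrAC (le_lt_trans (le_normcD _ _))// ntv.
  by rewrite -ltrBrDl.
have z1box : box (complex.Re z1, complex.Im z1).
  have hR := le_lt_trans (norm_Re_le _) z1a; have hI := le_lt_trans (norm_Im_le _) z1a.
  split => /=; rewrite in_itv/= -ler_distl ltW//.
    by move: hR; rewrite ReD ReN.
  by move: hI; rewrite ImD ImN.
have := xymin _ (mem_set z1box); rewrite /= -/z -/D.
have -> : complex.Re z1 +i* complex.Im z1 = z1 by case: (z1).
apply/negP; rewrite -ltNge.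
have := hd (t%:C * v); rewrite ntv => /(_ tv1); rewrite -/z1 => h.
have -> : f z1 - q = (f z1 - f z - d * (t%:C * v)) + (1 - t)%:C * D.
  have -> : d * (t%:C * v) = - (t%:C * D).
    by rewrite /v mulrCA [d * _]mulrCA mulfV// mulr1 mulrN.
  rewrite rmorphB rmorph1 /D; set T := t%:C; ring.
rewrite (le_lt_trans (le_normcD _ _))// normcM normc_real.
rewrite ger0_norm ?subr_ge0; last by lra.
rewrite (le_lt_trans (lerD h (lexx _)))//.
have -> : A * (t * normc v) = t * normc D / 2 * (normc v / normc v).
  by rewrite /A; ring.
rewrite divff ?gt_eqF// mulr1.
have : 0 < t * normc D by rewrite mulr_gt0.
by lra.
Qed.

Definition expi (t : R) : C := cos t +i* sin t.

Lemma normc_expi t : normc (expi t) = 1.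
Proof. by rewrite /= cos2Dsin2 sqrtr1. Qed.

Lemma expi_neq0 t : expi t != 0.
Proof. by rewrite -normc_gt0 normc_expi. Qed.

Lemma expiD s t : expi (s + t) = expi s * expi t.
Proof. by rewrite /expi cosD sinD; apply/eqP; rewrite eq_complex /=; apply/andP; split; apply/eqP; ring. Qed.

Lemma expi0 : expi 0 = 1.
Proof. by rewrite /expi cos0 sin0. Qed.

Lemma expiX t n : expi t ^+ n = expi (n%:R * t).
Proof.
elim: n => [|n IH]; first by rewrite expr0 mul0r expi0.
by rewrite exprS IH -expiD; congr expi; rewrite [in RHS]mulrSr mulrDl mul1r addrC.
Qed.

Lemma expi2pi t : expi (t + 2 * pi) = expi t.
Proof. by rewrite mulr_natl /expi cosD2pi sinD2pi. Qed.

Lemma pderiv_expi t : pderiv expi t ('i%C * expi t).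
Proof.
have -> : 'i%C * expi t = (- sin t +i* cos t : C).
  by apply/eqP; rewrite eq_complex /= !mul0r !mul1r sub0r add0r !eqxx.
split => /=; [exact: is_derive_cos|exact: is_derive_sin].
Qed.

(** The range of the angle matters in [ray_S1], where it keeps the difference of two polar angles
    below 2 pi. *)
Lemma polar_bounded z : exists2 t, - pi <= t <= pi & z = (normc z)%:C * expi t.
Proof.
have [->|z0] := eqVneq z 0.
  by exists 0; rewrite ?normc0 ?mul0r// oppr_le0 pi_ge0.
have n0 : normc z != 0 by rewrite normc_eq0.
pose a := complex.Re z / normc z; pose b := complex.Im z / normc z.
have ab : a ^+ 2 + b ^+ 2 = 1.
  by rewrite /a /b !expr_div_n -mulrDl -normc_sqr divff// expf_neq0.
have a1 : -1 <= a <= 1.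
  rewrite -ler_norml -(ler_pXn2r (n:=2)) ?nnegrE// expr1n real_normK ?num_real//.
  by rewrite -ab lerDl sqr_ge0.
have [b0|b0] := leP 0 b.
  exists (acos a); first by rewrite acos_lepi// andbT (le_trans _ (acos_ge0 a1))// oppr_le0 pi_ge0.
  rewrite /expi acosK ?in_itv// sin_acos//.
  rewrite -ab addrAC subrr add0r sqrtr_sqr ger0_norm//.
  apply/eqP; rewrite eq_complex /=; rewrite !mul0r subr0 addr0 /a /b.
  by rewrite !(mulrC (normc z)) !divfK// !eqxx.
exists (- acos a).
  by rewrite lerN2 acos_lepi//= (le_trans _ (pi_ge0 R))// oppr_le0 acos_ge0.
rewrite /expi cosN sinN acosK ?in_itv// sin_acos//.
rewrite -ab addrAC subrr add0r sqrtr_sqr ltr0_norm// opprK.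
apply/eqP; rewrite eq_complex /=; rewrite !mul0r subr0 addr0 /a /b.
by rewrite !(mulrC (normc z)) !divfK// !eqxx.
Qed.

Lemma polar z : exists t, z = (normc z)%:C * expi t.
Proof. by have [t _ zE] := polar_bounded z; exists t. Qed.

Lemma pderiv_continuous (g : R -> C) t v : pderiv g t v -> {for t, continuous g}.
Proof.
move=> /pderivP gd; apply/continuous_normcP => e e0.
have [del del0 hd] := gd 1 ltr01.
have N0 : 0 < normc v + 1 by rewrite ltr_pwDr ?normc_ge0.
apply/nbhs_ballP; exists (Num.min del (e / (normc v + 1))) => /=.
  by rewrite lt_min del0 divr_gt0.
move=> s; rewrite /ball/= distrC lt_min => /andP[sd se].
have := hd (s - t) sd; rewrite [t + _]addrC subrK mul1r => h.
have -> : g s - g t = (g s - g t - (s - t)%:C * v) + (s - t)%:C * v by rewrite subrK.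
rewrite (le_lt_trans (le_normcD _ _))// normcM normc_real.
rewrite (le_lt_trans (lerD h (lexx _)))//.
by rewrite -[X in X + _]mulr1 -mulrDr (addrC 1) -ltr_pdivlMr.
Qed.

End OpenMapping.

(** * Univalence of Phi *)

Definition small_param (R : realType) (m : nat) (b : R) : Prop :=
  [/\ (10 <= m)%N, 0 < b & (m%:R + 1) * b <= 1 / 3].

Section SmallParam.
Variable R : realType.
Local Notation C := (plane R).
Variables (m : nat) (b : R).
Hypothesis H : small_param m b.
Let m10 : (10 <= m)%N. Proof. by case: H. Qed.
Let b0 : 0 < b. Proof. by case: H. Qed.
Let mb : (m%:R + 1) * b <= 1 / 3. Proof. by case: H. Qed.
Implicit Types (z w u v : C).

(* [Phi' z = ((w - zeroP) / (w + poleP)) ^+ 2] and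
   [Phi z = z * (w + zeroQ) / (w + poleP)], where [w = z ^+ m]. *)
Definition zeroP : R := (m%:R + 1) * b.
Definition poleP : R := (m%:R - 1) * b.
Definition zeroQ : R := (m%:R + 1) ^+ 2 * b / (m%:R - 1).
Local Notation x := zeroP.
Local Notation beta := poleP.
Local Notation y := zeroQ.

Lemma M10 : 10 <= m%:R :> R.
Proof. by rewrite (ler_nat _ 10). Qed.

Lemma x_gt0 : 0 < x.
Proof. by rewrite /zeroP mulr_gt0// ltr_wpDl. Qed.

Lemma beta_gt0 : 0 < beta.
Proof. by rewrite /poleP mulr_gt0//; have := M10; lra. Qed.

Lemma yE : (m%:R - 1) * y = (m%:R + 1) * x.
Proof. by rewrite /zeroQ /zeroP; field; have := M10; lra. Qed.

Lemma y_gt0 : 0 < y.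
Proof. by rewrite /zeroQ divr_gt0 ?mulr_gt0 ?exprn_gt0//; have := M10; lra. Qed.

Lemma beta_lt_x : beta < x.
Proof. by rewrite /poleP /zeroP ltr_pM2r//; lra. Qed.

(** [y] is (m + 1) / (m - 1) times [x]; the factor is at most 11/9 for m >= 10, and x <= 1/3. *)
Lemma y_le : y <= 11 / 27.
Proof.
have q0 : 0 < (m%:R - 1 : R) by have := M10; lra.
rewrite -(ler_pM2l q0) yE.
have := ler_wpM2l (_ : 0 <= m%:R + 1 :> R) mb; rewrite -/x => /(_ _)/le_trans; apply.
  by rewrite addr_ge0.
by have := M10; lra.
Qed.

Lemma x_lt_y : x < y.
Proof.
have q0 : 0 < (m%:R - 1 : R) by have := M10; lra.
rewrite -(ltr_pM2l q0) yE ltr_pM2r ?x_gt0//; lra.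
Qed.

(** Together with [y_sub_beta] this makes (w + y) (w + beta) - m w (y - beta) equal to (w - x)^2,
    which is why the derivative of Phi is a perfect square. *)
Lemma y_beta : y * beta = x ^+ 2.
Proof. by rewrite /zeroQ /zeroP /poleP; field; have := M10; lra. Qed.

Lemma y_sub_beta : m%:R * (y - beta) = y + beta + 2 * x.
Proof. by rewrite /zeroQ /zeroP /poleP; field; have := M10; lra. Qed.

(* A margin around the unit circle, uniform in [m]: everything is univalent on
   the neighbourhood [Omega] of the closed exterior. *)
Definition R0 : R := 51 / 50.

Lemma R0V : R0^-1 = 50 / 51 :> R.
Proof. by rewrite /R0 invf_div. Qed.

Definition Omega : set C := [set z | R0^-1 < normc z ^+ m].

(** 11/27 is less than half of 50/51, hence less than half of |w|. *)
Lemma normc_addr_gt (r : R) w : R0^-1 < normc w -> 0 <= r <= 11 / 27 ->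
  2^-1 * normc w < normc (w + r%:C).
Proof.
move=> wR /andP[r0 r1].
have := le_normcB (w + r%:C) r%:C; rewrite addrK normc_real ger0_norm//.
move: wR; rewrite R0V => h1 h2. lra.
Qed.

Lemma normc_subr_gt (r : R) w : R0^-1 < normc w -> 0 <= r <= 11 / 27 ->
  2^-1 * normc w < normc (w - r%:C).
Proof.
move=> wR /andP[r0 r1].
have := le_normcD (w - r%:C) r%:C; rewrite subrK normc_real ger0_norm//.
by move: wR; rewrite R0V => h1 h2; lra.
Qed.

Lemma Omega_gt z : Omega z -> R0^-1 < normc (z ^+ m).
Proof. by rewrite normcX. Qed.

Lemma beta_bd : 0 <= beta <= 11 / 27.
Proof. by have := beta_gt0; have := beta_lt_x; have := mb; rewrite -/x; lra. Qed.
Lemma x_bd : 0 <= x <= 11 / 27.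
Proof. by have := x_gt0; have := mb; rewrite -/x; lra. Qed.
Lemma y_bd : 0 <= y <= 11 / 27.
Proof. by have := y_gt0; have := y_le; lra. Qed.

Lemma half_normc_gt0 w : R0^-1 < normc w -> 0 < 2^-1 * normc w.
Proof. by rewrite R0V => ?; lra. Qed.

Lemma wbeta_neq0 z : Omega z -> z ^+ m + beta%:C != 0.
Proof.
move=> /Omega_gt zO; rewrite -normc_gt0.
exact: lt_trans (half_normc_gt0 zO) (normc_addr_gt zO beta_bd).
Qed.

Lemma wx_neq0 z : Omega z -> z ^+ m - x%:C != 0.
Proof.
move=> /Omega_gt zO; rewrite -normc_gt0.
exact: lt_trans (half_normc_gt0 zO) (normc_subr_gt zO x_bd).
Qed.

Lemma wy_neq0 z : Omega z -> z ^+ m + y%:C != 0.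
Proof.
move=> /Omega_gt zO; rewrite -normc_gt0.
exact: lt_trans (half_normc_gt0 zO) (normc_addr_gt zO y_bd).
Qed.

Lemma Omega_neq0 z : Omega z -> z != 0.
Proof.
move=> zO; apply/eqP => z0; move: zO.
rewrite /Omega/= z0 normc0 expr0n R0V; have -> : (m == 0)%N = false by case: (m) m10.
by rewrite mulr0n ltNge divr_ge0.
Qed.

Lemma m_gt0 : (0 < m)%N. Proof. exact: leq_trans m10. Qed.

Lemma Omega_ext z : 1 <= normc z -> Omega z.
Proof. by move=> z1; rewrite /Omega/= (lt_le_trans _ (exprn_ege1 m z1))// R0V; lra. Qed.

Lemma PhiE z : z ^+ m + beta%:C != 0 ->
  Phi m b z = z * (z ^+ m + y%:C) / (z ^+ m + beta%:C).
Proof.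
move=> wb; rewrite /Phi.
have q0 : ((m%:R - 1 : R)%:C : C) != 0.
  by rewrite (inj_eq (@complexI R)) gt_eqF//; have := M10; lra.
have E : ((4 * m%:R * b)%:C : C) = (m%:R - 1)%:C * (y%:C - beta%:C).
  have -> : 4 * m%:R * b = (m%:R - 1) * (y - beta).
    by rewrite /zeroQ /poleP; field; have := M10; lra.
  by rewrite rmorphM [X in _ * X]rmorphB.
rewrite E -/beta; set W := z ^+ m in wb *.
by field; apply/andP; split=> //; move: q0; rewrite rmorphB rmorph1 rmorph_nat.
Qed.

Definition dPhi z : C := ((z ^+ m - x%:C) / (z ^+ m + beta%:C)) ^+ 2.

Lemma exprm1 z : z * z ^+ m.-1 = z ^+ m.
Proof. by rewrite -exprS prednK// m_gt0. Qed.

Lemma cderiv_pow z : cderiv (fun w => w ^+ m) z (m%:R * z ^+ m.-1).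
Proof. by apply: (cderiv_eq (cderivX m (cderiv_id z))); rewrite mulr1. Qed.

Lemma natrC n : (n%:R : C) = (n%:R : R)%:C.
Proof. by rewrite rmorph_nat. Qed.

Lemma cderiv_Phi z : z ^+ m + beta%:C != 0 -> cderiv (Phi m b) z (dPhi z).
Proof.
move=> wb.
have dw (c : C) : cderiv (fun w => w ^+ m + c) z (m%:R * z ^+ m.-1 + 0).
  by apply: cderivD; [exact: cderiv_pow|exact: cderiv_cst].
have h := cderivM (cderivM (cderiv_id z) (dw y%:C)) (cderivV (f := fun w => w ^+ m + beta%:C) wb (dw beta%:C)).
have near0 : \forall w \near z, w ^+ m + beta%:C != 0.
  apply: (continuous_neq0_near (f := fun w => w ^+ m + beta%:C)) => //.
  exact: cderiv_continuous (dw beta%:C).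
apply: (cderiv_eq (f := Phi m b)).
  apply: cderiv_near_eq h; apply: filterS near0 => w w0.
  by rewrite PhiE.
rewrite /dPhi.
have E : (m%:R : C) * (y%:C - beta%:C) = y%:C + beta%:C + 2 * x%:C.
  rewrite natrC -rmorphB -rmorphM y_sub_beta 2!rmorphD; congr (_ + _).
  by rewrite natrC; exact: rmorphM.
have E2 : y%:C * beta%:C = x%:C ^+ 2 :> C by rewrite -rmorphM y_beta rmorphXn.
rewrite expr_div_n !addr0 mulr1.
have -> : z * (z ^+ m + y%:C) * (- (m%:R * z ^+ m.-1) / (z ^+ m + beta%:C) ^+ 2) =
  - (m%:R * z ^+ m * (z ^+ m + y%:C)) / (z ^+ m + beta%:C) ^+ 2.
  move: (z ^+ m + y%:C) (z ^+ m + beta%:C) => A B.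
  by rewrite -exprm1; ring.
have -> : (z * (m%:R * z ^+ m.-1) + (z ^+ m + y%:C)) =
  m%:R * z ^+ m + (z ^+ m + y%:C) by rewrite mulrCA exprm1.
set W := z ^+ m in wb *.
have -> : (W - x%:C) ^+ 2 = (W + y%:C) * (W + beta%:C) - m%:R * W * (y%:C - beta%:C).
  transitivity (W ^+ 2 + (y%:C + beta%:C) * W + y%:C * beta%:C - W * (m%:R * (y%:C - beta%:C))).
    by rewrite E E2; ring.
  by ring.
by field.
Qed.

End SmallParam.

(** * The Noshiro-Warschawski estimate in the inverted variable *)

Section NoshiroWarschawski.
Variable R : realType.
Local Notation C := (plane R).
Implicit Types (u w z : C) (f : C -> C).

Lemma normc_conj z : normc (z^*) = normc z.
Proof. by case: z => p q /=; rewrite sqrrN. Qed.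

Lemma mulc_conj z : z * z^* = (normc z ^+ 2)%:C.
Proof.
rewrite normc_sqr; case: z => p q; apply/eqP; rewrite eq_complex /=.
by apply/andP; split; apply/eqP; ring.
Qed.

Lemma Re_sqr z : complex.Re (z ^+ 2) = complex.Re z ^+ 2 - complex.Im z ^+ 2.
Proof. by rewrite expr2; case: z => p q /=; ring. Qed.

Lemma divcE z w : w != 0 -> z / w = (normc w ^- 2)%:C * (z * w^*).
Proof.
move=> w0; have nw : (normc w ^+ 2)%:C != 0 :> C.
  by rewrite (inj_eq (@complexI R)) expf_neq0// normc_eq0.
apply: (mulIf w0); rewrite divfK// -!mulrA (mulrC _ w) mulc_conj mulrCA.
by rewrite -rmorphM /= mulVf ?mulr1// expf_neq0// normc_eq0.
Qed.

Lemma Re_sqr_div z w : w != 0 -> complex.Re ((z / w) ^+ 2) =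
  (complex.Re (z * w^*) ^+ 2 - complex.Im (z * w^*) ^+ 2) / normc w ^+ 4.
Proof.
move=> w0; rewrite divcE// exprMn -rmorphXn ReM Re_sqr mulrC; congr (_ * _).
by rewrite exprVn -exprM.
Qed.

(* Noshiro-Warschawski: the real part of the derivative bounds below the growth
   of [f] along a segment. *)
Lemma Re_deriv_expansive f f' (delta : R) u1 u2 :
  (forall t : R, 0 <= t <= 1 -> cderiv f (u2 + t%:C * (u1 - u2)) (f' (u2 + t%:C * (u1 - u2))) /\
     delta <= complex.Re (f' (u2 + t%:C * (u1 - u2)))) ->
  delta * normc (u1 - u2) <= normc (f u1 - f u2).
Proof.
move=> H; have [->|u12] := eqVneq u1 u2; first by rewrite !subrr normc0 mulr0.
set D := u1 - u2; have D0 : 0 < normc D by rewrite normc_gt0 subr_eq0.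
pose l (t : R) : C := u2 + t%:C * D.
have dl t : pderiv l t D.
  apply/pderivP => e e0; exists 1 => // h _.
  have -> : l (t + h) - l t - h%:C * D = 0 by rewrite /l rmorphD; ring.
  by rewrite normc0 mulr_ge0// ltW.
(* The mean value theorem needs a real function: pairing with the conjugate direction gives phi' =
   Re (f') |D|^2. *)
pose phi t : R := complex.Re (f (l t) * D^*).
have dphi (t : R) : 0 <= t <= 1 -> is_derive t (1 : R) phi (complex.Re (f' (l t)) * normc D ^+ 2).
  move=> t01; have [fd _] := H t t01.
  have h := cderivM fd (cderiv_cst (D^*) _).
  have [hR _] := pderiv_comp h (dl t).
  have DD : D * D^* = (normc D ^+ 2)%:C.
    rewrite normc_sqr; case: (D) => p q; apply/eqP; rewrite eq_complex /=.
    by apply/andP; split; apply/eqP; ring.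
  apply: is_derive_eq hR _; rewrite -/D -/(l t) [RHS]mulrC -ReM -DD.
  by congr complex.Re; ring.
have [||c c01 ] := @MVT_segment R phi (fun t => complex.Re (f' (l t)) * normc D ^+ 2) 0 1 ler01.
- by move=> t /[!in_itv]/= /andP[t0 t1]; apply: dphi; rewrite !ltW.
- apply: continuous_in_subspaceT => t; rewrite inE/= in_itv/= => /dphi dt.
  by apply: differentiable_continuous; apply/derivable1_diffP; case: dt.
move: c01; rewrite in_itv/= subr0 mulr1 => c01 E.
have [_ Hc] := H c c01.
have : delta * normc D ^+ 2 <= phi 1 - phi 0.
  by rewrite E ler_wpM2r// exprn_ge0// ltW.
have l1 : l 1 = u1 by rewrite /l rmorph1 mul1r addrC subrK.
have l0 : l 0 = u2 by rewrite /l rmorph0 mul0r addr0.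
rewrite /phi -ReN -ReD -mulNr -mulrDl l1 l0.
move=> h; rewrite -(ler_pM2r D0) -mulrA -expr2 (le_trans h)//.
by rewrite (le_trans (ler_norm _))// (le_trans (norm_Re_le _))// normcM normc_conj.
Qed.
End NoshiroWarschawski.

Section Inversion.
Variable R : realType.
Local Notation C := (plane R).
Variables (m : nat) (b : R).
Hypothesis H : small_param m b.
Let m10 : (10 <= m)%N. Proof. by case: H. Qed.
Let b0 : 0 < b. Proof. by case: H. Qed.
Let mb : (m%:R + 1) * b <= 1 / 3. Proof. by case: H. Qed.
Implicit Types (z w u v : C).
Local Notation x := (zeroP m b).
Local Notation beta := (poleP m b).
Local Notation y := (zeroQ m b).

Lemma one_yv_neq0 v : normc v < R0 R -> 1 + y%:C * v != 0.
Proof.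
move=> vR; rewrite -normc_gt0.
have := le_normcD (1 + y%:C * v) (- (y%:C * v)); rewrite addrK normc1 normcN normcM normc_real.
have /andP[y0 y1] := y_bd H.
rewrite ger0_norm//; have : y * normc v <= 11 / 27 * R0 R.
  by rewrite ler_pM ?normc_ge0// ltW.
by rewrite /R0 => h1 h2; lra.
Qed.

(* [hh u = 1 / Phi (1 / u)] and its derivative. *)
Definition hh u : C := u * (1 + beta%:C * u ^+ m) / (1 + y%:C * u ^+ m).
Definition dhh u : C := ((1 - x%:C * u ^+ m) / (1 + y%:C * u ^+ m)) ^+ 2.

Lemma cderiv_hh u : normc (u ^+ m) < R0 R -> cderiv hh u (dhh u).
Proof.
move=> uR; have v0 := one_yv_neq0 uR.
have dw (c : C) : cderiv (fun w => 1 + c * w ^+ m) u (0 + (c * (m%:R * u ^+ m.-1) + u ^+ m * 0)).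
  apply: cderivD; first exact: cderiv_cst.
  apply: (cderivM (f := fun=> c)); first exact: cderiv_cst.
  exact: cderiv_pow.
apply: (cderiv_eq (cderivM (cderivM (cderiv_id u) (dw beta%:C)) (cderivV (f := fun w => 1 + y%:C * w ^+ m) v0 (dw y%:C)))).
rewrite /dhh.
have E : (m%:R : C) * (y%:C - beta%:C) = y%:C + beta%:C + 2 * x%:C.
  rewrite natrC -rmorphB -rmorphM y_sub_beta// 2!rmorphD; congr (_ + _).
  by rewrite natrC; exact: rmorphM.
have E2 : y%:C * beta%:C = x%:C ^+ 2 :> C by rewrite -rmorphM y_beta// rmorphXn.
rewrite expr_div_n !mulr0 !addr0 !add0r mulr1.
move: v0; set Y : C := y%:C; set B : C := beta%:C; set X : C := x%:C.
rewrite -/Y -/B -/X in E E2.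
have U := exprm1 H u.
set W := u ^+ m; set V := u ^+ m.-1 => v0; rewrite -/W -/V in U.
have -> : u * (1 + B * W) * (- (Y * (m%:R * V)) / (1 + Y * W) ^+ 2) =
  - (m%:R * W * Y * (1 + B * W)) / (1 + Y * W) ^+ 2.
  by move: (1 + B * W) (1 + Y * W) => A1 A2; rewrite -U; ring.
have -> : u * (B * (m%:R * V)) + (1 + B * W) = m%:R * W * B + (1 + B * W).
  by congr (_ + _); rewrite -U; ring.
have -> : (1 - X * W) ^+ 2 = (1 + B * W) * (1 + Y * W) - m%:R * W * (Y - B).
  transitivity (1 + (Y + B) * W + (Y * B) * W ^+ 2 - W * (m%:R * (Y - B))).
    by rewrite E E2; ring.
  by ring.
by field.
Qed.

Definition delta0 : R := (1 / 50) ^+ 2 / 16.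

(** Write v = u^m. The product of 1 - x v with the conjugate of 1 + y v is A - i B, and A - |B| is
    at least 1 - 2 y R0 - x y R0^2, which exceeds 1/50 when y <= 11/27 and x y <= 11/81. So A^2 -
    B^2 >= (1/50)^2, and the denominator |1 + y v|^4 is at most 2^4; this is the origin of
    [delta0]. *)
Lemma Re_dhh u : normc (u ^+ m) < R0 R -> delta0 <= complex.Re (dhh u).
Proof.
move=> uR; have v0 := one_yv_neq0 uR; rewrite /dhh Re_sqr_div//.
have d2 : normc (1 + y%:C * u ^+ m) <= 2.
  have /andP[y0 y1] := y_bd H.
  rewrite (le_trans (le_normcD _ _))// normc1 normcM normc_real ger0_norm//.
  have : y * normc (u ^+ m) <= 11 / 27 * R0 R by rewrite ler_pM ?normc_ge0// ltW.
  by rewrite /R0 => h; lra.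
have {v0} v0 : 0 < normc (1 + y%:C * u ^+ m) by rewrite normc_gt0.
rewrite ler_pdivlMr ?exprn_gt0//.
have d4 : normc (1 + y%:C * u ^+ m) ^+ 4 <= 2 ^+ 4.
  by rewrite ler_pXn2r ?nnegrE ?normc_ge0.
rewrite (le_trans (ler_wpM2l _ d4))//; first by rewrite /delta0 divr_ge0// sqr_ge0.
have := norm_Re_le (u ^+ m); have := norm_Im_le (u ^+ m).
have := normc_sqr (u ^+ m).
move: uR; have := normc_ge0 (u ^+ m); move: (normc (u ^+ m) : R) => N.
case: (u ^+ m) => p q N0 NR /= Ns qN pN.
have /andP[y0 y1] := y_bd H; have /andP[x0 _] := x_bd H.
have x1 := mb; rewrite -/x in x1; have /ltW xy := x_lt_y H.
have xy1 : x * y <= 1 / 3 * (11 / 27) by rewrite ler_pM.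
have NR2 : N ^+ 2 <= R0 R ^+ 2 by rewrite ler_pXn2r ?nnegrE /R0 ?divr_ge0// ltW.
have h1 : x * y * N ^+ 2 <= 1 / 3 * (11 / 27) * R0 R ^+ 2.
  by apply: ler_pM => //; [exact: mulr_ge0|exact: sqr_ge0].
have h2 : (y - x) * `|p| <= (y - x) * R0 R.
  by rewrite ler_wpM2l ?subr_ge0// (le_trans pN)// ltW.
have h3 : (x + y) * `|q| <= (x + y) * R0 R.
  by rewrite ler_wpM2l ?addr_ge0// (le_trans qN)// ltW.
pose A := 1 + (y - x) * p - x * y * N ^+ 2; pose B := (x + y) * q.
have AB : `|B| + 1 / 50 <= A.
  rewrite /A /B normrM (ger0_norm (addr_ge0 x0 y0)).
  have h4 : - ((y - x) * `|p|) <= (y - x) * p.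
    by rewrite -mulrN ler_wpM2l ?subr_ge0// lerNl ler_normr lexx orbT.
  by move: h1 h2 h3; rewrite /R0 => h1 h2 h3; nra.
have -> : (1 - (x * p - 0 * q)) * (1 + (y * p - 0 * q)) - (0 - (x * q + 0 * p)) * - (0 + (y * q + 0 * p)) = A.
  by rewrite /A Ns; ring.
have -> : (1 - (x * p - 0 * q)) * - (0 + (y * q + 0 * p)) + (0 - (x * q + 0 * p)) * (1 + (y * p - 0 * q)) = - B.
  by rewrite /B; ring.
rewrite sqrrN -(real_normK (num_real B)).
have B0 := normr_ge0 B; move: (`|B|) B0 AB => B' B0 AB.
by rewrite /delta0; nra.
Qed.
End Inversion.

Section Univalence.
Variable R : realType.
Local Notation C := (plane R).
Variables (m : nat) (b : R).
Hypothesis H : small_param m b.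
Implicit Types (z w u v : C).
Local Notation beta := (poleP m b).
Local Notation y := (zeroQ m b).
Local Notation Om := (@Omega R m).

(** The constants are 1 - 21/50 and 1 + 21/50, since 11/27 < (21/50) (50/51). *)
Lemma normc_addr_bounds (r : R) w : (R0 R)^-1 < normc w -> 0 <= r <= 11 / 27 ->
  29 / 50 * normc w <= normc (w + r%:C) <= 71 / 50 * normc w.
Proof.
move=> wR /andP[r0 r1].
have := le_normcB (w + r%:C) r%:C; have := le_normcD w r%:C.
rewrite addrK normc_real ger0_norm//.
by move: wR; rewrite R0V => h1 h2 h3; apply/andP; split; lra.
Qed.

(** The quotient of the two bounds above satisfies 29/71 > 2/5. This linear comparison also gives
    the properness of F, the bound on the interior and the growth of psi. *)
Lemma Phi_ratio z : Om z ->
  2 / 5 * normc z <= normc (Phi m b z) <= 5 / 2 * normc z.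
Proof.
move=> zO; have wb := wbeta_neq0 H zO.
have wO := Omega_gt zO.
have /andP[h1 h2] := normc_addr_bounds wO (beta_bd H).
have /andP[h3 h4] := normc_addr_bounds wO (y_bd H).
have -> : normc (Phi m b z) = normc z * (normc (z ^+ m + y%:C) / normc (z ^+ m + beta%:C)).
  by rewrite PhiE// normcM normcM normcV mulrA.
have z0 : 0 < normc z by rewrite normc_gt0 (Omega_neq0 H).
have wb0 : 0 < normc (z ^+ m + beta%:C) by rewrite normc_gt0.
move: wO; rewrite R0V => h5.
apply/andP; split.
  by rewrite [leLHS]mulrC ler_pM2l// ler_pdivlMr//; lra.
by rewrite [leRHS]mulrC ler_pM2l// ler_pdivrMr//; lra.
Qed.

Lemma Phi_neq0 z : Om z -> Phi m b z != 0.
Proof.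
move=> zO; rewrite -normc_gt0; have /andP[h _] := Phi_ratio zO.
by apply: lt_le_trans h; rewrite mulr_gt0// normc_gt0 (Omega_neq0 H).
Qed.

Lemma Phi_hh z : Om z -> Phi m b z = (hh m b z^-1)^-1.
Proof.
move=> zO; have wb := wbeta_neq0 H zO; have wy := wy_neq0 H zO.
have z0 := Omega_neq0 H zO.
have w0 : z ^+ m != 0 by rewrite expf_neq0.
rewrite PhiE// /hh exprVn; set W := z ^+ m in wb wy w0 *.
have -> : 1 + beta%:C * W^-1 = (W + beta%:C) / W by rewrite mulrDl divff.
have -> : 1 + y%:C * W^-1 = (W + y%:C) / W by rewrite mulrDl divff.
move: (beta%:C : C) (y%:C : C) wb wy => B Y wb wy.
by field; rewrite ?z0 ?w0 ?wb ?wy.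
Qed.

(** The factor 4/25 is the inverse of (5/2)^2: going back from hh (1/z) to Phi z costs |z1 h1| |z2
    h2|, and each factor is at most 5/2 by [Phi_ratio]. *)
Definition lip0 : R := delta0 R * (4 / 25).

Lemma lip0_gt0 : 0 < lip0.
Proof. by rewrite /lip0 /delta0 !mulr_gt0// ?exprn_gt0 ?invr_gt0// divr_gt0. Qed.

Lemma Phi_expansive z1 z2 : Om z1 -> Om z2 ->
  lip0 * normc (z1 - z2) <= normc (Phi m b z1 - Phi m b z2).
Proof.
move=> z1O z2O.
have z10 := Omega_neq0 H z1O; have z20 := Omega_neq0 H z2O.
have dV z : Om z -> normc z^-1 ^+ m < R0 R.
  move=> zO; rewrite normcV exprVn -[ltRHS]invrK ltf_pV2// posrE ?invr_gt0 ?divr_gt0//.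
  by rewrite exprn_gt0// normc_gt0 (Omega_neq0 H).
have hD : delta0 R * normc (z1^-1 - z2^-1) <= normc (hh m b z1^-1 - hh m b z2^-1).
  apply: (@Re_deriv_expansive _ _ (dhh m b)) => t /andP[t0 t1].
  suff uR : normc ((z2^-1 + t%:C * (z1^-1 - z2^-1)) ^+ m) < R0 R.
    by split; [exact: cderiv_hh|exact: Re_dhh].
  rewrite normcX.
  have : normc (z2^-1 + t%:C * (z1^-1 - z2^-1)) <= Num.max (normc z1^-1) (normc z2^-1).
    have -> : z2^-1 + t%:C * (z1^-1 - z2^-1) = t%:C * z1^-1 + (1 - t)%:C * z2^-1.
      by rewrite rmorphB rmorph1; ring.
    rewrite (le_trans (le_normcD _ _))// !normcM !normc_real !ger0_norm ?subr_ge0//.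
    set N := Num.max _ _.
    have -> : N = t * N + (1 - t) * N by ring.
    by rewrite lerD// ler_wpM2l ?subr_ge0// /N le_max lexx ?orbT.
  move=> h; have := lerXn2r m (normc_ge0 _) (le_trans (normc_ge0 _) h) h.
  move/le_lt_trans; apply.
  by have [_|_] := leP (normc z1^-1) (normc z2^-1); exact: dV.
move: hD; rewrite !Phi_hh//.
have h10 : hh m b z1^-1 != 0 by have := Phi_neq0 z1O; rewrite Phi_hh// invr_eq0.
have h20 : hh m b z2^-1 != 0 by have := Phi_neq0 z2O; rewrite Phi_hh// invr_eq0.
have /andP[b1 _] := Phi_ratio z1O; have /andP[b2 _] := Phi_ratio z2O.
move: b1 b2; rewrite !Phi_hh//.
move: (hh m b z1^-1) (hh m b z2^-1) h10 h20 => h1 h2 h10 h20 b1 b2.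
have -> : z1^-1 - z2^-1 = - (z1 - z2) * z1^-1 * z2^-1 by field; rewrite z10 z20.
have -> : h1 - h2 = - (h1^-1 - h2^-1) * h1 * h2 by field; rewrite h10 h20.
rewrite !normcM !normcN /lip0.
rewrite !normcV in b1 b2 *.
have N1 : 0 < normc z1 by rewrite normc_gt0. have N2 : 0 < normc z2 by rewrite normc_gt0.
have M1 : 0 < normc h1 by rewrite normc_gt0. have M2 : 0 < normc h2 by rewrite normc_gt0.
have B0 := normc_ge0 (h1^-1 - h2^-1).
move: (normc (z1 - z2) : R) (normc (h1^-1 - h2^-1) : R) B0 => A B B0 h.
have {b1} b1 : normc z1 * normc h1 <= 5 / 2.
  by move: b1; rewrite -(ler_pM2r M1) mulVf ?gt_eqF// => ?; lra.
have {b2} b2 : normc z2 * normc h2 <= 5 / 2.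
  by move: b2; rewrite -(ler_pM2r M2) mulVf ?gt_eqF// => ?; lra.
have h' : delta0 R * A <= B * ((normc z1 * normc h1) * (normc z2 * normc h2)).
  move: h; rewrite (_ : delta0 R * _ = delta0 R * A / (normc z1 * normc z2)); last first.
    by rewrite invfM; ring.
  rewrite ler_pdivrMr ?mulr_gt0// => /le_trans; apply.
  by rewrite le_eqVlt; apply/orP; left; apply/eqP; ring.
have : (normc z1 * normc h1) * (normc z2 * normc h2) <= (5 / 2) * (5 / 2).
  by rewrite ler_pM// mulr_ge0// ltW.
move/(ler_wpM2l B0) => h2'; have := le_trans h' h2'.
by move: (delta0 R * A) => DA ?; lra.
Qed.
End Univalence.

(** * Interior and exterior of the bubble *)

Section Domains.
Variable R : realType.
Local Notation C := (plane R).
Variables (m : nat) (b s : R).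
Hypothesis H : small_param m b.
Hypothesis s0 : 0 < s.
Implicit Types (z w u v p q : C).
Local Notation Om := (@Omega R m).

(** The scale [s] is an arbitrary positive number here, so the geometry does not depend on the area
    formula; the normalisation s^2 a = 1 enters with the computation of the area. *)
Definition bubble_map z : C := s%:C * Phi m b z.
Local Notation F := bubble_map.
Definition dbubble_map z : C := s%:C * dPhi m b z.
Local Notation dF := dbubble_map.

Lemma cderiv_F z : Om z -> cderiv F z (dF z).
Proof.
move=> zO; apply: (cderiv_eq (cderivM (cderiv_cst s%:C z) (cderiv_Phi H (wbeta_neq0 H zO)))).
by rewrite mulr0 addr0.
Qed.

Lemma realC_neq0 (r : R) : 0 < r -> (r%:C : C) != 0.
Proof. by move=> r0; rewrite (inj_eq (@complexI R)) gt_eqF. Qed.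

Lemma dF_neq0 z : Om z -> dF z != 0.
Proof.
move=> zO; rewrite /dF /dPhi mulf_neq0 ?realC_neq0// expf_neq0// mulf_neq0 ?invr_eq0//.
  exact: wx_neq0.
exact: wbeta_neq0.
Qed.

Definition lip1 : R := s * lip0 R.

Lemma lip1_gt0 : 0 < lip1.
Proof. by rewrite mulr_gt0// lip0_gt0. Qed.

Lemma F_expansive z1 z2 : Om z1 -> Om z2 ->
  lip1 * normc (z1 - z2) <= normc (F z1 - F z2).
Proof.
move=> z1O z2O; rewrite /F -mulrBr normcM normc_real gtr0_norm// /lip1 -mulrA.
by rewrite ler_pM2l// Phi_expansive.
Qed.

Lemma F_inj z1 z2 : Om z1 -> Om z2 -> F z1 = F z2 -> z1 = z2.
Proof.
move=> z1O z2O E; have := F_expansive z1O z2O; rewrite E subrr normc0.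
rewrite pmulr_rle0 ?lip1_gt0// => h; apply/eqP; rewrite -subr_eq0 -normc_eq0.
by rewrite eq_le h normc_ge0.
Qed.

Lemma F_ratio z : Om z -> s * (2 / 5) * normc z <= normc (F z) <= s * (5 / 2) * normc z.
Proof.
move=> zO; rewrite normcM normc_real gtr0_norm// -!mulrA !ler_pM2l// !mulrA.
exact: Phi_ratio.
Qed.

Lemma Om_open : open (Om : set C).
Proof.
move=> z zO; apply/nbhs_normcP.
have := cderiv_continuous (cderiv_pow m z).
move/continuous_normcP => /(_ (normc (z ^+ m) - (R0 R)^-1)).
rewrite subr_gt0 => /(_ (Omega_gt zO)) /nbhs_normcP[e e0 he].
exists e => // w /he h; rewrite /Omega/= -normcX.
have := le_normc_dist (z ^+ m) (w ^+ m); rewrite normcB => h2.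
have := le_lt_trans (le_trans (ler_norm _) h2) h.
by move: (normc (z ^+ m) : R) (normc (w ^+ m) : R) => A B; lra.
Qed.

Lemma F_open (A : set C) z : open A -> A `<=` Om -> A z -> \forall q \near F z, (F @` A) q.
Proof.
move=> oA AO Az; have /nbhs_normcP[e e0 he] : nbhs z A by exact: oA.
have [||||r r0 hr] := @open_image R F z lip1 e.
- exact: lip1_gt0.
- by [].
- by move=> w /he/AO wO; exists (dF w); [exact: dF_neq0|exact: cderiv_F].
- by move=> w /he/AO wO; apply: F_expansive => //; exact: AO.
apply/nbhs_normcP; exists r => // q /hr[w we wq]; exists w => //; exact: he.
Qed.

(** It inverts F on the image of all of [Omega], hence also slightly inside the curve; elsewhere its
    value is the default 0. *)
Definition bubble_inv p : C := xget 0 [set z | Om z /\ F z = p].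
Local Notation G := bubble_inv.

Lemma FK z : Om z -> G (F z) = z.
Proof.
move=> zO; rewrite /G; case: xgetP => [w _ [wO wz]|/(_ z)[]//].
exact: F_inj.
Qed.

Lemma cderiv_G z : Om z -> cderiv G (F z) (dF z)^-1.
Proof.
move=> zO.
have nO : \forall q \near F z, (F @` Om) q by apply: F_open => //; exact: Om_open.
apply: (@inverse_cderiv R F _ _ _ lip1^-1).
- exact: dF_neq0.
- by rewrite FK//; exact: cderiv_F.
- by apply: filterS nO => _ [w wO <-]; rewrite FK.
- apply: filterS nO => _ [w wO <-]; rewrite !FK// mulrC ler_pdivlMr ?lip1_gt0// mulrC.
  exact: F_expansive.
Qed.

Definition bubble_ext : set C := F @` @unit_disc_ext R.
Local Notation U1 := bubble_ext.
Definition bubble_curve : set C := F @` @unit_circle R.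
Local Notation S1 := bubble_curve.
(* Not [F @` [set z | normc z < 1]]: [F] has poles in the disc. *)
Definition bubble_int : set C := ~` (F @` [set z | 1 <= normc z]).
Local Notation V1 := bubble_int.

Lemma open_ext : open (@unit_disc_ext R).
Proof.
move=> z z1; apply/nbhs_normcP; exists (normc z - 1); first by rewrite subr_gt0.
move=> w h; have := le_lt_trans (le_trans (ler_norm _) (le_normc_dist z w)) _.
rewrite normcB => /(_ _ h); rewrite /unit_disc_ext/=.
by move: (normc z : R) (normc w : R) => A B; lra.
Qed.

Lemma open_U1 : open U1.
Proof.
move=> _ [z z1 <-]; apply: F_open => //; first exact: open_ext.
by move=> w /ltW; exact: Omega_ext.
Qed.

Lemma notS_UV p : ~ S1 p -> U1 p \/ V1 p.
Proof.
move=> nS; have [Vp|/contrapT[z z1 zp]] := pselect (V1 p); [by right|left].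
exists z => //; rewrite /unit_disc_ext/= lt_neqAle z1 andbT.
by apply/eqP => zE; apply: nS; exists z.
Qed.

Lemma UV_disj p : U1 p -> V1 p -> False.
Proof. by move=> [z z1 <-]; apply; exists z => //; exact: ltW. Qed.

Lemma SV_disj p : S1 p -> V1 p -> False.
Proof. by move=> [z z1 <-]; apply; exists z => //; rewrite /= z1. Qed.

Lemma SU_disj p : S1 p -> U1 p -> False.
Proof.
move=> [z z1 <-] [w w1 wz]; have wO : Om w by exact/Omega_ext/ltW.
have zO : Om z by apply: Omega_ext; rewrite z1.
by move: w1; rewrite (F_inj wO zO wz) /unit_disc_ext/= z1 ltxx.
Qed.

(** The image of the closed exterior is closed because F is proper: when |z| > L, the point F z is
    farther than 1 from p, and on the compact remainder |F - p| attains a positive minimum. *)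
Lemma open_V1 : open V1.
Proof.
move=> p Vp.
pose L := (normc p + 2) / (s * (2 / 5)) + 1.
have c0 : 0 < s * (2 / 5) by rewrite mulr_gt0.
have L1 : 1 <= L by rewrite lerDr divr_ge0 ?addr_ge0 ?normc_ge0// ltW.
pose mk (xy : R * R) : C := xy.1 +i* xy.2.
pose A := (`[- L, L] `*` `[- L, L] : set (R * R)) `&` [set xy | 1 <= normc (mk xy)].
have cA : compact A.
  apply: compact_closedI; first by apply: compact_setX; exact: segment_compact.
  have -> : [set xy | 1 <= normc (mk xy)] = (fun xy => normc (mk xy) : R) @^-1` [set r : R | 1 <= r] by [].
  apply: closed_comp; last exact: closed_ge.
  move=> xy _; apply: (@continuous_comp _ _ _ mk (fun w : C => normc w : R)).
    exact: mk_continuous.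
  exact: normc_continuous.
have A0 : A !=set0.
  exists (1, 0); split => /=; first by split; rewrite /= in_itv/=; apply/andP; split; lra.
  by rewrite /mk/= expr1n expr0n addr0 sqrtr1.
have cF : {within A, continuous (fun xy => normc (F (mk xy) - p) : R)}.
  apply: continuous_in_subspaceT => xy; rewrite inE => -[_ xy1]; have {xy1} xyO : Om (mk xy) := Omega_ext m xy1.
  apply: (@continuous_comp _ _ _ (fun xy : R * R => (F (mk xy) - p : C)) (fun w : C => normc w : R)).
    apply: (@continuous_comp _ _ _ mk (fun z => F z - p)); first exact: mk_continuous.
    exact: (cderiv_continuous (cderivB (cderiv_F xyO) (cderiv_cst p _))).
  exact: normc_continuous.
have [[x y]] := compact_EVT_min A0 cA cF.
rewrite inE => -[_ xy1] xymin.
pose r : R := normc (F (mk (x, y)) - p).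
have {}xymin : forall q : R * R, q \in A -> r <= normc (F (mk q) - p) := xymin.
have r0 : 0 < r.
  by rewrite normc_gt0 subr_eq0; apply/eqP => E; apply: Vp; rewrite -E; exact: imageP.
apply/nbhs_normcP; exists (Num.min r 1); first by rewrite lt_min r0 ltr01.
move=> q; rewrite lt_min => /andP[qr q1] [z z1 zq].
have [zL|zL] := leP (normc z) L.
  have : A (complex.Re z, complex.Im z).
    split; last by move: z1; rewrite /mk /=; case: (z).
    by split; rewrite /= in_itv/= -ler_norml (le_trans _ zL)// ?norm_Re_le ?norm_Im_le.
  move/mem_set/xymin; rewrite /mk.
  have -> : complex.Re z +i* complex.Im z = z by case: (z).
  by rewrite zq leNgt qr.
have /andP[h _] := F_ratio (Omega_ext m z1).
have h2 : normc p + 2 < s * (2 / 5) * normc z.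
  rewrite mulrC -ltr_pdivrMr// (lt_trans _ zL)// /L; lra.
have := le_normcD (q - p) p; rewrite subrK -zq => h3.
rewrite zq in h h3.
by move: h h2 h3 q1; move: (normc (q - p) : R) (normc p : R) (normc q : R) => *; lra.
Qed.

Lemma connected_UV (A : set C) : connected A -> (forall p, A p -> ~ S1 p) ->
  (A `&` U1 !=set0 -> A `<=` U1) /\ (A `&` V1 !=set0 -> A `<=` V1).
Proof.
move=> cA AS.
split; [apply: (connected_sub_open cA open_U1 open_V1)|
        apply: (connected_sub_open cA open_V1 open_U1)].
- by move=> p /AS/notS_UV.
- by move=> p [Up Vp]; exact: (UV_disj Up Vp).
- by move=> p /AS/notS_UV[]; [right|left].
- by move=> p [Vp Up]; exact: (UV_disj Up Vp).
Qed.

Lemma connected_path (g : R -> C) (I : interval R) :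
  (forall t, t \in I -> exists v, pderiv g t v) -> connected (g @` [set` I]).
Proof.
move=> gd; apply: connected_continuous_connected.
  exact/connected_intervalP/interval_is_interval.
apply: continuous_in_subspaceT => t; rewrite inE/= => /gd[v] hv.
exact: pderiv_continuous hv.
Qed.

Lemma pderiv_ray (u : C) t : pderiv (fun t => t%:C * u) t u.
Proof.
apply/pderivP => e e0; exists 1 => // h _.
have -> : (t + h)%:C * u - t%:C * u - h%:C * u = 0 by rewrite rmorphD; ring.
by rewrite normc0 mulr_ge0// ltW.
Qed.

Lemma pderiv_circle (r : R) t : pderiv (fun t => r%:C * expi t) t (r%:C * ('i%C * expi t)).
Proof.
have h := cderivM (cderiv_cst r%:C (expi t)) (cderiv_id _).
have := pderiv_comp h (pderiv_expi t).
by rewrite mulr0 addr0 mulr1.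
Qed.

Lemma S1_bound p : S1 p -> normc p <= s * (5 / 2).
Proof.
move=> [z z1 <-]; have zO : Om z by apply: Omega_ext; rewrite z1.
by have /andP[_] := F_ratio zO; rewrite z1 mulr1.
Qed.

Lemma F_real (t : R) : 1 < t -> F t%:C = (normc (F t%:C))%:C.
Proof.
move=> t1; have tO : Om t%:C by apply: Omega_ext; rewrite normc_real (le_trans (ltW t1))// ler_norm.
have t0 : 0 < t by lra.
have wb := wbeta_neq0 H tO.
have be0 := beta_gt0 H; have y0 := y_gt0 H.
suff [r r0 E] : exists2 r : R, 0 < r & F t%:C = r%:C.
  by rewrite E -[in LHS](gtr0_norm r0) -normc_real.
exists (s * (t * (t ^+ m + zeroQ m b) / (t ^+ m + poleP m b))).
  by rewrite mulr_gt0// divr_gt0 ?mulr_gt0 ?addr_gt0 ?exprn_gt0.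
rewrite /F PhiE// [RHS]rmorphM; congr (_ * _).
by rewrite -rmorphXn -!rmorphD -rmorphM -fmorphV -rmorphM.
Qed.

(** Far points are reached by connectedness. The curve lies in the disc of radius s * (5/2); beyond
    it the positive real ray contains F T for a large real T, because F is positive there
    ([F_real]), and every larger circle about 0 crosses that ray. *)
Lemma large_U1 p : s * (5 / 2) < normc p -> U1 p.
Proof.
move=> pL; have [t pE] := polar p.
set L := s * (5 / 2) in pL; have L0 : 0 < L by rewrite mulr_gt0.
pose ray := (fun t : R => t%:C * (1 : C)) @` `]L, +oo[.
have rayU : ray `<=` U1.
  apply: (connected_UV _ _).1.
  - by apply: connected_path => r _; exists 1; exact: pderiv_ray.
  - move=> _ [r rL <-] /S1_bound; rewrite mulr1 normc_real => Lr.
    move: rL; rewrite /= in_itv/= andbT => rL.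
    by have := le_trans (ler_norm r) Lr; rewrite leNgt rL.
  pose T := L / (s * (2 / 5)) + 2.
  have T2 : 2 <= T by rewrite lerDr divr_ge0 ?ltW// mulr_gt0.
  have T1 : 1 < T by lra.
  have TO : 1 < normc (T%:C : C) by rewrite normc_real (lt_le_trans T1)// ler_norm.
  have /andP[h _] := F_ratio (Omega_ext m (ltW TO)).
  exists (F T%:C); split; last by exists T%:C.
  exists (normc (F T%:C)); last by rewrite mulr1 -F_real.
  rewrite /= in_itv/= andbT (lt_le_trans _ h)// normc_real gtr0_norm; last by lra.
  by rewrite mulrC -ltr_pdivrMr ?mulr_gt0// /T; lra.
pose circ := (fun t : R => (normc p)%:C * expi t : C) @` `]-oo, +oo[.
have circU : circ `<=` U1.
  apply: (connected_UV _ _).1.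
  - by apply: connected_path => r _; exists ((normc p)%:C * ('i%C * expi r)); exact: pderiv_circle.
  - move=> _ [r _ <-] /S1_bound; rewrite normcM normc_expi mulr1 normc_real.
    by move/(le_trans (ler_norm _)); rewrite leNgt pL.
  exists ((normc p)%:C); split.
    by exists 0; rewrite ?expi0 ?mulr1//= in_itv.
  apply: rayU; exists (normc p); rewrite ?mulr1//= in_itv/= andbT//.
by apply: circU; exists t; rewrite -?pE//= in_itv.
Qed.

(** A point F z of the exterior image lies on the image of the radial half-line from z to infinity,
    an unbounded connected set off the curve. A component meeting [V1] stays in [V1], which is
    bounded by [large_U1]. *)
Lemma inner_V1 : inner_domain S1 = V1.
Proof.
apply/seteqP; split => p.
  move=> [nS bd]; have [[z z1 zp]|//] := notS_UV nS; exfalso.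
  have [t zE] := polar z; have z1' : 1 < normc z := z1.
  pose path := (fun r : R => F (r%:C * expi t)) @` `[normc z, +oo[.
  have pc : connected path.
    apply: connected_path => r; rewrite in_itv/= andbT => rz.
    have rO : Om (r%:C * expi t).
      apply: Omega_ext; rewrite normcM normc_expi mulr1 normc_real.
      by rewrite (le_trans (ltW z1'))// (le_trans rz)// ler_norm.
    by eexists; exact: (pderiv_comp (cderiv_F rO) (pderiv_ray (expi t) r)).
  have pathext r : normc z <= r -> 1 < normc (r%:C * expi t).
    move=> zr; rewrite normcM normc_expi mulr1 normc_real.
    by rewrite (lt_le_trans z1')// (le_trans zr)// ler_norm.
  have pS : path `<=` ~` S1.
    move=> _ [r /= + <-] /SU_disj; rewrite in_itv/= andbT => rz; apply.
    by exists (r%:C * expi t) => //; exact: pathext.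
  have pp : path p by exists (normc z); [rewrite /= in_itv/= lexx|rewrite -zE].
  have sub := connected_component_max pp pS pc.
  have /bounded_setP[B hB] := bd.
  pose r := Num.max (normc z) (B / (s * (2 / 5)) + 1).
  have zr : normc z <= r by rewrite le_max lexx.
  have : path (F (r%:C * expi t)) by exists r => //=; rewrite in_itv/= andbT.
  move/sub/hB; apply/negP; rewrite -ltNge.
  have c0 : 0 < s * (2 / 5) by rewrite mulr_gt0.
  have /andP[h _] := F_ratio (Omega_ext m (ltW (pathext r zr))).
  apply: lt_le_trans h; rewrite mulrC -ltr_pdivrMr// normcM normc_expi mulr1 normc_real.
  apply: lt_le_trans (ler_norm _); rewrite lt_max; apply/orP; right.
  by rewrite ltrDl.
move=> Vp; have nS : ~ S1 p by move=> /SV_disj; apply.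
split => //; apply/bounded_setP; exists (s * (5 / 2)) => q.
have sub : connected_component (~` S1) p `<=` V1.
  apply: (connected_UV _ _).2; first exact: component_connected.
    exact: connected_component_sub.
  by exists p; split => //; exact: connected_component_refl.
by move=> /sub Vq; rewrite leNgt; apply/negP => /large_U1 Uq; exact: (UV_disj Uq).
Qed.

Lemma outer_U1 : outer_domain S1 = U1.
Proof.
apply/seteqP; split => p.
  move=> [nS bd]; have [//|Vp] := notS_UV nS; exfalso; apply: bd.
  by move: Vp; rewrite -inner_V1 => -[].
move=> Up; have nS : ~ S1 p by move=> /SU_disj; apply.
split => // bd; have : inner_domain S1 p by [].
by rewrite inner_V1; exact: UV_disj.
Qed.
End Domains.

(** * The potential *)

Section Calculus.
Variable R : realType.
Local Notation C := (plane R).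
Implicit Types (z w u v p q : C).

Lemma cderiv_comp (f g : C -> C) z df dg : cderiv g z dg -> cderiv f (g z) df ->
  cderiv (fun w => f (g w)) z (df * dg).
Proof.
move=> gd fd e e0.
have M0 : 0 < normc dg + 1 by rewrite ltr_pwDr ?normc_ge0.
have N0 : 0 < normc df + 1 by rewrite ltr_pwDr ?normc_ge0.
have e20 : 0 < e / 2 by rewrite divr_gt0.
have [d1 d10 h1] := fd (e / 2 / (normc dg + 1)) (divr_gt0 e20 M0).
have [d2 d20 h2] := gd (e / 2 / (normc df + 1)) (divr_gt0 e20 N0).
have [d3 d30 h3] := cderiv_bound gd.
exists (Num.min d2 (Num.min d3 (d1 / (normc dg + 1)))).
  by rewrite !lt_min d20 d30 divr_gt0.
move=> w; rewrite !lt_min => /and3P[wd2 wd3 wd1].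
pose k := g (z + w) - g z; have kle : normc k <= (normc dg + 1) * normc w := h3 w wd3.
have kd1 : normc k < d1 by rewrite (le_lt_trans kle)// mulrC -ltr_pdivlMr.
have -> : f (g (z + w)) - f (g z) - df * dg * w =
   (f (g z + k) - f (g z) - df * k) + df * (k - dg * w).
  by rewrite /k [g z + _]addrC subrK; ring.
rewrite (le_trans (le_normcD _ _))// (splitr (e * normc w)) lerD//.
  rewrite (le_trans (h1 _ kd1))// (le_trans (ler_wpM2l _ kle))//.
    by rewrite !divr_ge0 ?(ltW e0)// ltW.
  have -> : e / 2 / (normc dg + 1) * ((normc dg + 1) * normc w) =
     e * normc w / 2 * ((normc dg + 1) / (normc dg + 1)) by ring.
  by rewrite divff ?mulr1// gt_eqF.
rewrite normcM (le_trans (ler_wpM2l (normc_ge0 _) (h2 _ wd2)))//.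
have -> : normc df * (e / 2 / (normc df + 1) * normc w) =
  (e * normc w / 2) * (normc df / (normc df + 1)) by ring.
rewrite ler_piMr//; first by rewrite divr_ge0// mulr_ge0 ?normc_ge0// ltW.
by rewrite ler_pdivrMr// mul1r lerDl.
Qed.

Lemma pderiv_line z v t : pderiv (fun t => z + t%:C * v) t v.
Proof.
apply/pderivP => e e0; exists 1 => // h _.
have -> : z + (t + h)%:C * v - (z + t%:C * v) - h%:C * v = 0 by rewrite rmorphD; ring.
by rewrite normc0 mulr_ge0// ltW.
Qed.

Lemma ln_normc z : ln (normc z : R) = 2^-1 * ln (complex.Re z ^+ 2 + complex.Im z ^+ 2).
Proof.
(* At z = 0 both sides vanish, since [ln] is 0 at 0. *)
rewrite -normc_sqr; have [->|z0] := eqVneq z 0; first by rewrite normc0 expr0n ln0 ?mulr0.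
by rewrite lnXn ?normc_gt0// -[X in _ * X]mulr_natl mulrA mulVf ?mul1r.
Qed.

Lemma is_derive_ln_normc (g : R -> C) t v : g t != 0 -> pderiv g t v ->
  is_derive t (1 : R) (fun r => ln (normc (g r) : R)) (complex.Re (v / g t)).
Proof.
move=> g0 [gR gI].
have -> : (fun r => ln (normc (g r) : R)) =
  (fun r => 2^-1 * ln (complex.Re (g r) ^+ 2 + complex.Im (g r) ^+ 2)).
  by apply/funext => r; rewrite ln_normc.
set gr := fun r => complex.Re (g r); set gi := fun r => complex.Im (g r).
have h0 : 0 < gr t ^+ 2 + gi t ^+ 2 by rewrite /gr /gi -normc_sqr exprn_gt0// normc_gt0.
have h1 : is_derive t (1 : R) (fun r => gr r ^+ 2 + gi r ^+ 2)
   (2 * gr t * complex.Re v + 2 * gi t * complex.Im v).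
  have hr := is_deriveX 2 gR; have hi := is_deriveX 2 gI.
  apply: is_derive_eq (is_deriveD hr hi) _.
  by rewrite /GRing.scale /= !expr1.
have h2 := is_derive1_comp (g := fun r => gr r ^+ 2 + gi r ^+ 2) (is_derive1_ln h0) h1.
apply: is_derive_eq (is_deriveZ (2^-1) h2) _.
rewrite /GRing.scale /= divcE// ReM normc_sqr -/(gr t) -/(gi t).
rewrite /gr /gi in h0 *; case: (g t) v h0 {gR gI h1 h2} => p q [v1 v2] /= h0.
by field; rewrite gt_eqF.
Qed.

Lemma Re_continuous (T : topologicalType) (f : T -> C) (t : T) :
  {for t, continuous f} -> {for t, continuous (fun t => complex.Re (f t) : R)}.
Proof.
move=> /continuous_normcP cf; apply/cvgrPdist_lt => e /cf; apply: filterS => s.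
by apply: le_lt_trans; rewrite -ReN -ReD normcB norm_Re_le.
Qed.

Lemma near_eq_continuous (T U : topologicalType) (f g : T -> U) (t : T) :
  (\forall r \near t, f r = g r) -> {for t, continuous f} -> {for t, continuous g}.
Proof.
move=> E; rewrite /prop_for /continuous_at (nbhs_singleton E) => c.
exact: cvg_trans (near_eq_cvg E) c.
Qed.

Lemma ccont_comp (T U V : topologicalType) (f : T -> U) (g : U -> V) (t : T) :
  {for t, continuous f} -> {for f t, continuous g} ->
  {for t, continuous (fun r => g (f r))}.
Proof. exact: continuous_comp. Qed.

Lemma ccontM (T : topologicalType) (f g : T -> C) (t : T) :
  {for t, continuous f} -> {for t, continuous g} ->
  {for t, continuous (fun r => f r * g r)}.
Proof. exact: (@continuousM R[i] T f g t). Qed.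

Lemma ccontD (T : topologicalType) (f g : T -> C) (t : T) :
  {for t, continuous f} -> {for t, continuous g} ->
  {for t, continuous (fun r => f r + g r)}.
Proof. exact: (@continuousD R[i] C T f g t). Qed.

Lemma ccontN (T : topologicalType) (f : T -> C) (t : T) :
  {for t, continuous f} -> {for t, continuous (fun r => - f r)}.
Proof. exact: (@continuousN R[i] C T f t). Qed.

Lemma ccont_cst (T : topologicalType) (c : C) (t : T) : {for t, continuous (fun=> c)}.
Proof. exact: cst_continuous. Qed.
End Calculus.

Section Potential.
Variable R : realType.
Local Notation C := (plane R).
Variables (m : nat) (b s : R).
Hypothesis H : small_param m b.
Hypothesis s0 : 0 < s.
Implicit Types (z w u v p q : C).
Local Notation Om := (@Omega R m).
Local Notation F := (bubble_map m b s).
Local Notation dF := (dbubble_map m b s).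
Local Notation G := (bubble_inv m b s).
Local Notation U1 := (bubble_ext m b s).
Local Notation x := (zeroP m b).
Local Notation beta := (poleP m b).

Definition ddPhi z : C := 2 * ((z ^+ m - x%:C) / (z ^+ m + beta%:C)) *
  (m%:R * z ^+ m.-1 * (x%:C + beta%:C) / (z ^+ m + beta%:C) ^+ 2).

Definition ddbubble_map z : C := s%:C * ddPhi z.
Local Notation ddF := ddbubble_map.

Lemma cderiv_wc z (c : C) : cderiv (fun w => w ^+ m + c) z (m%:R * z ^+ m.-1).
Proof. by apply: (cderiv_eq (cderivD (cderiv_pow m z) (cderiv_cst c z))); rewrite addr0. Qed.

Lemma cderiv_dPhi z : Om z -> cderiv (dPhi m b) z (ddPhi z).
Proof.
move=> zO; have wb := wbeta_neq0 H zO.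
have h1 := cderivM (cderiv_wc z (- x%:C)) (cderivV (f := fun w => w ^+ m + beta%:C) wb (cderiv_wc z beta%:C)).
apply: (cderiv_eq (cderivX 2 h1)); rewrite /ddPhi expr1.
move: wb; move: (m%:R * z ^+ m.-1) (x%:C : C) (beta%:C : C) (z ^+ m) => A B D W wb.
by field.
Qed.

Lemma ddPhi_continuous z : Om z -> {for z, continuous ddPhi}.
Proof.
move=> zO; have wb := wbeta_neq0 H zO.
have h1 := cderivM (cderiv_wc z (- x%:C)) (cderivV (f := fun w => w ^+ m + beta%:C) wb (cderiv_wc z beta%:C)).
have h2 := cderivM (cderiv_cst 2 z) h1.
have h3 := cderivM (cderivM (cderiv_cst m%:R z) (cderivX m.-1 (cderiv_id z))) (cderiv_cst (x%:C + beta%:C) z).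
have h4 := cderivV (f := fun w => (w ^+ m + beta%:C) ^+ 2) (expf_neq0 2 wb) (cderivX 2 (cderiv_wc z beta%:C)).
exact: cderiv_continuous (cderivM h2 (cderivM h3 h4)).
Qed.

Lemma cderiv_dF z : Om z -> cderiv dF z (ddF z).
Proof.
move=> zO; apply: (cderiv_eq (cderivM (cderiv_cst s%:C z) (cderiv_dPhi zO))).
by rewrite mulr0 addr0.
Qed.

Lemma ddF_continuous z : Om z -> {for z, continuous ddF}.
Proof.
move=> zO; apply/continuous_normcP => e e0.
have /continuous_normcP/(_ (e / s)) := ddPhi_continuous zO.
rewrite divr_gt0// => /(_ isT); apply: filterS => w.
rewrite ltr_pdivlMr// mulrC => h.
have -> : ddF w - ddF z = s%:C * (ddPhi w - ddPhi z) by rewrite mulrBr.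
by rewrite normcM normc_real gtr0_norm.
Qed.

Definition bubble_psi p : R := ln (normc (G p) : R).
Local Notation psi := bubble_psi.

Lemma psi_F z : Om z -> psi (F z) = ln (normc z : R).
Proof. move=> zO.
rewrite /psi.
rewrite (FK H s0 zO).
by []. Qed.

(** 1 / (z F'(z)) is the derivative of log G at F z. Only the modulus of G is differentiated, so no
    branch of the logarithm has to be chosen. *)
Lemma psi_line z v : Om z ->
  is_derive 0 (1 : R) (on_line psi (F z) v) (complex.Re (v * (z * dF z)^-1)).
Proof.
move=> zO; have zG : G (F z + 0%:C * v) = z by rewrite rmorph0 mul0r addr0 FK.
have gd : cderiv G (F z + 0%:C * v) (dF z)^-1.
  by rewrite rmorph0 mul0r addr0; exact: cderiv_G.
have h := pderiv_comp gd (pderiv_line (F z) v 0).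
have := is_derive_ln_normc _ h; rewrite zG => /(_ (Omega_neq0 H zO)) h'.
apply: is_derive_eq h' _; congr complex.Re.
by rewrite (invfM z (dF z)); ring.
Qed.

Lemma ddir_psi z v : Om z -> ddir v psi (F z) = complex.Re (v * (z * dF z)^-1).
Proof.
by move=> zO; rewrite /ddir derive1E; have [_ ->] := psi_line v zO.
Qed.

Definition dK z : C := - (dF z + z * ddF z) / (z * dF z) ^+ 2.

Lemma cderiv_K z : Om z -> cderiv (fun z => (z * dF z)^-1) z (dK z).
Proof.
move=> zO; have zd : z * dF z != 0 by apply: mulf_neq0; [exact: (Omega_neq0 H)|exact: dF_neq0].
apply: (cderiv_eq (cderivV (f := fun z => z * dF z) zd (cderivM (cderiv_id z) (cderiv_dF zO)))).
by rewrite /dK mulr1 [_ + dF z]addrC.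
Qed.

(** The second complex derivative of log G, as a function on the bubble side; harmonicity of psi
    then reduces to 1 + i^2 = 0. *)
Definition dKG p : C := dK (G p) * (dF (G p))^-1.

Lemma cderiv_KG z : Om z -> cderiv (fun p => (G p * dF (G p))^-1) (F z) (dKG (F z)).
Proof.
move=> zO; have h : cderiv (fun z => (z * dF z)^-1) (G (F z)) (dK z).
  by rewrite FK//; exact: cderiv_K.
have := cderiv_comp (cderiv_G H s0 zO) h.
by rewrite /dKG FK.
Qed.

Lemma near_FOm z : Om z -> \forall q \near F z, (F @` Om) q.
Proof. by move=> zO; apply: F_open => //; exact: Om_open. Qed.

Lemma near_ddir_psi z v : Om z ->
  \forall q \near F z, complex.Re (v * (G q * dF (G q))^-1) = ddir v psi q.
Proof. by move=> /near_FOm; apply: filterS => _ [w wO <-]; rewrite (ddir_psi _ wO) (FK H s0 wO). Qed.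

Lemma near_line p v (P : set C) : (\forall q \near p, P q) ->
  \forall t \near (0 : R), P (p + t%:C * v).
Proof.
move=> Pp; have := pderiv_continuous (pderiv_line p v 0).
by move=> /(_ P); apply; rewrite rmorph0 mul0r addr0.
Qed.

Lemma ddir_psi_line z v v' : Om z ->
  is_derive 0 (1 : R) (on_line (ddir v psi) (F z) v') (complex.Re (v * (dKG (F z) * v'))).
Proof.
move=> zO.
have kd : cderiv (fun p => v * (G p * dF (G p))^-1) (F z + 0%:C * v') (v * dKG (F z)).
  rewrite rmorph0 mul0r addr0; apply: (cderiv_eq (cderivM (cderiv_cst v _) (cderiv_KG zO))).
  by rewrite mulr0 addr0.
have [h _] := pderiv_comp kd (pderiv_line (F z) v' 0).
rewrite mulrA; apply: near_eq_is_derive h.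
by have := near_line v' (near_ddir_psi v zO).
Qed.

Lemma ddir_ddir_psi z v v' : Om z ->
  ddir v' (ddir v psi) (F z) = complex.Re (v * (dKG (F z) * v')).
Proof.
by move=> zO; rewrite /ddir derive1E; have [_ ->] := ddir_psi_line v v' zO.
Qed.

Lemma dK_continuous z : Om z -> {for z, continuous dK}.
Proof.
move=> zO.
have zd : z * dF z != 0 by apply: mulf_neq0; [exact: (Omega_neq0 H)|exact: dF_neq0].
have c1 := cderiv_continuous (cderiv_dF zO); have c2 := ddF_continuous zO.
have c3 : {for z, continuous (fun z => ((z * dF z) ^+ 2)^-1)}.
  have h := cderivX 2 (cderivM (cderiv_id z) (cderiv_dF zO)).
  exact: cderiv_continuous (cderivV (f := fun z => (z * dF z) ^+ 2) (expf_neq0 2 zd) h).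
have c4 : {for z, continuous (fun z => z * ddF z)}.
  exact: (ccontM (cderiv_continuous (cderiv_id z)) c2).
exact: (ccontM (ccontN (ccontD c1 c4)) c3).
Qed.

Lemma dKG_continuous z : Om z -> {for F z, continuous dKG}.
Proof.
move=> zO; have cG := cderiv_continuous (cderiv_G H s0 zO).
have c1 := cderiv_continuous (cderivV (dF_neq0 H s0 zO) (cderiv_dF zO)).
apply: (ccont_comp (g := fun w => dK w * (dF w)^-1) cG); rewrite (FK H s0 zO).
exact: (ccontM (dK_continuous zO) c1).
Qed.

Lemma psi_C1 : C1_on U1 psi.
Proof.
move=> v _ _ [z z1 <-]; have zO : Om z by exact/Omega_ext/ltW.
split; first by have [] := psi_line v zO.
have h := cderivM (cderiv_cst v _) (cderiv_KG zO).
have c := Re_continuous (cderiv_continuous h).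
have E := near_ddir_psi v zO.
exact: near_eq_continuous E c.
Qed.

Lemma psi_C2 : C2_on U1 psi.
Proof.
split; first exact: psi_C1.
move=> v _ v' _ _ [z z1 <-]; have zO : Om z by exact/Omega_ext/ltW.
split; first by have [] := ddir_psi_line v v' zO.
have c : {for F z, continuous (fun p => complex.Re (v * (dKG p * v')) : R)}.
  apply: Re_continuous; apply: (ccontM (f := fun=> v)); first exact: ccont_cst.
  by apply: (ccontM (f := dKG)); [exact: dKG_continuous|exact: ccont_cst].
have E : \forall q \near F z, complex.Re (v * (dKG q * v')) = ddir v' (ddir v psi) q.
  by have := near_FOm zO; apply: filterS => _ [w wO <-]; rewrite ddir_ddir_psi.
exact: near_eq_continuous E c.
Qed.

Lemma psi_harmonic p : U1 p -> - laplacian psi p = 0.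
Proof.
move=> [z z1 <-]; have zO : Om z by exact/Omega_ext/ltW.
rewrite /laplacian !ddir_ddir_psi// -ReD.
have -> : (1 : C) * (dKG (F z) * 1) + 'i%C * (dKG (F z) * 'i%C) = dKG (F z) * (1 + 'i%C ^+ 2) by ring.
by rewrite sqr_i subrr mulr0 oppr0.
Qed.

Lemma psi_continuous z : Om z -> {for F z, continuous psi}.
Proof.
move=> zO; apply: (ccont_comp (g := fun w => ln (normc w : R)) (cderiv_continuous (cderiv_G H s0 zO))).
rewrite (FK H s0 zO); apply: (ccont_comp (g := @ln R) (@normc_continuous R z)).
by apply: continuous_ln; rewrite normc_gt0 (Omega_neq0 H).
Qed.
End Potential.

(** * The boundary equation *)

Section Curves.
Variable R : realType.
Local Notation C := (plane R).
Implicit Types (z w u v p q n : C).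

Lemma expi_eq1 (d : R) : - (2 * pi) < d < 2 * pi -> expi d = 1 -> d = 0.
Proof.
move=> /andP[d1 d2] [c1 _].
have sd : sin (d / 2) = 0.
  have : cos (d / 2 *+ 2) = 1 by rewrite -mulr_natr divfK.
  rewrite cos_mulr2n cos2sin2 -mulr_natr => h.
  by apply/eqP; rewrite -sqrf_eq0; apply/eqP; lra.
have [//|/eqP d0] := eqVneq d 0.
have [d3|d3] := ltP 0 d.
  have : 0 < sin (d / 2) by apply: sin_gt0_pi; apply/andP; split; lra.
  by rewrite sd ltxx.
have {}d3 : d < 0 by rewrite lt_neqAle d3 andbT; apply/eqP.
have : 0 < sin (- (d / 2)) by apply: sin_gt0_pi; apply/andP; split; lra.
by rewrite sinN sd oppr0 ltxx.
Qed.

Lemma expi_inj_lt2pi (t t' : R) : - (2 * pi) < t - t' < 2 * pi -> expi t = expi t' -> t = t'.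
Proof.
move=> h E; apply/eqP; rewrite -subr_eq0; apply/eqP/expi_eq1 => //.
by apply: (mulIf (expi_neq0 t')); rewrite -expiD subrK mul1r.
Qed.

Lemma velocityE (g : R -> C) t v : pderiv g t v -> velocity g t = v.
Proof.
by move=> [[_ h1] [_ h2]]; rewrite /velocity !derive1E h1 h2; case: v {h1 h2}.
Qed.

Lemma pderiv_C1 (g h : R -> C) : (forall t, pderiv g t (h t)) -> continuous h -> C1_curve g.
Proof.
move=> gd hc; split.
- by move=> t; have [[]] := gd t.
- by move=> t; have [_ []] := gd t.
by have -> : velocity g = h by apply/funext => t; exact: velocityE.
Qed.

Lemma dotE z w : dot z w = complex.Re (z * w^*).
Proof. by rewrite /dot; case: z; case: w => * /=; ring. Qed.

Lemma pos_derive_sign (f : R -> R) (d : R) : 0 < d -> f 0 = 0 -> is_derive 0 (1 : R) f d ->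
  \forall h \near 0^'+, 0 < f h /\ f (- h) < 0.
Proof.
move=> d0 f0 /is_derive_dP/(_ (d / 2))[|e e0 he]; first by rewrite divr_gt0.
near=> h.
have h0 : 0 < h by [].
have hle : h < e by near: h; exact: nbhs_right_lt.
have := he h; rewrite gtr0_norm// => /(_ hle); rewrite add0r f0 subr0 ler_norml => /andP[a1 _].
have := he (- h); rewrite normrN gtr0_norm// => /(_ hle).
rewrite add0r f0 subr0 ler_norml => /andP[_ a2].
have dh : 0 < d * h by rewrite mulr_gt0.
by split; lra.
Unshelve. all: by end_near. Qed.
End Curves.

Section Boundary.
Variable R : realType.
Local Notation C := (plane R).
Variables (m : nat) (b s : R).
Hypothesis H : small_param m b.
Hypothesis s0 : 0 < s.
Implicit Types (z w u v p q : C).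
Local Notation Om := (@Omega R m).
Local Notation F := (bubble_map m b s).
Local Notation dF := (dbubble_map m b s).
Local Notation ddF := (ddbubble_map m b s).
Local Notation S1 := (bubble_curve m b s).
Local Notation psi := (bubble_psi m b s).
Local Notation x := (zeroP m b).

Definition bubble_param (t : R) : C := F (expi t).
Local Notation gam := bubble_param.
Definition bubble_vel (t : R) : C := dF (expi t) * ('i%C * expi t).
Local Notation vel := bubble_vel.
Definition bubble_acc (t : R) : C := 'i%C * (dF (expi t) + expi t * ddF (expi t)) * ('i%C * expi t).
Local Notation acc := bubble_acc.

Lemma expi_Om t : Om (expi t).
Proof. by apply: Omega_ext; rewrite normc_expi. Qed.

Lemma pderiv_gam t : pderiv gam t (vel t).
Proof. exact: pderiv_comp (cderiv_F s H (expi_Om t)) (pderiv_expi t). Qed.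

Lemma pderiv_vel t : pderiv vel t (acc t).
Proof.
have zO := expi_Om t.
have h : cderiv (fun z => dF z * ('i%C * z)) (expi t) ('i%C * (dF (expi t) + expi t * ddF (expi t))).
  apply: (cderiv_eq (cderivM (cderiv_dF s H zO) (cderivM (cderiv_cst 'i%C _) (cderiv_id _)))).
  by rewrite mulr1 mulr0 addr0 [RHS]mulrDr; congr (_ + _); [exact: mulrC|exact/esym/mulrA].
exact: (pderiv_comp h (pderiv_expi t)).
Qed.

Lemma acc_continuous : continuous acc.
Proof.
move=> t; have zO := expi_Om t.
have cid := cderiv_continuous (cderiv_id (expi t)).
have c1 := ccontD (cderiv_continuous (cderiv_dF s H zO)) (ccontM cid (ddF_continuous H s0 zO)).
have c2 := ccontM (ccontM (@ccont_cst R C 'i%C (expi t)) c1) (ccontM (@ccont_cst R C 'i%C (expi t)) cid).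
have c3 : {for t, continuous acc}.
  apply: (ccont_comp (g := fun z => ('i%C * (dF z + z * ddF z) * ('i%C * z)) : C) _ c2).
  exact: (pderiv_continuous (pderiv_expi t)).
exact: c3.
Qed.

Lemma velE : velocity gam = vel.
Proof. by apply/funext => t; exact: velocityE (pderiv_gam t). Qed.

Lemma accE : velocity vel = acc.
Proof. by apply/funext => t; exact: velocityE (pderiv_vel t). Qed.

Lemma jordan_gam : jordan_param S1 gam.
Proof.
split.
- split; first by apply: (pderiv_C1 pderiv_gam) => t; exact: pderiv_continuous (pderiv_vel t).
  by rewrite velE; apply: (pderiv_C1 pderiv_vel); exact: acc_continuous.
- move=> t; rewrite velE /vel; apply: mulf_neq0; first exact: dF_neq0 (expi_Om t).
  by apply: mulf_neq0; [rewrite -normc_gt0 /= expr0n expr1n add0r sqrtr1|exact: expi_neq0].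
- by move=> t; rewrite /gam expi2pi.
- move=> t t'; rewrite !inE/= !in_itv/= => /andP[t0 t2] /andP[t0' t2'] E.
  apply: expi_inj_lt2pi; first by apply/andP; split; lra.
  exact: (F_inj H s0 (expi_Om t) (expi_Om t') E).
apply/seteqP; split => p.
  by move=> [t _ <-]; apply: imageP; exact: normc_expi.
move=> [z z1 <-]; have [t zE] := polar z.
have -> : z = expi t by rewrite zE z1 mul1r.
exact: imageT.
Qed.

(** The radial direction at [expi t], transported by the conformal map and normalised. *)
Definition bubble_normal t : C := expi t * dF (expi t) / (normc (dF (expi t)))%:C.
Local Notation nor := bubble_normal.

Lemma nor_norm t : normc (nor t) = 1.
Proof.
have d0 := dF_neq0 H s0 (expi_Om t).
rewrite normcM normcV normc_real ger0_norm ?normc_ge0// normcM normc_expi mul1r.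
by rewrite divff// normc_eq0.
Qed.

Lemma normal_derivative t :
  is_derive 0 (1 : R) (on_line psi (gam t) (nor t)) (normc (dF (expi t)))^-1.
Proof.
have d0 := dF_neq0 H s0 (expi_Om t); have zn0 := expi_neq0 t.
apply: is_derive_eq (psi_line H s0 (nor t) (expi_Om t)) _.
rewrite /nor mulrAC divff; last by apply: mulf_neq0.
by rewrite mul1r -fmorphV.
Qed.

Lemma psi_gam t : psi (gam t) = 0.
Proof. by rewrite /gam psi_F ?normc_expi ?ln1//; exact: expi_Om. Qed.

(** The sign of psi tells the two sides apart: psi (F z) = log |z| is positive exactly when |z| > 1.
    Near the curve every point has a preimage in [Omega], and psi vanishes on the curve with
    positive derivative along the normal. *)
Lemma normal_gam t : outer_unit_normal S1 gam t (nor t).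
Proof.
have d0 := dF_neq0 H s0 (expi_Om t); have zn0 := expi_neq0 t.
split; first exact: nor_norm.
  rewrite velE dotE /nor /vel.
  move: (expi t) (dF (expi t)) => z d.
  have -> : d * ('i%C * z) = 'i%C * (z * d) by rewrite mulrCA (mulrC d).
  rewrite -fmorphV; move: (normc d)^-1 (z * d) => r [a c] /=; ring.
rewrite inner_V1// outer_U1//.
have L0 : on_line psi (gam t) (nor t) 0 = 0 by rewrite /on_line rmorph0 mul0r addr0 psi_gam.
have dpos : 0 < (normc (dF (expi t)))^-1 by rewrite invr_gt0 normc_gt0.
have sg := pos_derive_sign dpos L0 (normal_derivative t).
have nO : \forall h \near 0^'+, (F @` Om) (gam t + h%:C * nor t) /\ (F @` Om) (gam t - h%:C * nor t).
  have n1 := near_line (nor t) (near_FOm H s0 (expi_Om t)).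
  have n2 := near_line (- nor t) (near_FOm H s0 (expi_Om t)).
  apply: cvg_within; near=> h; split; first by near: h.
  by rewrite -mulrN; near: h.
near=> h.
have [p1 p2] : 0 < on_line psi (gam t) (nor t) h /\ on_line psi (gam t) (nor t) (- h) < 0 by near: h.
have [[z1 z1O E1] [z2 z2O E2]] : (F @` Om) (gam t + h%:C * nor t) /\ (F @` Om) (gam t - h%:C * nor t) by near: h.
move: p1 p2; rewrite /on_line rmorphN mulNr -E1 -E2 !psi_F// => p1 p2.
have q1 : 0 < normc z1 by rewrite normc_gt0 (Omega_neq0 H).
have q2 : 0 < normc z2 by rewrite normc_gt0 (Omega_neq0 H).
split.
  exists z1 => //; rewrite /unit_disc_ext/= -(ltr_ln (x := 1)) ?posrE//.
  by rewrite ln1.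
move=> [z z1' E]; have zO : Om z by exact: Omega_ext.
move: (F_inj H s0 zO z2O E) z1' => -> /=; rewrite leNgt -(ltr_ln (y := 1)) ?posrE//.
by rewrite ln1 p2.
Unshelve. all: by end_near. Qed.

Lemma normal_derivative_right t :
  has_normal_derivative psi (gam t) (nor t) (normc (dF (expi t)))^-1.
Proof.
have [h1 h2] := normal_derivative t.
have : (fun h : R => h^-1 *: ((on_line psi (gam t) (nor t) \o shift 0) (h *: (1:R)) - on_line psi (gam t) (nor t) 0)) @ 0^'
    --> ((normc (dF (expi t)))^-1 : R) by rewrite -h2; exact: h1.
move=> h; rewrite /has_normal_derivative.
have := cvg_dnbhs_at_right h; apply: cvg_trans; apply: near_eq_cvg; near=> k.
rewrite /= /GRing.scale /= mulr1 addr0 mulrC /on_line.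
by rewrite rmorph0 mul0r addr0.
Unshelve. all: by end_near. Qed.
End Boundary.

Section FreeBoundary.
Variable R : realType.
Local Notation C := (plane R).
Variables (m : nat) (b s : R).
Hypothesis H : small_param m b.
Hypothesis s0 : 0 < s.
Implicit Types (z w u v p q : C).
Local Notation dF := (dbubble_map m b s).
Local Notation ddF := (ddbubble_map m b s).
Local Notation gam := (bubble_param m b s).
Local Notation nor := (bubble_normal m b s).
Local Notation x := (zeroP m b).
Local Notation beta := (poleP m b).

Definition We0 : R := (m%:R + 1) * (1 - x ^+ 2) / (1 + beta * x).
(* On the unscaled curve [- We0 / 2 * (d_n psi) ^+ 2 + kappa = lambda0]. *)
Definition lambda0 : R :=
  - ((m%:R - 1) / (m%:R + 1)) - ((m%:R - 1) / (m%:R + 1)) ^+ 2 * (We0 / 2).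

(** This is the boundary equation multiplied by s A^2, where A = |w - x|^2, B = |w + beta|^2, w =
    exp (i m t) and c = cos (m t). Both sides are quadratic in c. The c^2 coefficient yields lambda0
    = - r - r^2 We0 / 2 with r = beta / x = (m - 1) / (m + 1), and the value of [We0] settles the
    other two. *)
Lemma free_boundary_poly (c : R) :
  let A := 1 + x ^+ 2 - 2 * x * c in let B := 1 + beta ^+ 2 + 2 * beta * c in
  - (We0 / 2) * B ^+ 2 + A * B +
     2 * m%:R * (x + beta) * (c * (1 - x * beta) + beta - x) = lambda0 * A ^+ 2.
Proof.
move=> A B; rewrite /lambda0 /We0 /A /B.
have p0 : (m%:R + 1 : R) != 0 by rewrite gt_eqF// ltr_wpDl.
have d0 : 1 + beta * x != 0.
  by rewrite gt_eqF// addr_gt0// mulr_gt0// ?(beta_gt0 H) ?(x_gt0 H).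
move: d0; rewrite /zeroP /poleP; move: (m%:R : R) p0 => M p0 d0.
by field; rewrite d0.
Qed.

Lemma curvature_gam t : curvature gam (nor t) t =
  (1 + complex.Re (expi t * ddF (expi t) / dF (expi t))) / normc (dF (expi t)).
Proof.
have d0 := dF_neq0 H s0 (expi_Om m t).
have n0 : normc (dF (expi t)) != 0 by rewrite normc_eq0.
rewrite /curvature (velE s H) (accE s H) dotE.
have -> : normc (bubble_vel m b s t) = normc (dF (expi t)).
  by rewrite /bubble_vel !normcM normc_expi mulr1 [normc 'i%C]/= expr0n expr1n add0r sqrtr1 mulr1.
have -> : bubble_acc m b s t * (bubble_normal m b s t)^* =
   (normc (dF (expi t)))%:C * (- (1 + expi t * ddF (expi t) / dF (expi t))).
  have nz := normc_expi t; rewrite /bubble_acc /nor.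
  move: (expi t) nz (dF (expi t)) (ddF (expi t)) d0 n0 => z nz d e d0 n0.
  (* On |z| = 1 the conjugate of z F' is |F'|^2 / (z F'), so that only field operations remain. *)
  have E : ((z * d)^* )%R = (normc d ^+ 2)%:C / (z * d).
    have zd0 : z * d != 0 by rewrite mulf_neq0// -normc_gt0 nz.
    apply: (mulIf zd0); rewrite divfK// mulrC mulc_conj normcM nz mul1r.
    by [].
  have -> : ((z * d / (normc d)%:C)^* )%R = (z * d)^* / (normc d)%:C.
    rewrite -fmorphV; move: (normc d)^-1 (z * d) => r [a c]; apply/eqP.
    by rewrite eq_complex /=; apply/andP; split; apply/eqP; ring.
  rewrite E (_ : (normc d ^+ 2)%:C = (normc d)%:C ^+ 2 :> C); last exact: rmorphXn.
  have z0 : z != 0 by rewrite -normc_gt0 nz.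
  have N0 : (normc d)%:C != 0 :> C by rewrite (inj_eq (@complexI R)).
  have -> : 'i%C * (d + z * e) * ('i%C * z) = - (z * (d + z * e)).
    by have -> : 'i%C * (d + z * e) * ('i%C * z) = 'i%C ^+ 2 * (z * (d + z * e)) by [ring]; rewrite sqr_i mulN1r.
  move: ((normc d)%:C : C) N0 => N N0.
  by field; rewrite N0 z0 d0.
rewrite ReM ReN ReD (_ : complex.Re (1 : C) = 1)//.
move: (complex.Re _ : R) (normc _ : R) n0 => X N n0.
by field.
Qed.

Lemma normc_dF t : let w := expi t ^+ m in
  normc (dF (expi t)) = s * (normc (w - x%:C) ^+ 2 / normc (w + beta%:C) ^+ 2).
Proof.
move=> w; rewrite /dF /dPhi -/w normcM normc_real gtr0_norm// normcX normcM normcV.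
by rewrite expr_div_n.
Qed.

Lemma free_boundary (We : R) t : We = s * We0 ->
  - (2^-1 * We * ((normc (dF (expi t)))^-1) ^+ 2) + curvature gam (nor t) t = lambda0 / s.
Proof.
move=> ->; rewrite curvature_gam normc_dF.
have zO := expi_Om m t.
have wb := wbeta_neq0 H zO; have wx := wx_neq0 H zO.
have -> : expi t * ddF (expi t) / dF (expi t) =
  (2 * m%:R * (x + beta))%:C * (expi t ^+ m / ((expi t ^+ m - x%:C) * (expi t ^+ m + beta%:C))).
  rewrite /ddF /ddPhi /dF /dPhi.
  have s1 : s%:C != 0 :> C by exact: realC_neq0.
  have -> : (2 * m%:R * (x + beta))%:C = 2 * m%:R * (x%:C + beta%:C) :> C.
    by rewrite rmorphM rmorphD rmorphM !natrC.
  rewrite -[X in _ = _ * (X / _)](exprm1 H).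
  move: wb wx s1; move: (x%:C : C) (beta%:C : C) (s%:C : C) (expi t ^+ m) (expi t ^+ m.-1) (expi t).
  by move=> X B S W V z wb wx s1; field; rewrite wb wx s1.
have -> : expi t ^+ m = expi (m%:R * t) by rewrite expiX.
rewrite ReM.
have := normc_expi (m%:R * t).
have -> : complex.Re (expi (m%:R * t) / ((expi (m%:R * t) - x%:C) * (expi (m%:R * t) + beta%:C)))
  = (cos (m%:R * t) * (1 - x * beta) + beta - x) /
    (normc (expi (m%:R * t) - x%:C) ^+ 2 * normc (expi (m%:R * t) + beta%:C) ^+ 2).
  have cs := cos2Dsin2 (m%:R * t).
  rewrite divcE; last by rewrite -expiX; apply: mulf_neq0.
  rewrite ReM normcM exprMn mulrC; congr (_ / _).
  rewrite /expi; move: (cos _) (sin _) cs => c e cs /=.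
  transitivity (c * (c ^+ 2 + e ^+ 2) + (beta - x) * (c ^+ 2 + e ^+ 2) - x * beta * c); first by ring.
  by rewrite cs; ring.
have [EA EB] : normc (expi (m%:R * t) - x%:C) ^+ 2 = 1 + x ^+ 2 - 2 * x * cos (m%:R * t) /\
   normc (expi (m%:R * t) + beta%:C) ^+ 2 = 1 + beta ^+ 2 + 2 * beta * cos (m%:R * t).
  have := cos2Dsin2 (m%:R * t); rewrite !normc_sqr /expi.
  by move: (cos _) (sin _) => c e cs /=; split; rewrite ?oppr0 !addr0; lra.
rewrite EA EB; move: (free_boundary_poly (cos (m%:R * t))) => /=.
have A0 : 0 < 1 + x ^+ 2 - 2 * x * cos (m%:R * t).
  by rewrite -EA exprn_gt0// normc_gt0 -expiX.
have B0 : 0 < 1 + beta ^+ 2 + 2 * beta * cos (m%:R * t).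
  by rewrite -EB exprn_gt0// normc_gt0 -expiX.
move: A0 B0; move: (1 + x ^+ 2 - _) (1 + beta ^+ 2 + _) => A B A0 B0.
set K := cos _ * _ + _ - _; move: K We0 lambda0 => K W L E _.
have -> : L / s = (L * A ^+ 2) / (s * A ^+ 2) by field; rewrite !gt_eqF.
rewrite -E; field; rewrite !gt_eqF//.
Qed.
End FreeBoundary.

(** * The enclosed area *)

Section Measure.
Variable R : realType.
Local Notation mu := (@lebesgue_measure R).

(** By uniqueness of Lebesgue measure: the rescaled pushforward [nu] agrees with it on half-open
    intervals. For x < 0 the preimage of such an interval is closed at the other end. *)
Lemma lebesgue_measure_dilation (x : R) (E : set (measurableTypeR R)) : x != 0 -> measurable E ->
  (mu [set y : R | E (y / x)%R] = `|x|%:E * mu E)%E.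
Proof.
move=> x0 mE.
have mf : measurable_fun [set: measurableTypeR R] (fun y : measurableTypeR R => y / x : measurableTypeR R).
  apply: continuous_measurable_fun => y; apply: cvgM; first exact: cvg_id.
  exact: cvg_cst.
have c0 : 0 <= `|x|^-1 by rewrite invr_ge0.
pose nu : {measure set (measurableTypeR R) -> \bar R} :=
  mscale (NngNum c0) (measure_function_pushforward__canonical__measure_function_Measure mu mf).
have nuE X : nu X = (`|x|^-1%:E * mu [set y : R | X (y / x)%R])%E by [].
suff Emu : mu E = nu E by rewrite Emu nuE muleA -EFinM divff ?normr_eq0// mul1e.
apply: (lebesgue_measure_unique (mu := nu)) => //.
move=> _ [[a c] _ <-] /=; rewrite nuE.
have [ac|ac] := ltP a c; last first.
  have E0 : `]a, c]%classic = set0 :> set R by rewrite set_itv_ge// bnd_simp -leNgt.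
  have -> : [set y : R | `]a, c]%classic (y / x)] = set0 by rewrite E0.
  by rewrite E0 measure0 mule0.
have [xp|xn] := ltP 0 x.
  have -> : [set y : R | `]a, c]%classic (y / x)] = `]a * x, c * x]%classic.
    by apply/seteqP; split => y /=; rewrite !in_itv/= ltr_pdivlMr// ler_pdivrMr.
  rewrite !lebesgue_measure_itv/= !lte_fin ltr_pM2r// ac gtr0_norm//.
  by rewrite -!EFinB -EFinM -mulrBl mulrCA mulVf// mulr1.
have {}xn : x < 0 by rewrite lt_neqAle x0.
have -> : [set y : R | `]a, c]%classic (y / x)] = `[c * x, a * x[%classic.
  by apply/seteqP; split => y /=; rewrite !in_itv/= ltr_ndivlMr// ler_ndivrMr// andbC.
rewrite !lebesgue_measure_itv/= !lte_fin ltr_nM2r// ac ltr0_norm//.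
by rewrite -!EFinB -EFinM -mulrBl mulrCA invrN mulNr mulVf// mulrN1 opprB.
Qed.

Lemma integral_norm_itv (a c : R) : 0 < a -> 0 < c ->
  (\int[mu]_(x in `](- c)%R, a[) `|x|%:E = (2^-1 * (a ^+ 2 + c ^+ 2))%:E)%E.
Proof.
move=> a0 c0.
have cn : continuous (fun x : R => `|x|) by move=> x; exact: norm_continuous.
have mn D : measurable_fun D (fun x : R => `|x|%:E).
  by apply/measurable_EFinP/measurable_funTS; exact: continuous_measurable_fun.
rewrite (@itv_bndbnd_setU _ _ _ (BRight 0)) ?bnd_simp ?oppr_le0 ?ltW//; last first.
rewrite ge0_integral_setU//=; last 2 first.
- exact: mn.
- apply/disj_set2P/seteqP; split => x //= []; rewrite !in_itv/= => /andP[_ h1] /andP[h2 _].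
  by move: (le_lt_trans h1 h2); rewrite ltxx.
have hsq (x : R) : is_derive x (1 : R) (fun y : R => 2^-1 * y ^+ 2) x.
  have h := is_deriveZ 2^-1 (is_deriveX 2 (is_derive_id x (1 : R))).
  apply: is_derive_eq h _; rewrite /GRing.scale /= expr1 mulr1.
  by rewrite mulrA mulVf ?mul1r.
have csq : continuous (fun y : R => 2^-1 * y ^+ 2).
  by move=> x; apply: differentiable_continuous; apply/derivable1_diffP; case: (hsq x).
rewrite integral_itv_obnd_cbnd// integral_itv_obnd_cbnd// integral_itv_bndo_bndc//.
have -> : (\int[mu]_(x in `[(- c)%R, 0%R]) `|x|%:E = (2^-1 * c ^+ 2)%:E)%E.
  transitivity (\int[mu]_(x in `[(- c)%R, 0%R]) (- (x : R))%:E)%E.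
    by apply: eq_integral; move=> x; rewrite inE/= in_itv/= => /andP[_ h]; rewrite ler0_norm.
  rewrite (@continuous_FTC2 _ (fun x : R => - x) (fun y : R => - (2^-1 * y ^+ 2)))//.
  - by rewrite -EFinB; congr EFin; ring.
  - by rewrite ltrNl oppr0.
  - by apply: continuous_subspaceT => x; apply: continuousN; exact: cvg_id.
  - split.
    + by move=> x _; have [h _] := hsq x; exact: derivableN.
    + by apply: cvg_at_right_filter; apply: cvgN; exact: csq.
    + by apply: cvg_at_left_filter; apply: cvgN; exact: csq.
  - by move=> x _; rewrite derive1E deriveN; [have [_ ->] := hsq x|have [] := hsq x].
have -> : (\int[mu]_(x in `[0%R, a]) `|x|%:E = (2^-1 * a ^+ 2)%:E)%E.
  transitivity (\int[mu]_(x in `[0%R, a]) (x : R)%:E)%E.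
    by apply: eq_integral; move=> x; rewrite inE/= in_itv/= => /andP[h _]; rewrite ger0_norm.
  rewrite (@continuous_FTC2 _ (fun x : R => x) (fun y : R => 2^-1 * y ^+ 2))//.
  - by rewrite -EFinB; congr EFin; ring.
  - by apply: continuous_subspaceT => x; exact: cvg_id.
  - split.
    + by move=> x _; have [h _] := hsq x.
    + by apply: cvg_at_right_filter; exact: csq.
    + by apply: cvg_at_left_filter; exact: csq.
  - by move=> x _; rewrite derive1E; have [_ ->] := hsq x.
by rewrite -EFinD -mulrDr addrC.
Qed.
End Measure.

(** * Area by slicing along lines through 0 *)

Section StarlikeArea.
Variable R : realType.
Local Notation mu := (@lebesgue_measure R).

(** The coordinates are the abscissa x and the slope u, with Jacobian |x|: the section of [A] at
    abscissa x is x times its set of slopes, hence has measure |x| times that of the slopes.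
    Exchanging the integrals leaves, for each u, the integral of |x| over []- Xm u, Xp u[]. *)
Lemma starlike_area (A : set (R * R)) (Xp Xm : R -> R) :
  (forall u, 0 < Xp u) -> (forall u, 0 < Xm u) -> continuous Xp -> continuous Xm ->
  (forall x u, x != 0 -> A (x, x * u) <-> - Xm u < x < Xp u) ->
  ((mu \x mu) A = \int[mu]_u (2^-1 * (Xp u ^+ 2 + Xm u ^+ 2))%:E)%E.
Proof.
move=> Xp0 Xm0 cp cm HA.
pose K : set (measurableTypeR R * measurableTypeR R) := [set xu | - Xm xu.2 < xu.1 < Xp xu.2].
have mK : measurable K.
  have mp : measurable_fun setT (fun xu : measurableTypeR R * measurableTypeR R => Xp xu.2).
    by apply: measurableT_comp => //; exact: continuous_measurable_fun.
  have mm : measurable_fun setT (fun xu : measurableTypeR R * measurableTypeR R => - Xm xu.2).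
    apply: measurableT_comp => //; apply: measurableT_comp => //.
    exact: continuous_measurable_fun.
  rewrite (_ : K = [set xu | - Xm xu.2 < xu.1] `&` [set xu | xu.1 < Xp xu.2]); last first.
    by apply/seteqP; split => -[x u] /= /andP.
  apply: measurableI.
    have h := measurable_fun_ltr mm measurable_fst.
    by have h2 := h measurableT [set true] I; rewrite setTI in h2.
  have h := measurable_fun_ltr measurable_fst mp.
  by have h2 := h measurableT [set true] I; rewrite setTI in h2.
pose k (xu : measurableTypeR R * measurableTypeR R) : \bar R := (`|xu.1| * \1_K xu)%:E.
have mk : measurable_fun setT k.
  apply/measurable_EFinP/measurable_funM; last exact: measurable_indic.
  exact: measurableT_comp measurable_fst.
have k0 xu : (0 <= k xu)%E by rewrite lee_fin mulr_ge0.
have secE (x : R) : x != 0 -> ((mu \o xsection A) x = \int[mu]_u k (x, u))%E.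
  move=> x0; pose Kx := [set u : measurableTypeR R | K (x, u)].
  have mKx : measurable Kx.
    by rewrite (_ : Kx = xsection K x); [exact: measurable_xsection|rewrite xsectionE].
  transitivity (\int[mu]_u (`|x|%:E * (\1_Kx u)%:E))%E; last first.
    by apply: eq_integral => u _; rewrite -EFinM /k /=; congr (_ * _)%:E; rewrite !indicE !in_setE.
  rewrite ge0_integralZl_EFin//; last by apply/measurable_EFinP; exact: measurable_indic.
  rewrite integral_indic// setIT.
  rewrite -lebesgue_measure_dilation//=; congr (mu _); rewrite xsectionE.
  apply/seteqP; split => y /=.
    by rewrite -[y in A (x, y)](mulVKf x0) [x^-1 * y]mulrC => /(HA _ _ x0).
  by move=> /(HA _ _ x0); rewrite mulrC divfK.
have mF : measurable_fun setT (fubini_F mu k) by exact: measurable_fun_fubini_tonelli_F.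
have -> : ((mu \x mu) A = \int[mu]_x \int[mu]_u k (x, u))%E.
  rewrite /product_measure1.
  (* The abscissa 0 is removed as a null set: slopes say nothing about the section of [A] there. *)
  rewrite -[LHS](@integral_setD1 _ _ 0%R)//; last 2 first.
  - exact: measurableD.
  - apply: (eq_measurable_fun (fubini_F mu k)); last exact: measurable_funTS.
    by move=> x; rewrite inE/= => -[_ /eqP x0]; rewrite /fubini_F -secE.
  rewrite -[RHS](@integral_setD1 _ _ 0%R)//; last 2 first.
  - exact: measurableD.
  - exact: measurable_funTS.
  by apply: eq_integral => x; rewrite inE/= => -[_ /eqP x0]; rewrite -secE.
rewrite (fubini_tonelli k)//.
apply: eq_integral => u _; rewrite -integral_norm_itv//.
rewrite [RHS]integral_mkcond; apply: eq_integral => x _.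
rewrite /k patchE /=.
have -> : \1_K (x, u) = (x \in `](- Xm u)%R, (Xp u)[%classic)%:R :> R.
  by rewrite indicE; congr (nat_of_bool _)%:R; apply/idP/idP; rewrite !inE/= in_itv.
by case: ifP => _; rewrite ?mulr1 ?mulr0.
Qed.

Lemma integral_deriveT (f P : R -> R) (a c : R) : (forall u, 0 <= f u) -> continuous f ->
  (forall u, is_derive u (1 : R) P (f u)) ->
  P u @[u --> +oo] --> c -> P u @[u --> -oo] --> a ->
  (\int[mu]_u (f u)%:E = (c - a)%:E)%E.
Proof.
move=> f0 cf dP Pc Pa.
have mf : measurable_fun setT f by exact: continuous_measurable_fun.
have cP : continuous P.
  by move=> u; apply: differentiable_continuous; apply/derivable1_diffP; case: (dP u).
have dP1 (u : R) : derive1 P u = f u by rewrite derive1E; have [_ ->] := dP u.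
have -> : [set: measurableTypeR R] = `]-oo, 0%R] `|` `]0%R, +oo[.
  apply/seteqP; split => x //= _; rewrite !in_itv/= andbT.
  by case: (leP x 0) => ?; [left|right].
rewrite ge0_integral_setU//=; last 3 first.
- by apply/measurable_EFinP/measurable_funTS.
- by move=> u _; rewrite lee_fin.
- apply/disj_set2P/seteqP; split => x //= []; rewrite !in_itv/= andbT => h1 h2.
  by move: (le_lt_trans h1 h2); rewrite ltxx.
rewrite integral_itv_obnd_cbnd; last by apply/measurable_EFinP/measurable_funTS.
rewrite (@ge0_continuous_FTC2y _ f P 0 c)//; last 2 first.
- exact: continuous_subspaceT.
- by apply: cvg_at_right_filter; exact: cP.
rewrite -[X in `]-oo, X]]oppr0 ge0_integration_by_substitutionNy//; last exact: continuous_subspaceT.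
have dPN u : is_derive u (1 : R) (fun u => - P (- u)) (f (- u)).
  have h := is_deriveN (is_derive1_comp (dP (- u)) (is_deriveNid u (1 : R))).
  by apply: is_derive_eq h _; rewrite mulrN1 opprK.
rewrite (@ge0_continuous_FTC2y _ (f \o -%R) (fun u => - P (- u)) 0 (- a))//=.
- by rewrite -!EFinB -EFinD oppr0; congr EFin; ring.
- apply: continuous_subspaceT => x.
  by apply: (continuous_comp (f := -%R)); [exact: oppr_continuous|exact: cf].
- by apply: cvgN; move/cvgNy_compNP: Pa.
- have c0 : {for 0, continuous (fun u => - P (- u))}.
    by apply: differentiable_continuous; apply/derivable1_diffP; case: (dPN 0).
  exact: cvg_at_right_filter c0.
- by move=> x _; rewrite derive1E; have [_ ->] := dPN x.
Qed.
End StarlikeArea.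

Section RealDerivatives.
Variable R : realType.
Implicit Types (f g : R -> R) (t : R).

Lemma is_derive_cts f t d : is_derive t (1 : R) f d -> {for t, continuous f}.
Proof. by move=> [fd _]; apply: differentiable_continuous; apply/derivable1_diffP. Qed.

Lemma rderivD f g t df dg : is_derive t (1 : R) f df -> is_derive t (1 : R) g dg ->
  is_derive t (1 : R) (fun r => f r + g r) (df + dg).
Proof. by move=> h1 h2; exact: (is_deriveD (f := f)). Qed.

Lemma rderivZ (k : R) f t df : is_derive t (1 : R) f df ->
  is_derive t (1 : R) (fun r => k * f r) (k * df).
Proof. by move=> h1; exact: (is_deriveZ k h1). Qed.

Lemma rderivM f g t df dg : is_derive t (1 : R) f df -> is_derive t (1 : R) g dg ->
  is_derive t (1 : R) (fun r => f r * g r) (f t * dg + g t * df).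
Proof. by move=> h1 h2; exact: (is_deriveM (f := f)). Qed.

Lemma rderiv_div f g t df dg : g t != 0 -> is_derive t (1 : R) f df -> is_derive t (1 : R) g dg ->
  is_derive t (1 : R) (fun r => f r / g r) ((df * g t - f t * dg) / g t ^+ 2).
Proof.
move=> g0 h1 h2; have h3 := is_deriveV g0 h2.
apply: is_derive_eq (rderivM h1 h3) _; rewrite /GRing.scale /=.
by field.
Qed.

Lemma rderiv_atan f t df : is_derive t (1 : R) f df ->
  is_derive t (1 : R) (fun r => atan (f r)) (df / (1 + f t ^+ 2)).
Proof.
move=> h; apply: is_derive_eq (is_derive1_comp (f := @atan R) (is_derive1_atan (f t)) h) _.
by rewrite mulrC.
Qed.

Lemma rderiv_cos (k : R) t : is_derive t (1 : R) (fun r => cos (k * r)) (- (k * sin (k * t))).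
Proof.
have h := rderivZ k (is_derive_id t (1 : R)).
by apply: is_derive_eq (is_derive1_comp (f := @cos R) (is_derive_cos (k * t)) h) _; ring.
Qed.

Lemma rderiv_sin (k : R) t : is_derive t (1 : R) (fun r => sin (k * r)) (k * cos (k * t)).
Proof.
have h := rderivZ k (is_derive_id t (1 : R)).
by apply: is_derive_eq (is_derive1_comp (f := @sin R) (is_derive_sin (k * t)) h) _; ring.
Qed.

Lemma sin_atan (v : R) : sin (atan v) = v * cos (atan v).
Proof.
have c0 : cos (atan v) != 0 by rewrite gt_eqF// cos_gt0_pihalf// atan_gtNpi2 atan_ltpi2.
by rewrite -{2}(atanK v) /tan divfK.
Qed.

Lemma cos_atan_gt0 (v : R) : 0 < cos (atan v).
Proof. by rewrite cos_gt0_pihalf// atan_gtNpi2 atan_ltpi2. Qed.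

Lemma cos_atan_sqr (v : R) : cos (atan v) ^+ 2 = (1 + v ^+ 2)^-1.
Proof. by rewrite cos_atan exprVn sqr_sqrtr// addr_ge0// sqr_ge0. Qed.

Lemma cvgNy_atan : atan u @[u --> -oo] --> - (pi / 2 : R).
Proof.
apply/cvgNy_compNP; rewrite (_ : atan \o -%R = fun u => - atan u).
  by apply: cvgN; exact: cvgy_atan.
by apply/funext => u /=; rewrite atanN.
Qed.
End RealDerivatives.

(** * The polar angle along the curve *)

Section PolarAngle.
Variable R : realType.
Local Notation C := (plane R).
Variables (m : nat) (b s : R).
Hypothesis H : small_param m b.
Hypothesis s0 : 0 < s.
Implicit Types (z w u v p q : C).
Local Notation x := (zeroP m b).
Local Notation beta := (poleP m b).
Local Notation y := (zeroQ m b).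
Local Notation sg := (y + beta).
Local Notation eta := (y - beta).
Local Notation M := (m%:R : R).

(* With [e = expi (m t)], the product [(e + y) * (e + beta)^*] has real part [angle_den t]
   and imaginary part [- (y - beta) * sin (m t)], so [polar_angle t] is an argument of
   [F (expi t)]; its derivative is [angle_num t / angle_sqr t]. *)
Definition angle_den (t : R) : R := 1 + x ^+ 2 + sg * cos (M * t).
Local Notation Dt := angle_den.
Definition pole_sqr (t : R) : R := 1 + beta ^+ 2 + 2 * beta * cos (M * t).
Local Notation Bt := pole_sqr.
Definition angle_sqr (t : R) : R := Dt t ^+ 2 + (eta * sin (M * t)) ^+ 2.
Local Notation Ut := angle_sqr.
Definition angle_num (t : R) : R := (1 - x ^+ 2) ^+ 2 - 2 * x * sg +
  (sg - 2 * x) * (1 + x ^+ 2) * cos (M * t) + 4 * x ^+ 2 * cos (M * t) ^+ 2.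
Local Notation Nt := angle_num.

Definition polar_angle (t : R) : R := t - atan (eta * sin (M * t) / Dt t).
Local Notation theta := polar_angle.

Lemma sg_le : sg <= 20 / 9 * x.
Proof.
have q0 : 0 < (M - 1 : R) by have := @M10 R _ _ H; lra.
have h : y <= 11 / 9 * x.
  rewrite -(ler_pM2l q0) (yE H).
  have := @M10 R _ _ H; have := x_gt0 H => h1 h2; nra.
by have := beta_lt_x H; lra.
Qed.

Lemma x_le : x <= 1 / 3. Proof. by case: H. Qed.

Lemma cos_bd (t : R) : -1 <= cos (M * t) <= 1.
Proof. by rewrite cos_geN1 cos_le1. Qed.

Lemma Dt_gt0 t : 0 < Dt t.
Proof.
rewrite /Dt; have /andP[c1 c2] := cos_bd t.
have h1 := sg_le; have h2 := x_le; have h3 := x_gt0 H; have h4 := beta_gt0 H; have h5 := y_gt0 H.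
move: (cos _) c1 c2 => c c1 c2.
have : 0 <= sg * (1 + c) by rewrite mulr_ge0//; lra.
have := sqr_ge0 x.
by lra.
Qed.

Lemma Bt_gt0 t : 0 < Bt t.
Proof.
rewrite /Bt; have /andP[c1 c2] := cos_bd t.
have h2 := x_le; have h3 := beta_lt_x H; have h4 := beta_gt0 H.
move: (cos _) c1 c2 => c c1 c2.
have : 0 <= beta * (1 + c) by rewrite mulr_ge0//; lra.
have := sqr_ge0 beta.
by lra.
Qed.

Lemma Ut_gt0 t : 0 < Ut t.
Proof. by rewrite /Ut ltr_pwDl ?sqr_ge0// exprn_gt0// Dt_gt0. Qed.

(** The arithmetic-geometric mean inequality, as x^2 = y beta. *)
Lemma two_x_le_sg : 2 * x <= sg.
Proof.
have := y_beta H; have := x_gt0 H; have := beta_gt0 H; have := y_gt0 H.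
move=> h1 h2 h3 h4.
have s1 : 0 <= sg by rewrite addr_ge0// ltW.
have x1 : 0 <= 2 * x by rewrite mulr_ge0// ltW.
rewrite -(@ler_pXn2r _ 2)// exprMn -h4 -subr_ge0 (_ : _ - _ = (y - beta) ^+ 2) ?sqr_ge0//.
by move: y beta => Y B; ring.
Qed.

(** The constant part is at least 64/81 - 40/81, the linear term at least - (2/27) (10/9) because sg
    - 2 x <= (2/9) x <= 2/27, and the last term is nonnegative. *)
Lemma Nt_gt0 t : 0 < Nt t.
Proof.
rewrite /Nt; have /andP[c1 c2] := cos_bd t.
have h1 := sg_le; have h2 := x_le; have h3 := x_gt0 H; have h4 := two_x_le_sg.
move: (cos _) c1 c2 => c c1 c2.
have e1 : x ^+ 2 <= 1 / 9 by nra.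
have e2 : x * sg <= 20 / 81 by nra.
have e3 : (sg - 2 * x) * (1 + x ^+ 2) <= 2 / 27 * (10 / 9).
  apply: ler_pM; [lra|have := sqr_ge0 x; lra|lra|lra].
have e4 : 0 <= (sg - 2 * x) * (1 + x ^+ 2) * (1 + c).
  rewrite !mulr_ge0//; [lra|have := sqr_ge0 x; lra|lra].
have e5 : 0 <= x ^+ 2 * c ^+ 2 by rewrite mulr_ge0// sqr_ge0.
have e6 : (8 / 9) ^+ 2 <= (1 - x ^+ 2) ^+ 2.
  by rewrite ler_pXn2r ?nnegrE//; lra.
by lra.
Qed.

Lemma theta_derive t : is_derive t (1 : R) theta (Nt t / Ut t).
Proof.
have D0 : Dt t != 0 by rewrite gt_eqF// Dt_gt0.
have h1 := rderivZ eta (rderiv_sin M t).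
have h2 : is_derive t (1 : R) Dt (sg * (- (M * sin (M * t)))).
  apply: is_derive_eq (rderivD (is_derive_cst (1 + x ^+ 2) t (1 : R)) (rderivZ sg (rderiv_cos M t))) _.
  by rewrite add0r.
have h3 := rderiv_atan (rderiv_div D0 h1 h2).
have h4 := rderivD (is_derive_id t (1 : R)) (rderivZ (-1) h3).
have -> : theta = (fun r => id r + -1 * atan (eta * sin (M * r) / Dt r)).
  by apply/funext => r; rewrite /theta mulN1r.
apply: is_derive_eq h4 _.
have U0 : Ut t != 0 by rewrite gt_eqF// Ut_gt0.
have E1 := y_sub_beta H; have E2 := y_beta H; have cs := cos2Dsin2 (M * t).
have -> : 1 + (eta * sin (M * t) / Dt t) ^+ 2 = Ut t / Dt t ^+ 2.
  by rewrite /Ut; field.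
transitivity ((Ut t - M * eta * (cos (M * t) * Dt t + sg * sin (M * t) ^+ 2)) / Ut t).
  by field; rewrite ?D0 ?U0.
(* [y_sub_beta] eliminates m; [y_beta] and sin^2 = 1 - cos^2 then leave an identity between
   polynomials in the cosine. *)
congr (_ / _); rewrite E1.
rewrite /Ut /Nt /Dt; clear -E2 cs; move: (cos _) (sin _) cs => c e cs.
move: y beta x E2 => Y B X E2.
have e2 : e ^+ 2 = 1 - c ^+ 2 by rewrite -cs; ring.
rewrite exprMn e2.
have -> : (Y - B) ^+ 2 = (Y + B) ^+ 2 - 4 * X ^+ 2 by rewrite -E2; ring.
by ring.
Qed.

Lemma theta_incr t t' : t < t' -> theta t < theta t'.
Proof.
move=> tt'; have [||c cin E] := @MVT _ theta (fun t => Nt t / Ut t) t t' tt'.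
- by move=> r _; exact: theta_derive.
- by apply: continuous_subspaceT => r; exact: is_derive_cts (theta_derive r).
by rewrite -subr_gt0 E mulr_gt0 ?subr_gt0// divr_gt0// ?Nt_gt0 ?Ut_gt0.
Qed.

Lemma theta_inj : injective theta.
Proof.
move=> t t' E; case: (ltgtP t t') => // /theta_incr; rewrite E ltxx//.
Qed.

Lemma theta_close t : t - pi / 2 < theta t < t + pi / 2.
Proof.
rewrite /theta; set v := _ / Dt t; have h1 := atan_gtNpi2 v; have h2 := atan_ltpi2 v.
by apply/andP; split; lra.
Qed.

Lemma theta_surj a : exists t, theta t = a.
Proof.
have p0 := pi_gt0 R.
have [|||t _ tE] := @IVT _ theta (a - pi) (a + pi) a.
- lra.
- by apply: continuous_subspaceT => r; exact: is_derive_cts (theta_derive r).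
- rewrite ge_min le_max; apply/andP; split; apply/orP.
    by left; have /andP[_ h] := theta_close (a - pi); lra.
  by right; have /andP[h _] := theta_close (a + pi); lra.
by exists t.
Qed.

Definition angle_inv (a : R) : R := projT1 (cid (theta_surj a)).
Local Notation Tinv := angle_inv.

Lemma TinvK a : theta (Tinv a) = a.
Proof. by rewrite /Tinv; case: cid. Qed.

Lemma thetaK t : Tinv (theta t) = t.
Proof. by apply: theta_inj; rewrite TinvK. Qed.

Lemma Tinv_derive a : is_derive a (1 : R) Tinv (Ut (Tinv a) / Nt (Tinv a)).
Proof.
rewrite -{1}(TinvK a) -invf_div.
apply: is_derive_inverse.
- by near=> t; exact: thetaK.
- by near=> t; exact: is_derive_cts (theta_derive t).
- exact: theta_derive.
by rewrite gt_eqF// divr_gt0// ?Nt_gt0 ?Ut_gt0.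
Unshelve. all: by end_near. Qed.

Lemma cosM2pi t : cos (M * (t + 2 * pi)) = cos (M * t).
Proof.
rewrite mulrDr (_ : M * (2 * pi) = (pi *+ 2) *+ m); last by rewrite -(mulr_natl (pi *+ 2)) -(mulr_natl pi).
by rewrite (periodicn (@cosD2pi R)).
Qed.

Lemma sinM2pi t : sin (M * (t + 2 * pi)) = sin (M * t).
Proof.
rewrite mulrDr (_ : M * (2 * pi) = (pi *+ 2) *+ m); last by rewrite -(mulr_natl (pi *+ 2)) -(mulr_natl pi).
by rewrite (periodicn (@sinD2pi R)).
Qed.

Lemma theta2pi t : theta (t + 2 * pi) = theta t + 2 * pi.
Proof. by rewrite /theta /Dt cosM2pi sinM2pi addrAC. Qed.

Lemma Tinv2pi a : Tinv (a + 2 * pi) = Tinv a + 2 * pi.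
Proof. by apply: theta_inj; rewrite TinvK theta2pi TinvK. Qed.
End PolarAngle.

(** * Starlikeness of the interior *)

Section Starlike.
Variable R : realType.
Local Notation C := (plane R).
Variables (m : nat) (b s : R).
Hypothesis H : small_param m b.
Hypothesis s0 : 0 < s.
Implicit Types (z w u v p q : C).
Local Notation U1 := (bubble_ext m b s).
Local Notation V1 := (bubble_int m b s).
Local Notation S1 := (bubble_curve m b s).
Local Notation gam := (bubble_param m b s).
Local Notation beta := (poleP m b).
Local Notation y := (zeroQ m b).
Local Notation eta := (y - beta).
Local Notation M := (m%:R : R).
Local Notation Dt := (angle_den m b).
Local Notation Bt := (pole_sqr m b).
Local Notation Ut := (angle_sqr m b).
Local Notation theta := (polar_angle m b).
Local Notation Tinv := (angle_inv H).

Definition polar_radius (t : R) : R := normc (gam t).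
Local Notation rho := polar_radius.
Let slope (t : R) : R := eta * sin (M * t) / Dt t.
Let rad (t : R) : R := s * (Dt t / (Bt t * cos (atan (slope t)))).

Lemma expiN_atan (D v : R) : (D +i* (- (D * v)) : C) = (D / cos (atan v))%:C * expi (- atan v).
Proof.
have c0 := cos_atan_gt0 v.
rewrite /expi cosN sinN sin_atan; apply/eqP; rewrite eq_complex /=.
by apply/andP; split; apply/eqP; field; rewrite gt_eqF.
Qed.

Let gamE t : gam t = (rad t)%:C * expi (theta t).
Proof.
have zO := expi_Om m t; have wb := wbeta_neq0 H zO.
have D0 := Dt_gt0 H t; have B0 := Bt_gt0 H t; have c0 := cos_atan_gt0 (slope t).
rewrite /gam /bubble_map PhiE// -mulrA divcE// expiX.
have -> : normc (expi (M * t) + beta%:C) ^- 2 = (Bt t)^-1.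
  congr (_^-1); have := cos2Dsin2 (M * t); rewrite normc_sqr /expi /Bt.
  by move: (cos _) (sin _) => c e cs /=; rewrite !addr0; lra.
have -> : (expi (M * t) + y%:C) * (expi (M * t) + beta%:C)^* = (Dt t +i* - (Dt t * slope t) : C).
  rewrite /slope mulrCA divff ?gt_eqF// mulr1 /Dt -(y_beta H) /expi.
  have cs := cos2Dsin2 (M * t).
  apply/eqP; rewrite eq_complex /=; move: (cos _) (sin _) cs => c e cs.
  by apply/andP; split; apply/eqP; lra.
rewrite expiN_atan.
have -> : theta t = t + - atan (slope t) by [].
rewrite expiD.
have -> : (rad t)%:C = s%:C * ((Bt t)^-1%:C * (Dt t / cos (atan (slope t)))%:C) :> C.
  by rewrite -!rmorphM; congr (_%:C); rewrite /rad; field; rewrite !gt_eqF.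
by ring.
Qed.

Let rad_gt0 t : 0 < rad t.
Proof. by rewrite /rad mulr_gt0// divr_gt0 ?Dt_gt0// mulr_gt0 ?Bt_gt0 ?cos_atan_gt0. Qed.

Lemma rhoE t : rho t = rad t.
Proof. by rewrite /rho gamE normcM normc_expi mulr1 normc_real gtr0_norm ?rad_gt0. Qed.

Lemma gam_polar t : gam t = (rho t)%:C * expi (theta t).
Proof. by rewrite rhoE gamE. Qed.

Lemma rho_gt0 t : 0 < rho t.
Proof. by rewrite rhoE rad_gt0. Qed.

Lemma rho_sqr t : rho t ^+ 2 = s ^+ 2 * (Ut t / Bt t ^+ 2).
Proof.
have D0 := Dt_gt0 H t; have B0 := Bt_gt0 H t.
rewrite rhoE /rad exprMn expr_div_n [(Bt t * _) ^+ 2]exprMn cos_atan_sqr /slope /Ut.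
have D1 : Dt t != 0 by rewrite gt_eqF.
have B1 : Bt t != 0 by rewrite gt_eqF.
have E : Dt t ^+ 2 + (eta * sin (M * t)) ^+ 2 != 0.
  by have := Ut_gt0 H t; rewrite /angle_sqr => h; rewrite gt_eqF.
move: (eta * sin (M * t)) (Dt t) (Bt t) D1 B1 E => e D B D1 B1 E.
field; rewrite D1 B1 /=.
by apply: contra_neq E => <-; ring.
Qed.

Lemma rho_continuous : continuous rho.
Proof.
move=> t; apply: (ccont_comp (g := fun w : C => normc w : R) (pderiv_continuous (pderiv_gam s H t))).
exact: normc_continuous.
Qed.

(** A second point of the curve on the ray has parameter t + tau with |tau| <= pi. Polar angles
    differ from parameters by less than pi/2, so the two polar angles differ by less than 2 pi;
    pointing in the same direction, they coincide, and [theta] is injective. *)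
Lemma ray_S1 (l : R) t : 0 <= l -> S1 (l%:C * gam t) -> l = 1.
Proof.
move=> l0 [z z1 E].
have [tau tb] := polar_bounded (z * expi (- t)).
rewrite normcM normc_expi z1 mulr1 rmorph1 mul1r => zE.
have {}zE : z = expi (t + tau).
  by rewrite expiD -zE mulrCA -expiD subrr expi0 mulr1.
have {}E : l%:C * gam t = gam (t + tau) by rewrite -E /gam zE.
have lr : l * rho t = rho (t + tau).
  by rewrite /rho -E (normcM l%:C) normc_real ger0_norm.
have Eth : expi (theta t) = expi (theta (t + tau)).
  have r0 : (rho (t + tau))%:C != 0 :> C by exact/realC_neq0/rho_gt0.
  apply: (mulfI r0); rewrite -gam_polar -E gam_polar mulrA -rmorphM -lr.
  by [].
have p0 := pi_gt0 R.
have : theta t = theta (t + tau).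
  apply: expi_inj_lt2pi => //.
  have /andP[a1 a2] := theta_close m b t; have /andP[a3 a4] := theta_close m b (t + tau).
  move: tb => /andP[b1 b2]; clear -a1 a2 a3 a4 b1 b2 p0.
  by move: (theta t) (theta _) a1 a2 a3 a4 => A B a1 a2 a3 a4; apply/andP; split; lra.
move/(theta_inj H) => tt; move: lr; rewrite -tt => lr.
have r0 : rho t != 0 by rewrite gt_eqF// rho_gt0.
by apply: (mulIf r0); rewrite mul1r.
Qed.

Lemma V1_0 : V1 0.
Proof.
move=> [z z1 E]; have /andP[h _] := F_ratio H s0 (Omega_ext m z1).
move: h; rewrite E normc0; apply/negP; rewrite -ltNge.
by rewrite mulr_gt0 ?mulr_gt0// (lt_le_trans ltr01 z1).
Qed.

(** Off the curve the ray splits into two connected pieces: the inner one contains 0, which lies in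
    the interior, and the outer one contains far points, which lie in the exterior by [large_U1]. *)
Lemma ray_V1 (l : R) t : 0 <= l -> V1 (l%:C * gam t) <-> l < 1.
Proof.
move=> l0; split.
  move=> Vl; rewrite ltNge; apply/negP; rewrite le_eqVlt => /predU1P[l1|l1].
    apply: (SV_disj _ Vl); rewrite -l1 rmorph1 mul1r; exists (expi t) => //.
    exact: normc_expi.
  have [||UU _] := @connected_UV R m b s H s0 ((fun r : R => r%:C * gam t) @` `]1, +oo[).
  - by apply: connected_path => r _; exists (gam t); exact: pderiv_ray.
  - move=> _ [r + <-] /ray_S1; rewrite /= in_itv/= andbT => r1 r1'.
    by have := r1' (ltW (lt_trans ltr01 r1)); move=> E; rewrite E ltxx in r1.
  have Ul : U1 (l%:C * gam t).
    apply: UU; last by exists l => //=; rewrite in_itv/= andbT.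
    have r0 := rho_gt0 t.
    pose r : R := s * (5 / 2) / rho t + 2.
    have r2 : 2 <= r by rewrite lerDr divr_ge0 ?ltW// mulr_gt0.
    exists (r%:C * gam t); split; first by exists r => //=; rewrite in_itv/= andbT; lra.
    apply: large_U1 => //; rewrite (normcM r%:C) normc_real gtr0_norm; last by lra.
    by rewrite -/(rho t) -ltr_pdivrMr// /r ltrDl.
  exact: UV_disj Ul Vl.
move=> l1.
have [||_ VV] := @connected_UV R m b s H s0 ((fun r : R => r%:C * gam t) @` `[0, 1[).
- by apply: connected_path => r _; exists (gam t); exact: pderiv_ray.
- move=> _ [r + <-] /ray_S1; rewrite /= in_itv/= => /andP[r0 r1] /(_ r0) E.
  by rewrite E ltxx in r1.
apply: VV; last by exists l => //=; rewrite in_itv/= l0.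
exists 0; split; last exact: V1_0.
by exists 0; rewrite /= ?in_itv/= ?lexx ?ltr01// rmorph0 mul0r.
Qed.

(* The line of slope [u] through [0] meets the interior over the abscissas
   [- Xm u < x < Xp u]. *)
Definition Xp (u : R) : R := rho (Tinv (atan u)) * cos (atan u).
Definition Xm (u : R) : R := rho (Tinv (pi + atan u)) * cos (atan u).

Lemma expi_pi a : expi (pi + a) = - expi a :> C.
Proof.
rewrite expiD; have -> : expi pi = -1 :> C by rewrite /expi cospi sinpi; apply/eqP; rewrite eq_complex /= oppr0 !eqxx.
by rewrite mulN1r.
Qed.

Lemma Xp_gt0 (u : R) : 0 < Xp u.
Proof. by rewrite /Xp mulr_gt0 ?rho_gt0 ?cos_atan_gt0. Qed.

Lemma Xm_gt0 (u : R) : 0 < Xm u.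
Proof. by rewrite /Xm mulr_gt0 ?rho_gt0 ?cos_atan_gt0. Qed.

Lemma V1_slope (r u : R) : r != 0 -> V1 (r +i* (r * u)) <-> - Xm u < r < Xp u.
Proof.
move=> r0; have c0 := cos_atan_gt0 u.
have E : (r +i* (r * u) : C) = (r / cos (atan u))%:C * expi (atan u).
  rewrite /expi sin_atan; apply/eqP; rewrite eq_complex /=.
  by apply/andP; split; apply/eqP; field; rewrite gt_eqF.
have [rp|rn] := ltP 0 r.
  have -> : (r +i* (r * u) : C) = (r / Xp u)%:C * gam (Tinv (atan u)).
    rewrite E gam_polar TinvK mulrA -rmorphM; congr (_%:C * _).
    have r1 := rho_gt0 (Tinv (atan u)).
    by rewrite /Xp; field; rewrite !gt_eqF.
  rewrite ray_V1; last by rewrite divr_ge0 ?ltW// Xp_gt0.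
  rewrite ltr_pdivrMr ?Xp_gt0// mul1r.
  have -> : - Xm u < r by rewrite (lt_trans _ rp)// oppr_lt0 Xm_gt0.
  by [].
have {}rn : r < 0 by rewrite lt_neqAle r0.
have -> : (r +i* (r * u) : C) = (- r / Xm u)%:C * gam (Tinv (pi + atan u)).
  rewrite E gam_polar TinvK expi_pi mulrA -rmorphM mulrN -mulNr -rmorphN; congr (_%:C * _).
  have r1 := rho_gt0 (Tinv (pi + atan u)).
  by rewrite /Xm; field; rewrite !gt_eqF.
rewrite ray_V1; last by rewrite divr_ge0 ?oppr_ge0 ?ltW// Xm_gt0.
rewrite ltr_pdivrMr ?Xm_gt0// mul1r ltrNl.
have -> : r < Xp u by rewrite (lt_trans rn)// Xp_gt0.
by rewrite andbT.
Qed.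
End Starlike.

Lemma rderiv_cst (R : realType) (k t : R) : is_derive t (1 : R) (fun=> k) 0.
Proof. exact: is_derive_cst. Qed.

(** * The value of the area *)

Section InnerArea.
Variable R : realType.
Variables (m : nat) (b s : R).
Hypothesis H : small_param m b.
Hypothesis s0 : 0 < s.
Hypothesis sa : s ^+ 2 * area_factor m b = 1.
Local Notation V1 := (bubble_int m b s).
Local Notation x := (zeroP m b).
Local Notation beta := (poleP m b).
Local Notation y := (zeroQ m b).
Local Notation sg := (y + beta).
Local Notation M := (m%:R : R).
Local Notation Bt := (pole_sqr m b).
Local Notation Ut := (angle_sqr m b).
Local Notation Nt := (angle_num m b).
Local Notation rho := (polar_radius m b s).
Local Notation Tinv := (angle_inv H).
Local Notation a := (area_factor m b).

(** Coefficients of a decomposition of Nt / (2 Bt^2), with c = cos (m t), into 1, (beta^2 + beta c)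
    / Bt and (c (1 + beta^2) + 2 beta) / Bt^2. Up to constant factors these are the derivatives of
    t, of the arctangent and of sin (m t) / Bt in [Yt]. Given c0, the c^2 coefficient determines c1
    and the c coefficient determines c2. *)
Let c0 : R := a / 2.
Let c1 : R := x ^+ 2 / beta ^+ 2 - a.
Let c2 : R := ((sg - 2 * x) * (1 + x ^+ 2) / 2 - 4 * beta * (1 + beta ^+ 2) * c0 -
  c1 * (beta * (1 + beta ^+ 2) + 2 * beta ^+ 3)) / (1 + beta ^+ 2).

(* Twice the area swept by the radius vector is the integral of [rho ^ 2 theta'],
   a rational function of [cos (m t)]; this is an explicit primitive of its half. *)
Definition Yt (t : R) : R := s ^+ 2 * (c0 * t +
  c1 / M * atan (beta * sin (M * t) / (1 + beta * cos (M * t))) +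
  c2 / M * (sin (M * t) / Bt t)).

Let M0 : M != 0.
Proof. by rewrite gt_eqF//; have := @M10 R _ _ H; lra. Qed.

Let K0 : 1 + beta ^+ 2 != 0.
Proof. by rewrite gt_eqF// ltr_pwDl// sqr_ge0. Qed.

Let beta_neq0 : beta != 0.
Proof. by rewrite gt_eqF// (beta_gt0 H). Qed.

Let coef (c : R) : let B := 1 + beta ^+ 2 + 2 * beta * c in
  c0 * B ^+ 2 + c1 * (beta ^+ 2 + beta * c) * B + c2 * (c * (1 + beta ^+ 2) + 2 * beta) =
  ((1 - x ^+ 2) ^+ 2 - 2 * x * sg + (sg - 2 * x) * (1 + x ^+ 2) * c + 4 * x ^+ 2 * c ^+ 2) / 2.
Proof.
move=> B.
have e2 : 4 * beta ^+ 2 * c0 + 2 * beta ^+ 2 * c1 = 2 * x ^+ 2 by rewrite /c0 /c1; field.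
have e1 : 4 * beta * (1 + beta ^+ 2) * c0 + c1 * (beta * (1 + beta ^+ 2) + 2 * beta ^+ 3)
   + c2 * (1 + beta ^+ 2) = (sg - 2 * x) * (1 + x ^+ 2) / 2.
  by rewrite /c2 divfK//; ring.
(* The remaining, constant coefficient is where the formula for [area_factor] is verified. *)
have e0 : (1 + beta ^+ 2) ^+ 2 * c0 + c1 * beta ^+ 2 * (1 + beta ^+ 2) + 2 * beta * c2 =
   ((1 - x ^+ 2) ^+ 2 - 2 * x * sg) / 2.
  rewrite /c2 /c1 /c0 /area_factor.
  have q0 : M - 1 != 0 by rewrite gt_eqF//; have := @M10 R _ _ H; lra.
  have b0 : b != 0 by case: H => _ b0 _; rewrite gt_eqF.
  have d0 : 1 - beta ^+ 2 != 0.
    have h : beta < 1 by have /andP[_ h] := beta_bd H; lra.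
    have -> : 1 - beta ^+ 2 = (1 - beta) * (1 + beta) by ring.
    have h2 := beta_gt0 H; rewrite gt_eqF// mulr_gt0//; lra.
  move: K0 d0; rewrite /zeroP /poleP /zeroQ; move: M q0 => N q0 k0 d0.
  by field; rewrite q0 k0 d0 b0.
transitivity ((1 + beta ^+ 2) ^+ 2 * c0 + c1 * beta ^+ 2 * (1 + beta ^+ 2) + 2 * beta * c2 +
  (4 * beta * (1 + beta ^+ 2) * c0 + c1 * (beta * (1 + beta ^+ 2) + 2 * beta ^+ 3)
   + c2 * (1 + beta ^+ 2)) * c + (4 * beta ^+ 2 * c0 + 2 * beta ^+ 2 * c1) * c ^+ 2).
  by rewrite /B; move: c0 c1 c2 => C0 C1 C2; ring.
by rewrite e2 e1 e0; field.
Qed.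

Lemma Yt_derive t : is_derive t (1 : R) Yt (s ^+ 2 * (Nt t / (2 * Bt t ^+ 2))).
Proof.
have B0 : Bt t != 0 by rewrite gt_eqF// (Bt_gt0 H).
have p0 : 1 + beta * cos (M * t) != 0.
  have /andP[k1 k2] := cos_bd m t; have /andP[k3 k4] := beta_bd H.
  rewrite gt_eqF//; move: (cos _) k1 k2 => c k1 k2.
  have : 0 <= beta * (1 + c) by rewrite mulr_ge0//; lra.
  by lra.
have h1 := rderivZ beta (rderiv_sin M t).
have h2 := rderivD (rderiv_cst 1 t) (rderivZ beta (rderiv_cos M t)).
have h3 := rderivZ (c1 / M) (rderiv_atan (rderiv_div (g := fun r => 1 + beta * cos (M * r)) p0 h1 h2)).
have h4 : is_derive t (1 : R) Bt (2 * beta * (- (M * sin (M * t)))).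
  apply: is_derive_eq (rderivD (rderiv_cst (1 + beta ^+ 2) t) (rderivZ (2 * beta) (rderiv_cos M t))) _.
  by rewrite add0r.
have h5 := rderivZ (c2 / M) (rderiv_div B0 (rderiv_sin M t) h4).
have h6 := rderivZ c0 (is_derive_id t (1 : R)).
apply: is_derive_eq (rderivZ (s ^+ 2) (rderivD (rderivD h6 h3) h5)) _.
congr (_ * _); have cs := cos2Dsin2 (M * t).
have BE : 1 + (beta * sin (M * t) / (1 + beta * cos (M * t))) ^+ 2 =
    Bt t / (1 + beta * cos (M * t)) ^+ 2.
  apply: (mulIf (expf_neq0 2 p0)); rewrite divfK ?expf_neq0// mulrDl -exprMn divfK// mul1r.
  rewrite /Bt; move: (cos _) (sin _) cs => c e cs.
  by have -> : (beta * e) ^+ 2 = beta ^+ 2 * (1 - c ^+ 2) by [rewrite -cs; ring]; ring.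
rewrite BE /Nt.
transitivity ((c0 * Bt t ^+ 2 + c1 * (beta ^+ 2 + beta * cos (M * t)) * Bt t +
   c2 * (cos (M * t) * (1 + beta ^+ 2) + 2 * beta)) / Bt t ^+ 2).
  have e1 : beta * (M * cos (M * t)) * (1 + beta * cos (M * t)) -
     beta * sin (M * t) * (0 + beta * - (M * sin (M * t))) = M * (beta ^+ 2 + beta * cos (M * t)).
    move: (cos _) (sin _) cs => c e cs.
    transitivity (M * beta * c + M * beta ^+ 2 * (c ^+ 2 + e ^+ 2)); first by ring.
    by rewrite cs; ring.
  have e2 : M * cos (M * t) * Bt t - sin (M * t) * (2 * beta * - (M * sin (M * t))) =
     M * (cos (M * t) * (1 + beta ^+ 2) + 2 * beta).
    rewrite /Bt; move: (cos _) (sin _) cs => c e cs.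
    transitivity (M * c * (1 + beta ^+ 2) + 2 * beta * M * (c ^+ 2 + e ^+ 2)); first by ring.
    by rewrite cs; ring.
  rewrite e1 e2; move: p0 B0 M0 {h1 h2 h3 h4 h5 h6 BE e1 e2 cs}.
  move: (1 + beta * cos (M * t)) (beta ^+ 2 + _) (cos _ * _ + _) (Bt t) => P E1 E2 B p0 B0 M1.
  by field; rewrite ?M1 ?B0 ?p0.
have -> : c0 * Bt t ^+ 2 + c1 * (beta ^+ 2 + beta * cos (M * t)) * Bt t +
   c2 * (cos (M * t) * (1 + beta ^+ 2) + 2 * beta) = Nt t / 2 by exact: coef.
by rewrite /Nt; field.
Qed.

(** Over a full turn the periodic terms cancel and only c0 * t contributes. *)
Lemma Yt2pi t : Yt (t + 2 * pi) - Yt t = pi.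
Proof.
rewrite /Yt /pole_sqr cosM2pi sinM2pi -mulrBr.
rewrite (_ : _ - _ = c0 * (2 * pi)); last by ring.
transitivity (s ^+ 2 * a * pi); last by rewrite sa mul1r.
by rewrite /c0; move: a => A; field.
Qed.

(** The right-hand side is Yt' / theta', so Yt composed with [Tinv] has derivative rho^2 / 2 in the
    polar angle. *)
Lemma rho_theta t : 2^-1 * rho t ^+ 2 = s ^+ 2 * (Nt t / (2 * Bt t ^+ 2)) * (Ut t / Nt t).
Proof.
rewrite (rho_sqr H s0).
have B0 : Bt t != 0 by rewrite gt_eqF// (Bt_gt0 H).
have N0 : Nt t != 0 by rewrite gt_eqF// (Nt_gt0 H).
by field; rewrite B0 N0.
Qed.

(** As the slope u runs through the reals, the angles atan u and pi + atan u sweep the right and the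
    left half-plane. The limits at both ends share the value at pi / 2, so the total increase is
    that of Yt over one full turn. *)
Let Pt (u : R) : R := Yt (Tinv (atan u)) + Yt (Tinv (pi + atan u)).
Let ft (u : R) : R := 2^-1 * (Xp s H u ^+ 2 + Xm s H u ^+ 2).

Let PtE (g : R -> R) (u : R) : is_derive u (1 : R) g (1 + u ^+ 2)^-1 ->
  is_derive u (1 : R) (fun u => Yt (Tinv (g u))) (2^-1 * (rho (Tinv (g u)) * cos (atan u)) ^+ 2).
Proof.
move=> h.
have h1 := is_derive1_comp (f := Tinv) (g := g) (Tinv_derive H (g u)) h.
have h2 := is_derive1_comp (f := Yt) (g := Tinv \o g) (Yt_derive (Tinv (g u))) h1.
apply: is_derive_eq h2 _.
rewrite exprMn cos_atan_sqr /=.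
by rewrite [RHS]mulrA rho_theta; ring.
Qed.

Let Pt_derive (u : R) : is_derive u (1 : R) Pt (ft u).
Proof.
have h1 := PtE (is_derive1_atan u).
have h2 : is_derive u (1 : R) (fun u => pi + atan u) (1 + u ^+ 2)^-1.
  by apply: is_derive_eq (rderivD (rderiv_cst pi u) (is_derive1_atan u)) _; rewrite add0r.
apply: is_derive_eq (rderivD h1 (PtE h2)) _.
by rewrite /ft mulrDr.
Qed.

Let YT_continuous (c : R) : {for c, continuous (fun r => Yt (Tinv r))}.
Proof. exact: is_derive_cts (is_derive1_comp (f := Yt) (g := Tinv) (Yt_derive (Tinv c)) (Tinv_derive H c)). Qed.

Let Pt_cvg (G : set_system R) (c : R) : Filter G -> atan u @[u --> G] --> c ->
  Pt u @[u --> G] --> Yt (Tinv c) + Yt (Tinv (pi + c)).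
Proof.
move=> FG h.
have h2 : pi + atan u @[u --> G] --> pi + c by apply: cvgD => //; exact: cvg_cst.
have h3 : Yt (Tinv (atan u)) @[u --> G] --> Yt (Tinv c) :=
  cvg_comp _ _ h (@YT_continuous c).
have h4 : Yt (Tinv (pi + atan u)) @[u --> G] --> Yt (Tinv (pi + c)) :=
  cvg_comp _ _ h2 (@YT_continuous (pi + c)).
exact: cvgD h3 h4.
Qed.

Let X_continuous (g : R -> R) : continuous g ->
  continuous (fun u => rho (Tinv (g u)) * cos (atan u)).
Proof.
move=> cg u.
have h1 : {for u, continuous (fun u => Tinv (g u))} :=
  ccont_comp (cg u) (is_derive_cts (Tinv_derive H (g u))).
have h2 : {for u, continuous (fun u => rho (Tinv (g u)))} :=
  ccont_comp h1 (@rho_continuous R m b s H (Tinv (g u))).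
have h3 : {for u, continuous (fun u : R => cos (atan u))} :=
  ccont_comp (@continuous_atan R u) (@continuous_cos R (atan u)).
exact: cvgM h2 h3.
Qed.

Lemma area_V1 : area V1 = pi%:E.
Proof.
have cp : continuous (Xp s H) by apply: X_continuous => u; exact: continuous_atan.
have cm : continuous (Xm s H).
  apply: (X_continuous (g := fun u => pi + atan u)) => u.
  by apply: cvgD; [exact: cvg_cst|exact: continuous_atan].
have sq (f : R -> R) : continuous f -> continuous (fun u => f u ^+ 2).
  by move=> hf u; exact: (ccont_comp (hf u) (@exprn_continuous R 2 (f u))).
have cf : continuous ft.
  move=> u; have h : {for u, continuous (fun u => Xp s H u ^+ 2 + Xm s H u ^+ 2)}.
    exact: cvgD (sq _ cp u) (sq _ cm u).
  exact: (ccont_comp (g := fun r : R => 2^-1 * r) h (@mulrl_continuous R 2^-1 _)).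
have f0 u : 0 <= ft u by rewrite /ft mulr_ge0// addr_ge0// sqr_ge0.
have Pp : Pt u @[u --> +oo%R] --> Yt (Tinv (pi / 2)) + Yt (Tinv (pi + pi / 2)).
  exact: Pt_cvg (@cvgy_atan R).
have Pn : Pt u @[u --> -oo%R] --> Yt (Tinv (- (pi / 2))) + Yt (Tinv (pi + - (pi / 2))).
  exact: Pt_cvg (@cvgNy_atan R).
have I := integral_deriveT f0 cf Pt_derive Pp Pn.
rewrite /area (@starlike_area R _ (Xp s H) (Xm s H) (Xp_gt0 H s0) (Xm_gt0 H s0) cp cm).
  transitivity (\int[@lebesgue_measure R]_u (ft u)%:E)%E; first by [].
  rewrite I; have E1 : pi + pi / 2 = - (pi / 2) + 2 * pi :> R by field.
  have E2 : pi + - (pi / 2) = pi / 2 :> R by field.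
  by rewrite E1 E2 Tinv2pi; congr EFin; rewrite -[RHS](Yt2pi (Tinv (- (pi / 2)))); ring.
by move=> r u r0; exact: (V1_slope H s0).
Qed.
End InnerArea.

(** * Choice of the parameters *)

Section Weber.
Variable R : realType.

Lemma area_factor_gt0 m (b : R) : small_param m b -> 0 < area_factor m b.
Proof.
case=> m10 b0 hx; have N10 : 10 <= m%:R :> R by rewrite (ler_nat R 10).
rewrite /area_factor; move: (m%:R : R) N10 hx => N N10 hx.
have q0 : 0 < N - 1 by lra.
have h1 : ((N + 1) * b) ^+ 2 <= 1 / 9.
  by rewrite (_ : 1 / 9 = (1 / 3) ^+ 2 :> R) ?ler_sqr ?nnegrE ?mulr_ge0//; [lra|lra|field].
have qb : 0 <= (N - 1) * b by rewrite mulr_ge0//; lra.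
have h2 : (N - 1) ^+ 2 * b ^+ 2 <= 1 / 9.
  by rewrite -exprMn (le_trans _ h1)// ler_sqr ?nnegrE//; nra.
have h3 : N ^+ 2 * b ^+ 2 <= 1 / 9.
  by rewrite -exprMn (le_trans _ h1)// ler_sqr ?nnegrE//; nra.
have h4 : (N - 1) * b ^+ 2 <= 1 / 9.
  by apply: le_trans h2; rewrite ler_wpM2r ?sqr_ge0//; nra.
have h5 : 0 <= N ^+ 2 * b ^+ 2 by rewrite mulr_ge0// sqr_ge0.
have h6 : 0 <= (N - 1) * b ^+ 2 by rewrite mulr_ge0 ?sqr_ge0// ltW.
have d0 : 0 < 1 - (N - 1) ^+ 2 * b ^+ 2 by lra.
rewrite subr_gt0 mulf_div ltr_pdivrMr ?mulr_gt0 ?exprn_gt0// mul1r.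
have -> : 16 * N ^+ 2 * b ^+ 2 = 16 * (N ^+ 2 * b ^+ 2) by ring.
move: h2 h3 h4 h5 h6 d0; set A := N ^+ 2 * _; set D := _ ^+ 2 * b ^+ 2; set B := _ * b ^+ 2.
move=> h2 h3 h4 h5 h6 d0.
(* What remains is 16 (A + A B) <= 160/81 against 9 (64/81) = 576/81. *)
have : A * B <= 1 / 81.
  by rewrite (_ : 1 / 81 = 1 / 9 * (1 / 9)); [rewrite ler_pM|field].
have : 9 * (64 / 81) <= (N - 1) * (1 - D) ^+ 2.
  apply: ler_pM => //; try lra.
  rewrite (_ : 64 / 81 = (8 / 9) ^+ 2); last by field.
  by rewrite ler_sqr ?nnegrE; lra.
lra.
Qed.

(* [45 / (20 N + 32)] bounds [1 - area_factor] when [(m + 1) b = 1 / 3] and [m = N];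
   the two polynomial inequalities have nonnegative coefficients in [N - 10]. *)
Lemma end_value (N : R) : 10 <= N ->
  16 * (N + 1) ^+ 4 * ((N - 1) * (N + 2) ^+ 2 * (2 * N + 1) ^+ 2) <=
  N ^+ 2 * (5 * N + 4) ^+ 2 * ((N - 1) * (N + 2) ^+ 2 * (2 * N + 1) ^+ 2 -
     N ^+ 2 * (9 * (N + 1) ^+ 2 + (N - 1))).
Proof.
move=> N10; have [k k0 NE] : exists2 k, 0 <= k & N = 10 + k.
  by exists (N - 10); [lra|ring].
have ak (a c : R) : 0 <= a -> 0 <= c -> 0 <= a * k + c.
  by move=> a0 c0; rewrite addr_ge0// mulr_ge0.
have h1 : N ^+ 2 * (9 * (N + 1) ^+ 2 + (N - 1)) * (20 * N + 32) <=
   45 * ((N - 1) * (N + 2) ^+ 2 * (2 * N + 1) ^+ 2).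
  rewrite NE -subr_ge0 [leRHS](_ : _ = (((52 * k + 1897) * k + (248 * 100 + 69)) * k + (1355 * 100 + 60)) * k + (2455 * 100 + 20)); last by ring.
  by do 4![apply: (ak _ _); last by rewrite -?natrM -?natrD ler0n].
have h2 : 16 * (N + 1) ^+ 4 * (20 * N + 32) <= N ^+ 2 * (5 * N + 4) ^+ 2 * (20 * N - 13).
  (* (26/29)^2 separates 16 (N + 1)^4 / (N^2 (5 N + 4)^2) from (20 N - 13) / (20 N + 32); at N = 10
     these are about 0.8033 and 0.8060, with 0.8038 in between. *)
  have h3 : 29 * (4 * (N + 1) ^+ 2) <= 26 * (N * (5 * N + 4)).
    rewrite NE -subr_ge0 [leRHS](_ : _ = (14 * k + 152) * k + 4); last by ring.
    by do 2![apply: (ak _ _); last by rewrite -?natrM -?natrD ler0n].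
  have h4 : 29 ^+ 2 * (4 * (N + 1) ^+ 2) ^+ 2 <= 26 ^+ 2 * (N * (5 * N + 4)) ^+ 2.
    rewrite -!exprMn ler_sqr ?nnegrE// !mulr_ge0 ?sqr_ge0//; lra.
  have h5 : (26 ^+ 2 * (20 * N + 32)) / 29 ^+ 2 <= 20 * N - 13.
    by rewrite ler_pdivrMr ?exprn_gt0//; lra.
  rewrite -exprMn (_ : 16 * _ = (4 * (N + 1) ^+ 2) ^+ 2); last by ring.
  move: h4 h5; move: (4 * (N + 1) ^+ 2) (N * (5 * N + 4)) => X Y h4 h5.
  apply: (le_trans _ (ler_wpM2l (sqr_ge0 Y) h5)).
  have -> : Y ^+ 2 * (26 ^+ 2 * (20 * N + 32) / 29 ^+ 2) =
    (20 * N + 32) / 29 ^+ 2 * (26 ^+ 2 * Y ^+ 2) by ring.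
  apply: le_trans (ler_wpM2l _ h4); last by rewrite divr_ge0//; lra.
  have -> : (20 * N + 32) / 29 ^+ 2 * (29 ^+ 2 * X ^+ 2) =
    X ^+ 2 * (20 * N + 32) * (29 ^+ 2 / 29 ^+ 2) by ring.
  by rewrite divff ?mulr1// expf_neq0.
have d0 : 0 < 20 * N + 32 by lra.
have Q0 : 0 <= (N - 1) * (N + 2) ^+ 2 * (2 * N + 1) ^+ 2.
  by rewrite !mulr_ge0 ?sqr_ge0//; lra.
have A0 : 0 <= N ^+ 2 * (5 * N + 4) ^+ 2 by rewrite mulr_ge0 ?sqr_ge0.
rewrite -(ler_pM2r d0); move: h1 h2 Q0 A0 {N10 NE}.
set Q := (N - 1) * _ * _; set A := N ^+ 2 * (5 * N + 4) ^+ 2; set B := _ ^+ 2 * (_ + _).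
move: (_ ^+ 4) => p4 h1 h2 Q0 A0.
have k1 := ler_wpM2r Q0 h2; have k2 := ler_wpM2l A0 h1.
rewrite -subr_ge0; rewrite -subr_ge0 in k1; rewrite -subr_ge0 in k2.
rewrite (_ : _ - _ = (A * (45 * Q) - A * (B * (20 * N + 32))) +
  (A * (20 * N - 13) * Q - 16 * p4 * (20 * N + 32) * Q)); last by ring.
exact: addr_ge0.
Qed.

(** The Weber relation is squared, which removes the root of the area factor, and multiplied by (1 -
    beta^2)^2. It becomes polynomial in b, so the intermediate value theorem for polynomials applies
    on the interval from 0 to 1 / (3 (m + 1)). *)
Lemma param_poly (m : nat) (We : R) : (10 <= m)%N -> m%:R <= We < m%:R + 1 ->
  exists b, small_param m b /\
    We ^+ 2 * area_factor m b * (1 + poleP m b * zeroP m b) ^+ 2 =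
      (m%:R + 1) ^+ 2 * (1 - zeroP m b ^+ 2) ^+ 2.
Proof.
move=> m10 /andP[Wm Wp]; have N10 : 10 <= m%:R :> R by rewrite (ler_nat R 10).
rewrite /small_param /area_factor /poleP /zeroP m10; move: (m%:R : R) N10 Wm Wp => N N10 Wm Wp.
have q0 : 0 < N - 1 by lra.
have p0 : 0 < N + 1 by lra.
pose g (b : R) := We ^+ 2 * ((1 - (N - 1) ^+ 2 * b ^+ 2) ^+ 2 -
   16 * N ^+ 2 / (N - 1) * b ^+ 2 * (1 + (N - 1) * b ^+ 2)) * (1 + (N - 1) * (N + 1) * b ^+ 2) ^+ 2 -
   (N + 1) ^+ 2 * (1 - (N + 1) ^+ 2 * b ^+ 2) ^+ 2 * (1 - (N - 1) ^+ 2 * b ^+ 2) ^+ 2.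
pose P : {poly R} := (We ^+ 2)%:P * ((1 - ((N - 1) ^+ 2)%:P * 'X ^+ 2) ^+ 2 -
   (16 * N ^+ 2 / (N - 1))%:P * 'X ^+ 2 * (1 + (N - 1)%:P * 'X ^+ 2)) *
   (1 + ((N - 1) * (N + 1))%:P * 'X ^+ 2) ^+ 2 -
   ((N + 1) ^+ 2)%:P * (1 - ((N + 1) ^+ 2)%:P * 'X ^+ 2) ^+ 2 * (1 - ((N - 1) ^+ 2)%:P * 'X ^+ 2) ^+ 2.
have PE b : P.[b] = g b by rewrite /P /g !hornerE.
pose b1 : R := (3 * (N + 1))^-1.
have b10 : 0 <= b1 by rewrite invr_ge0; lra.
(* The strict bound We < m + 1 is what keeps the root away from b = 0, the circle. *)
have g0 : g 0 < 0.
  rewrite /g !expr0n /= !(mulr0, mul0r, subr0, addr0, expr1n, mulr1).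
  by rewrite subr_lt0 ltr_sqr ?nnegrE; lra.
have g1 : 0 <= g b1.
  have E := end_value N10.
  have W2 : N ^+ 2 <= We ^+ 2 by rewrite ler_sqr ?nnegrE; lra.
  (* At b1 one has 1 - x^2 = 8/9, 1 - beta^2 = 4 (N + 2) (2 N + 1) / (9 (N + 1)^2) and 1 + beta x =
     2 (5 N + 4) / (9 (N + 1)). *)
  have -> : g b1 = 16 * (We ^+ 2 * (5 * N + 4) ^+ 2 * ((N - 1) * (N + 2) ^+ 2 * (2 * N + 1) ^+ 2 -
     N ^+ 2 * (9 * (N + 1) ^+ 2 + (N - 1))) -
     16 * (N + 1) ^+ 4 * ((N - 1) * (N + 2) ^+ 2 * (2 * N + 1) ^+ 2)) * 4 /
     ((N - 1) * (9 * (N + 1) ^+ 2) ^+ 2 * (9 * (N + 1)) ^+ 2).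
    rewrite /g /b1; field; rewrite !gt_eqF//.
  have h : 0 <= (N - 1) * (N + 2) ^+ 2 * (2 * N + 1) ^+ 2 - N ^+ 2 * (9 * (N + 1) ^+ 2 + (N - 1)).
    have A0 : 0 < N ^+ 2 * (5 * N + 4) ^+ 2 by rewrite mulr_gt0// exprn_gt0//; lra.
    rewrite -(pmulr_rge0 _ A0) (le_trans _ E)// !mulr_ge0 ?exprn_ge0//; lra.
  apply: divr_ge0; last by rewrite !mulr_ge0 ?exprn_ge0 ?mulr_ge0 ?exprn_ge0//; lra.
  apply: mulr_ge0 => //; apply: mulr_ge0 => //; rewrite subr_ge0 (le_trans E)//.
  by rewrite ler_wpM2r// ler_wpM2r// sqr_ge0.
have [||b /andP[b0 bb1] rb] := @poly_ivt R P 0 b1.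
- by [].
- by rewrite !PE (ltW g0) g1.
have gb : g b = 0 by rewrite -PE; apply/rootP.
have bp : 0 < b.
  rewrite lt_neqAle b0 andbT; apply/eqP => b00.
  by move: gb; rewrite -b00 => gb; move: g0; rewrite gb ltxx.
have hx : (N + 1) * b <= 1 / 3.
  by rewrite (le_trans (ler_wpM2l (ltW p0) bb1))// /b1 le_eqVlt; apply/orP; left; apply/eqP; field; rewrite gt_eqF.
exists b; split => //.
have d0 : 0 < 1 - (N - 1) ^+ 2 * b ^+ 2.
  have h : (N - 1) * b <= 1 / 3 by apply: le_trans hx; rewrite ler_wpM2r//; lra.
  have h0 : 0 <= (N - 1) * b by rewrite mulr_ge0// ltW.
  by rewrite -exprMn; move: (_ * b) h h0 => c h h0; nra.
apply: subr0_eq; transitivity (g b / (1 - (N - 1) ^+ 2 * b ^+ 2) ^+ 2).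
  by rewrite /g; field; rewrite exprMn (gt_eqF q0) (gt_eqF d0).
by rewrite gb mul0r.
Qed.
End Weber.

(** * Admissibility, non-circularity and the boundary value problem *)

Section Bubble.
Variable R : realType.
Local Notation C := (plane R).
Implicit Types (z w u v p q n : C).
Variables (m : nat) (b s : R).
Hypothesis H : small_param m b.
Hypothesis s0 : 0 < s.
Local Notation F := (bubble_map m b s).
Local Notation psi := (bubble_psi m b s).
Local Notation S1 := (bubble_curve m b s).
Local Notation U1 := (bubble_ext m b s).
Local Notation beta := (poleP m b).
Local Notation y := (zeroQ m b).

Lemma admissible_small : admissible m b.
Proof.
have inj z1 z2 : 1 <= normc z1 -> 1 <= normc z2 -> Phi m b z1 = Phi m b z2 -> z1 = z2.
  move=> h1 h2 E; apply: (F_inj H s0 (Omega_ext m h1) (Omega_ext m h2)).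
  by rewrite /bubble_map E.
split.
- move=> z z1; have zO := Omega_ext m (ltW z1).
  by have [] := (cderivP (Phi m b) z (dPhi m b z)).1 (cderiv_Phi H (wbeta_neq0 H zO)).
- by move=> z1 z2 /set_mem h1 /set_mem h2; apply: inj; exact: ltW.
- by move=> z1 z2 /set_mem h1 /set_mem h2; apply: inj; rewrite ?h1 ?h2.
Qed.

Lemma F_expi_ray (t w : R) : expi t ^+ m = w%:C -> w + beta != 0 ->
  F (expi t) = (s * ((w + y) / (w + beta)))%:C * expi t.
Proof.
move=> tw w0; have e0 : (w + beta)%:C != 0 :> C.
  by apply: contra w0 => /eqP [->].
have e1 : expi t ^+ m + beta%:C != 0 by rewrite tw -rmorphD.
have -> : (s * ((w + y) / (w + beta)))%:C = s%:C * ((w + y)%:C / (w + beta)%:C) :> C.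
  by rewrite 2!rmorphM fmorphV.
have eD r : w%:C + r%:C = (w + r)%:C :> C by rewrite rmorphD.
rewrite /bubble_map (PhiE H e1) tw !eD.
by move: (s%:C : C) ((w + y)%:C : C) ((w + beta)%:C : C) (expi t) => A B D z; ring.
Qed.

(** The angles 0, tau and - tau with tau = 2 pi / m give z^m = 1 and three distinct points at the
    same distance P > s from 0, so a circle through them is centred at 0. The angle pi / m gives z^m
    = -1 and a point at distance Q < s. *)
Lemma not_circle : ~ is_circle S1.
Proof.
case=> c [r [r0 E]].
have onS (t w : R) : expi t ^+ m = w%:C -> w + beta != 0 ->
  (s * ((w + y) / (w + beta)) * cos t - complex.Re c) ^+ 2 +
  (s * ((w + y) / (w + beta)) * sin t - complex.Im c) ^+ 2 = r ^+ 2.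
  move=> tw w0; have : S1 (F (expi t)) by exists (expi t) => //; exact: normc_expi.
  rewrite E => hr; have <- : normc (F (expi t) - c) ^+ 2 = r ^+ 2 by congr (_ ^+ 2); exact: hr.
  rewrite [RHS]normc_sqr (F_expi_ray tw w0) !ReD !ImD !ReN !ImN ReM ImM.
  by [].
have m0 : (m%:R : R) != 0 by rewrite gt_eqF//; have := @M10 R _ _ H; lra.
have b0 := beta_gt0 H; have /andP[_ b1] := beta_bd H; have y0 := y_gt0 H.
have by_ : beta < y := lt_trans (beta_lt_x H) (x_lt_y H).
have y1 : y < 1 by have /andP[_ h] := y_bd H; lra.
have d1 : 1 + beta != 0 by rewrite gt_eqF//; lra.
have d2 : -1 + beta != 0 by rewrite lt_eqF//; lra.
pose tau : R := 2 * pi / m%:R.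
have etau : expi tau ^+ m = 1%:C.
  by rewrite expiX /tau mulrC divfK// -[2 * pi]add0r expi2pi expi0.
have etau' : expi (- tau) ^+ m = 1%:C.
  by rewrite expiX mulrN /tau [m%:R * _]mulrC divfK// -expi2pi addNr expi0.
have epi : expi (pi / m%:R : R) ^+ m = (-1 : R)%:C.
  by rewrite expiX mulrC divfK// /expi cospi sinpi.
have e0 : expi (0 : R) ^+ m = (1 : R)%:C by rewrite expi0 expr1n.
have S0 : 0 < sin tau.
  have N10 := @M10 R _ _ H; have p0 := pi_gt0 R.
  apply: sin_gt0_pi; rewrite /tau divr_gt0 ?mulr_gt0//=; last by lra.
  rewrite ltr_pdivrMr; last by lra.
  by rewrite mulrC ltr_pM2l//; lra.
have cs := cos2Dsin2 tau; have cs' := cos2Dsin2 (pi / m%:R : R).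
have := onS _ _ epi d2; have := onS _ _ etau d1; have := onS _ _ etau' d1; have := onS _ _ e0 d1.
rewrite cosN sinN cos0 sin0.
have -> : (-1 + y) / (-1 + beta) = (1 - y) / (1 - beta).
  by rewrite -mulrNN -invrN !opprD !opprK.
have Pgt : s < s * ((1 + y) / (1 + beta)).
  by rewrite ltr_pMr// ltr_pdivlMr; lra.
have Qlt : s * ((1 - y) / (1 - beta)) < s.
  by rewrite gtr_pMr// ltr_pdivrMr; lra.
have Q0 : 0 < s * ((1 - y) / (1 - beta)).
  by rewrite mulr_gt0// divr_gt0; lra.
move: Pgt Qlt Q0 cs cs' S0; move: (s * ((1 + y) / (1 + beta))) (s * ((1 - y) / (1 - beta))) (complex.Re c) (complex.Im c).
move: (cos tau) (sin tau) (cos (pi / m%:R)) (sin (pi / m%:R)) => C1 S1' C2 S2 P Q c1 c2 Pgt Qlt Q0 cs cs' S0 h1 h2 h3 h4.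
have P0 : 0 < P by lra.
have c20 : c2 = 0.
  have : P * S1' * c2 = 0 by lra.
  by move/eqP; rewrite !mulf_eq0 (gt_eqF P0) (gt_eqF S0)/= => /eqP.
have C11 : 1 - C1 != 0.
  apply/eqP => h; have S00 : S1' ^+ 2 = 0 by rewrite (_ : C1 = 1) in cs; lra.
  by move/eqP: S00; rewrite sqrf_eq0 gt_eqF.
have c10 : c1 = 0.
  have : P * (1 - C1) * c1 = 0.
    have : P ^+ 2 * (C1 ^+ 2 + S1' ^+ 2) = P ^+ 2 by rewrite cs mulr1.
    move: h1 h2; rewrite c20; lra.
  by move/eqP; rewrite !mulf_eq0 (gt_eqF P0) (negbTE C11)/= => /eqP.
have : Q ^+ 2 = P ^+ 2.
  transitivity (Q ^+ 2 * (C2 ^+ 2 + S2 ^+ 2)); first by rewrite cs' mulr1.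
  by move: h1 h4; rewrite c10 c20; lra.
move/eqP; rewrite eqrXn2 ?ltW// => /eqP; lra.
Qed.

Lemma psi_growth z : U1 z ->
  `|psi z - ln (normc z)| <= `|ln (s * (2 / 5))| + `|ln (s * (5 / 2))|.
Proof.
case=> w w1 <-; have wO := Omega_ext m (ltW w1).
have /andP[] := F_ratio H s0 wO; rewrite (psi_F H s0 wO).
have w0 : 0 < normc w := lt_trans ltr01 w1.
have A0 : 0 < s * (2 / 5) by rewrite mulr_gt0//; lra.
have B0 : 0 < s * (5 / 2) by rewrite mulr_gt0//; lra.
have f0 : 0 < normc (F w) by rewrite normc_gt0 mulf_neq0 ?realC_neq0 ?(Phi_neq0 H).
move: A0 B0 f0 w0; move: (s * (2 / 5)) (s * (5 / 2)) (normc (F w)) (normc w) => A B f r A0 B0 f0 r0.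
rewrite -[_ * r <= _]ler_ln ?posrE ?mulr_gt0// -[_ <= _ * r]ler_ln ?posrE ?mulr_gt0//.
rewrite !lnM ?posrE// => h1 h2; rewrite ler_norml.
have := ler_norm (ln B); have := ler_norm (- ln A).
have := normr_ge0 (ln A); have := normr_ge0 (ln B); rewrite normrN => k1 k2 k3 k4.
by apply/andP; split; lra.
Qed.

Lemma solves_small (We : R) : We = s * We0 m b ->
  solves_free_boundary_problem We (lambda0 m b / s) S1 psi.
Proof.
move=> WE; split; rewrite ?(outer_U1 H s0).
- by split; [exact: psi_C2|exact: psi_harmonic].
- split; last by move=> _ [z z1 <-]; rewrite (psi_F H s0) ?z1 ?ln1//; apply: Omega_ext; rewrite z1.
  apply: continuous_in_subspaceT => _ /set_mem [] [z z1 <-]; apply: (psi_continuous H s0); apply: Omega_ext.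
  + by rewrite z1.
  + exact: ltW.
- exists (`|ln (s * (2 / 5))| + `|ln (s * (5 / 2))|), 0 => z zU _; exact: psi_growth.
- exists (bubble_param m b s); first exact: jordan_gam.
  move=> t; exists (bubble_normal m b s t), (normc (dbubble_map m b s (expi t)))^-1; split.
  + exact: normal_gam.
  + exact: normal_derivative_right.
  + exact: free_boundary.
Qed.
End Bubble.

Theorem proposition4p2 (R : realType) (We : R) (hWe : 10 <= We) :
  exists (m : nat) (b lambda : R) (psi : plane R -> R),
    [/\ (2 <= m)%N, 0 < b & admissible m b] /\
    [/\ CW_potential m b psi,
        ~ is_circle (CW_curve m b),
        area (inner_domain (CW_curve m b)) = pi%:E
      & solves_free_boundary_problem We lambda (CW_curve m b) psi].
Proof.
have We0_ : 0 <= We by lra.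
have m10 : (10 <= Num.truncn We)%N by rewrite Num.Theory.truncn_ge_nat.
have mW : (Num.truncn We)%:R <= We < (Num.truncn We)%:R + 1.
  by have := Num.Theory.truncn_itv We0_; rewrite -natr1.
have [b [H E]] := param_poly m10 mW.
move: (Num.truncn We) m10 mW H E => m m10 mW H E.
have a0 := area_factor_gt0 H.
pose s := (Num.sqrt (area_factor m b))^-1.
have s0 : 0 < s by rewrite invr_gt0 sqrtr_gt0.
have sa : s ^+ 2 * area_factor m b = 1.
  by rewrite exprVn sqr_sqrtr ?ltW// mulVf// gt_eqF.
have b0 : 0 < b by case: H.
have x0 := x_gt0 H; have be0 := beta_gt0 H.
have D0 : 0 < 1 + poleP m b * zeroP m b by rewrite addr_gt0// mulr_gt0.
have WE : We = s * We0 m b.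
  have n0 : 0 <= s * We0 m b.
    have p0 : 0 < m%:R + 1 :> R by rewrite ltr_wpDl.
    have k0 : 0 < 1 - zeroP m b ^+ 2.
      by have /andP[_ h] := x_bd H; rewrite subr_gt0 expr_lt1 ?ltW//; lra.
    by rewrite ltW// mulr_gt0// divr_gt0// mulr_gt0.
  (* [param_poly] provides the squared relation; both sides are nonnegative, so squares may be
     compared. *)
  apply/eqP; rewrite -(@eqrXn2 _ 2) //; apply/eqP.
  transitivity (s ^+ 2 * (We ^+ 2 * area_factor m b * (1 + poleP m b * zeroP m b) ^+ 2) /
     (1 + poleP m b * zeroP m b) ^+ 2).
    transitivity (We ^+ 2 * (s ^+ 2 * area_factor m b)); first by rewrite sa mulr1.
    by field; rewrite gt_eqF.
  by rewrite E /We0; field; rewrite gt_eqF.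
exists m, b, (lambda0 m b / s), (bubble_psi m b s); split.
  by split; [exact: leq_trans m10|exact: b0|exact: admissible_small H s0].
split.
- by move=> z z1; rewrite -[Phi_hat m b z]/(bubble_map m b s z) (psi_F H s0 (Omega_ext m (ltW z1))).
- exact: not_circle H s0.
- by rewrite -[CW_curve m b]/(bubble_curve m b s) (inner_V1 H s0) (area_V1 H s0 sa).
- exact: solves_small.
Qed.
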